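(* Let $\alpha>0$ and $0\le\varepsilon\le4$. If $\mathscr H_\varepsilon(v)<\pi(4+\varepsilon)$ for some $v\in N_\alpha$, then $\mathscr H_\varepsilon$ attains a minimum on $N_\alpha$ at some $u\in N_\alpha$, and $u\in C^\infty([-1,1])$.
   Context: $N_\alpha:=\{u\in H^2(-1,1): u \text{ even},\ u>0 \text{ on }[-1,1],\ u(\pm1)=\alpha,\ u'(\pm1)=0\}$; $\mathscr A(u)=2\pi\int_{-1}^1u\sqrt{1+u'^2}\,dx$, $\mathscr W(u)=\frac\pi2\int_{-1}^1(\frac{1}{u\sqrt{1+u'^2}}-\frac{u''}{(1+u'^2)^{3/2}})^2u\sqrt{1+u'^2}\,dx$, $\mathscr H_\varepsilon=\mathscr W+\varepsilon\mathscr A$. *)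

(* Defs.v *)
From HB Require Import structures.
From mathcomp Require Import all_boot all_order all_algebra.
From mathcomp Require Import all_classical all_reals all_analysis.
Set Implicit Arguments. Unset Strict Implicit. Unset Printing Implicit Defensive.
Import Order.TTheory GRing.Theory Num.Theory.
Import numFieldNormedType.Exports.
Local Open Scope classical_set_scope.
Local Open Scope ring_scope.

Section Defs.
Variable R : realType.
Local Notation mu := (@lebesgue_measure R).

(* H^2(-1,1), via its continuous representative u : R -> R (only the values
   on [-1,1] matter): u = u(-1) + \int_{-1}^x u1, u1 = u1(-1) + \int_{-1}^x w,
   with w in L^2(-1,1).  u1 is the (continuous) first derivative, w the
   (a.e.-defined) second weak derivative. *)
Definition H2 (u : R -> R) : Prop :=
  exists (u1 w : R -> R),
    [/\ mu.-integrable `[-1, 1] (EFin \o w),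
        mu.-integrable `[-1, 1] (fun x => (w x ^+ 2)%:E),
        (forall x, -1 <= x <= 1 ->
           u1 x = u1 (-1) + Rintegral mu `[-1, x] w) &
        (forall x, -1 <= x <= 1 ->
           u x = u (-1) + Rintegral mu `[-1, x] u1)].

Definition N_alpha (alpha : R) (u : R -> R) : Prop :=
  [/\ H2 u,
      (forall x, -1 <= x <= 1 -> u (- x) = u x),
      (forall x, -1 <= x <= 1 -> 0 < u x),
      (u (-1) = alpha /\ u 1 = alpha) &
      ((fun h => h^-1 * (u (1 + h) - u 1)) @ at_left 0 --> 0 /\
       (fun h => h^-1 * (u (-1 + h) - u (-1))) @ at_right 0 --> 0)].

(* first and second derivatives (classical, defined a.e. for u in H^2) *)
Definition d1 (u : R -> R) : R -> R := derive1 u.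
Definition d2 (u : R -> R) : R -> R := derive1 (derive1 u).

Definition Area (u : R -> R) : \bar R :=
  ((2 * pi)%:E * \int[mu]_(x in `[(-1)%R, 1%R]) (u x * Num.sqrt (1 + d1 u x ^+ 2))%:E)%E.

Definition Willmore (u : R -> R) : \bar R :=
  ((pi / 2)%:E * \int[mu]_(x in `[(-1)%R, 1%R])
     (((u x * Num.sqrt (1 + d1 u x ^+ 2))^-1
        - d2 u x / (Num.sqrt (1 + d1 u x ^+ 2)) ^+ 3) ^+ 2
      * (u x * Num.sqrt (1 + d1 u x ^+ 2)))%:E)%E.

Definition Helfrich (eps : R) (u : R -> R) : \bar R :=
  (Willmore u + eps%:E * Area u)%E.

Definition smooth_closed (u : R -> R) : Prop :=
  {within `[-1, 1], continuous u} /\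
  forall n : nat,
    (forall x, -1 < x < 1 -> derivable (iter n (@derive1 R R) u) x 1) /\
    exists g : R -> R, {within `[-1, 1], continuous g} /\
      (forall x, -1 < x < 1 -> g x = iter n (@derive1 R R) u x).

End Defs.

(* Main.v *)
(* With [sigma = u' / sqrt (1 + u'^2)] and [q = sqrt (1 + u'^2)], the Helfrich
   integrand is [1/X + X (sigma'^2 + 4 eps)], [X = u q], up to a null
   Lagrangian.  By AM-GM it dominates the variation of [sigma], so an energy below
   [pi (4 + eps)] (which is at most [4 pi sqrt (1 + eps)] for [eps <= 4]) keeps
   [|sigma|] away from [1]: slopes are bounded, then [u] is bounded below and [u'']
   is bounded in L^2.  Along a minimizing sequence whose slopes converge uniformly,
   the energy is convex in [u''] up to a small error, so midpoints show that [u'']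
   converges strongly in L^2; the limit is a minimizer.  Testing minimality with the
   residual of the twice integrated Euler-Lagrange equation shows that this residual
   vanishes, and bootstrapping gives smoothness. *)
Require Import Defs.
From HB Require Import structures.
From mathcomp Require Import all_boot all_order all_algebra.
From mathcomp Require Import all_classical all_reals all_analysis.
From mathcomp Require Import measurable_realfun ring lra.
Set Implicit Arguments.
Unset Strict Implicit.
Unset Printing Implicit Defensive.
Import Order.TTheory GRing.Theory Num.Theory.
Import numFieldNormedType.Exports.
Local Open Scope ring_scope.
Local Open Scope classical_set_scope.

(** * Integrals and primitives on [[-1, 1]] *)

Section Integration.
Variable R : realType.
Implicit Types (f g h w : R -> R) (x y t k M : R).

Local Notation mu := (@lebesgue_measure R).
Local Notation I := (`[(-1)%R, 1%R]%classic : set R).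

(** The unknown is [w = u''], from which [prim] recovers [u'] and [u]; [N_alpha] turns into linear
    conditions on [w] (even, mean zero) and positivity of [u], so midpoints of competitors are
    competitors. The threshold has a simple origin. As [u] is even, [sigma] is odd; if it vanishes
    at both ends and reaches [1], its total variation is at least [4] over a length [2], so
    [|sigma'|] has mean at least [2]. The AM-GM bound [2 sqrt (sigma'^2 + 4 eps)] is therefore
    replaced by its tangent at [|sigma'| = 2], and integration gives the critical energy
    [4 pi sqrt (1 + eps)]. Two obstacles shape the proof. [Helfrich] is written with classical
    derivatives, so [d2 u] equals [w] only almost everywhere, and its integral has to be identified
    without measurability of the integrand. And [u'] is merely a primitive of an integrable
    function, so the chain rule and integration by parts are derived from an argument on
    increments. *)

Definition integrableI f := mu.-integrable I (EFin \o f).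
Definition integralI f := Rintegral mu I f.
(* [prim f] is the primitive of [f] from [-1] on [-1, 1], extended to all of [R] by
   constants, so that it is continuous on the whole line. *)
Definition prim f x := integralI (fun t => f t * (t <= x)%R%:R).

(** Gives access to the definition of [prim] once it has been made opaque. *)
Lemma prim_integral f x : prim f x = integralI (fun t => f t * (t <= x)%R%:R).
Proof. by []. Qed.

Lemma in_I x : I x <-> -1 <= x <= 1.
Proof. by rewrite /= in_itv. Qed.

Lemma muI : mu I = 2%:E.
Proof.
rewrite lebesgue_measure_itv /= lte_fin ifT; last by lra.
by rewrite -EFinD; congr EFin; lra.
Qed.

Lemma integrableI_measurable f : integrableI f -> measurable_fun I f.
Proof. by move=> /(measurable_int mu) /measurable_EFinP. Qed.

Lemma eq_integrableI f g : {in I, f =1 g} -> integrableI f -> integrableI g.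
Proof. by move=> fg; apply: eq_integrable => // x xI /=; rewrite fg. Qed.

Lemma eq_integralI f g : (forall x, -1 <= x <= 1 -> f x = g x) -> integralI f = integralI g.
Proof. by move=> fg; apply: eq_Rintegral => x; rewrite inE => /in_I; exact: fg. Qed.

Lemma integrableID f g : integrableI f -> integrableI g -> integrableI (fun x => f x + g x).
Proof. by move=> fi gi; apply: eq_integrable (integrableD _ fi gi). Qed.

Lemma integrableIZ k f : integrableI f -> integrableI (fun x => k * f x).
Proof. by move=> fi; apply: eq_integrable (integrableZl _ k fi). Qed.

Lemma integrableIN f : integrableI f -> integrableI (fun x => - f x).
Proof. by move=> /(integrableIZ (-1)); apply: eq_integrableI => x _; rewrite mulN1r. Qed.

Lemma integrableIB f g : integrableI f -> integrableI g -> integrableI (fun x => f x - g x).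
Proof. by move=> fi gi; apply: integrableID => //; apply: integrableIN. Qed.

Lemma integrableI_norm f : integrableI f -> integrableI (fun x => `|f x|).
Proof. by move=> fi; apply: integrable_norm. Qed.

Lemma integrableI_bounded f M : measurable_fun I f ->
  (forall x, -1 <= x <= 1 -> `|f x| <= M) -> integrableI f.
Proof.
move=> mf fM; apply: measurable_bounded_integrable => //.
  by change (mu I < +oo)%E; rewrite muI ltry.
exists M; split; first exact: num_real.
by move=> K MK x /in_I xI; apply: le_trans (fM x xI) (ltW MK).
Qed.

Lemma integrableI_cst k : integrableI (fun=> k).
Proof. by apply: (@integrableI_bounded _ `|k|). Qed.

Lemma integrableI_le f g : measurable_fun I f -> integrableI g ->
  (forall x, -1 <= x <= 1 -> `|f x| <= g x) -> integrableI f.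
Proof.
move=> mf gi fg; apply: (le_integrable _ _ _ gi) => //.
  exact/measurable_EFinP.
move=> x /in_I xI; rewrite /= lee_fin; apply: le_trans (fg x xI) (ler_norm _).
Qed.

Lemma integrableI_mul f g M : integrableI f -> measurable_fun I g ->
  (forall x, -1 <= x <= 1 -> `|g x| <= M) -> integrableI (fun x => f x * g x).
Proof.
move=> fi mg gM; apply: (@integrableI_le _ (fun x => M * `|f x|)).
- by apply: measurable_funM => //; exact: integrableI_measurable.
- by apply/integrableIZ/integrableI_norm.
- by move=> x xI; rewrite normrM mulrC ler_wpM2r // gM.
Qed.

Lemma integralID f g : integrableI f -> integrableI g -> integralI (fun x =>
  f x + g x) = integralI f + integralI g.
Proof. by move=> fi gi; rewrite /integralI RintegralD. Qed.

Lemma integralIB f g : integrableI f -> integrableI g -> integralI (fun x =>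
  f x - g x) = integralI f - integralI g.
Proof. by move=> fi gi; rewrite /integralI RintegralB. Qed.

Lemma integralIZ k f : integrableI f -> integralI (fun x => k * f x) = k * integralI f.
Proof. by move=> fi; rewrite /integralI RintegralZl. Qed.

Lemma integralI_cst k : integralI (fun=> k) = k * 2.
Proof. by rewrite /integralI Rintegral_cst // -[fine _]/(fine (mu I)) muI. Qed.

Lemma integralI_le f g : integrableI f -> integrableI g -> (forall x, -1 <= x <= 1 -> f x <= g x) ->
  integralI f <= integralI g.
Proof. by move=> fi gi fg; apply: le_Rintegral => // x /in_I; exact: fg. Qed.

Lemma integralI_ge0 f : (forall x, -1 <= x <= 1 -> 0 <= f x) -> 0 <= integralI f.
Proof. by move=> f0; apply: Rintegral_ge0 => x /in_I; exact: f0. Qed.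

Lemma integralI_norm f : integrableI f -> `|integralI f| <= integralI (fun x => `|f x|).
Proof. by move=> fi; apply: le_normr_Rintegral. Qed.

Lemma integralI_E f : integrableI f -> (\int[mu]_(x in I) (f x)%:E = (integralI f)%:E)%E.
Proof. by move=> fi; rewrite /integralI /Rintegral fineK //; apply: integrable_fin_num. Qed.

Lemma measurable_ind x : measurable_fun I (fun t => (t <= x)%R%:R : R).
Proof.
rewrite (_ : (fun _ => _) = \1_(`]-oo, x]%classic : set R)).
  exact: measurable_indic.
apply/funext => t; rewrite indicE; congr (_%:R).
by apply/esym; rewrite (_ : (t <= x) = (t \in `]-oo, x])) ?in_itv //= mem_setE.
Qed.

Lemma integrableI_ind f x : integrableI f -> integrableI (fun t => f t * (t <= x)%R%:R).
Proof.
move=> fi; apply: (@integrableI_mul _ _ 1) => //; first exact: measurable_ind.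
by move=> t _; case: (t <= x); rewrite ?normr1 ?normr0.
Qed.
Hint Resolve integrableI_ind : core.

Lemma primE f x : -1 <= x <= 1 -> prim f x = Rintegral mu `[-1, x] f.
Proof.
move=> /andP[x1 x2].
rewrite (_ : `[-1, x]%classic = I `&` (`]-oo, x]%classic : set R)); last first.
  apply/seteqP; split => t /=; rewrite !in_itv /=.
    by move=> /andP[-> tx]; rewrite tx (le_trans tx x2).
  by move=> [/andP[-> _] ->].
rewrite Rintegral_mkcondr; apply: eq_Rintegral => t _.
rewrite patchE mem_setE in_itv /=.
by case: (t <= x); rewrite ?mulr1 ?mulr0.
Qed.

Lemma primD f g x : integrableI f -> integrableI g -> prim (fun t =>
  f t + g t) x = prim f x + prim g x.
Proof. by move=> fi gi; rewrite /prim -integralID; auto; apply: eq_integralI => t _;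
  rewrite mulrDl. Qed.

Lemma primB f g x : integrableI f -> integrableI g -> prim (fun t =>
  f t - g t) x = prim f x - prim g x.
Proof. by move=> fi gi; rewrite /prim -integralIB; auto; apply: eq_integralI => t _;
  rewrite mulrBl. Qed.

Lemma primZ k f x : integrableI f -> prim (fun t => k * f t) x = k * prim f x.
Proof. by move=> fi; rewrite /prim -integralIZ; auto; apply: eq_integralI => t _;
  rewrite mulrA. Qed.

Lemma eq_prim f g x : (forall t, -1 <= t <= 1 -> f t = g t) -> prim f x = prim g x.
Proof. by move=> fg; apply: eq_integralI => t tI; rewrite fg. Qed.

Lemma prim_ge1 f x : 1 <= x -> prim f x = integralI f.
Proof.
move=> x1; apply: eq_integralI => t /andP[_ t1].
by rewrite (le_trans t1 x1) mulr1.
Qed.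

Lemma prim1 f : prim f 1 = integralI f. Proof. exact: prim_ge1. Qed.

Lemma prim_leN1 f x : x <= -1 -> prim f x = 0.
Proof.
rewrite le_eqVlt => /predU1P[->|x1].
  by rewrite primE ?lexx ?lerN10 ?ge0_cp // ?set_itv1 ?Rintegral_set1 //; lra.
transitivity (integralI (fun=> 0)); last by rewrite integralI_cst mul0r.
apply: eq_integralI => t /andP[t1 _].
by rewrite leNgt (lt_le_trans x1 t1) mulr0.
Qed.

Lemma primN1 f : prim f (-1) = 0. Proof. exact: prim_leN1. Qed.

Lemma prim_sub f h x y : integrableI f -> integrableI h -> x <= y ->
  (forall t, -1 <= t <= 1 -> x <= t <= y -> `|f t| <= h t) ->
  `|prim f y - prim f x| <= prim h y - prim h x.
Proof.
move=> fi hi xy fh.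
rewrite /prim -!integralIB; auto.
apply: le_trans (integralI_norm _) _; first by apply: integrableIB; auto.
apply: integralI_le; [by apply/integrableI_norm/integrableIB; auto|by apply: integrableIB;
  auto|] => t tI.
case: (leP t x) => [tx|xt]; first by rewrite (le_trans tx xy) !mulr1 !subrr normr0.
case: (leP t y) => ty; last by rewrite !mulr0 !subrr normr0.
by rewrite !mulr0 !mulr1 !subr0 fh // ty ltW.
Qed.

Lemma prim_mono h x y : integrableI h -> (forall t, -1 <= t <= 1 -> 0 <= h t) -> x <= y ->
  prim h x <= prim h y.
Proof.
move=> hi h0 xy; rewrite -subr_ge0.
apply: le_trans (normr_ge0 _) (@prim_sub (fun=> 0) h x y _ hi xy _).
  exact: integrableI_cst.
by move=> t tI _; rewrite normr0 h0.
Qed.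

(** A form of [prim_sub] indifferent to the order of [x] and [y]: the bound on [f] is asked at
    distance at most [|y - x|] from [x], which is what continuity at [x] provides. *)
Lemma prim_dist f h x y : integrableI f -> integrableI h -> (forall t, -1 <= t <= 1 -> 0 <= h t) ->
  (forall t, -1 <= t <= 1 -> `|t - x| <= `|y - x| -> `|f t| <= h t) ->
  `|prim f y - prim f x| <= `|prim h y - prim h x|.
Proof.
move=> fi hi h0 fh; case: (leP x y) => [xy|/ltW yx].
  apply: le_trans (ler_norm _); apply: prim_sub => // t tI /andP[xt ty].
  by apply: fh => //; rewrite !ger0_norm ?subr_ge0 // lerD2r.
rewrite distrC [leRHS]distrC.
apply: le_trans (ler_norm _); apply: prim_sub => // t tI /andP[yt tx].
by apply: fh => //; rewrite !ler0_norm ?subr_le0 // lerN2 lerD2r.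
Qed.

Lemma prim_distN f x y : integrableI f -> `|prim f y - prim f x| <= `|prim (fun t =>
  `|f t|) y - prim (fun t => `|f t|) x|.
Proof. by move=> fi; apply: prim_dist => //; exact: integrableI_norm. Qed.

Lemma prim_bound f x : integrableI f -> `|prim f x| <= integralI (fun t => `|f t|).
Proof.
move=> fi; apply: le_trans (integralI_norm _) _; auto; apply: integralI_le;
  [|exact: integrableI_norm|].
  by apply: integrableI_norm; auto.
by move=> t tI; rewrite normrM ler_piMr //; case: (t <= x); rewrite ?normr1 ?normr0.
Qed.

(** * Continuity and differentiation of primitives *)

Definition clamp x : R := Num.max (-1) (Num.min x 1).

Lemma clampI x : -1 <= clamp x <= 1.
Proof.
rewrite /clamp; case: (leP x 1) => ?.
  by case: (leP (-1) x) => ?; apply/andP; split; lra.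
by case: (leP (-1 : R) 1) => ?; apply/andP; split; lra.
Qed.

Lemma clamp_dist x y : `|clamp y - clamp x| <= `|y - x|.
Proof.
suff mono a b : a <= b -> `|clamp b - clamp a| <= b - a.
  case: (leP x y) => [xy|/ltW yx]; first by apply: le_trans (mono _ _ xy) (ler_norm _).
  by rewrite distrC [leRHS]distrC; apply: le_trans (mono _ _ yx) (ler_norm _).
move=> ab; rewrite ler_norml /clamp.
case: (leP a 1) => ?; case: (leP b 1) => ?; try lra.
- by case: (leP (-1) a) => ?; case: (leP (-1) b) => ?; apply/andP; split; lra.
- by case: (leP (-1) a) => ?; case: (leP (-1 : R) 1) => ?; apply/andP; split; lra.
Qed.

Lemma prim_clamp f x : prim f x = prim f (clamp x).
Proof.
rewrite /clamp; case: (leP x 1) => x1; case: leP => x2 //.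
- by rewrite primN1 prim_leN1 // ltW.
- by rewrite prim1 prim_ge1 // ltW.
- lra.
Qed.

Lemma prim_one x : -1 <= x <= 1 -> prim (fun=> 1) x = x + 1.
Proof.
move=> xI; rewrite primE // Rintegral_cst // mul1r.
transitivity (fine (mu `[-1, x])) => //.
rewrite lebesgue_measure_itv /= lte_fin.
case: ltP => [|x1]; first by rewrite /= opprK.
by move/andP: xI => [x2 _]; rewrite /=; lra.
Qed.

Lemma prim_one_dist x y : `|prim (fun=> 1) y - prim (fun=> 1) x| <= `|y - x|.
Proof.
rewrite prim_clamp (prim_clamp _ x) !prim_one ?clampI //.
by rewrite opprD addrACA subrr addr0 clamp_dist.
Qed.

(** Continuity within [[-1, 1]] passes to the whole line because [prim f] factors through the
    1-Lipschitz map [clamp]. *)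
Lemma continuous_prim f : integrableI f -> continuous (prim f).
Proof.
move=> fi x.
have /subspace_continuousP c : {within I, continuous (prim f)}.
  have := @parameterized_integral_continuous _ (-1) 1 f (ltac:(lra)) fi.
  apply: subspace_eq_continuous.
  by move=> y; rewrite inE => /in_I yI; rewrite /from_subspace primE.
have /cvgrPdist_lt cx := c (clamp x) ((in_I _).2 (clampI x)).
apply/cvgrPdist_lt => e e0; have /nbhs_ballP[d /= d0 cd] := cx e e0.
apply/nbhs_ballP; exists d => //= y; rewrite /ball /= => xy.
rewrite (prim_clamp _ x) (prim_clamp _ y); apply: cd; last exact/in_I/clampI.
by rewrite /ball /= distrC (le_lt_trans (clamp_dist _ _)) // distrC.
Qed.

Lemma prim_derive f x : integrableI f -> -1 < x < 1 -> {for x, continuous f} ->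
  is_derive x 1 (prim f) (f x).
Proof.
move=> fi /andP[x1 x2] fx.
have [] := @continuous_FTC1_closed _ f (-1) x 1 x2 fi x1 fx.
set F := fun _ => _ => dF F'.
have FP : {near x, F =1 prim f}.
  near=> y; rewrite primE //; apply/andP; split; apply: ltW; near: y.
    exact: lt_nbhsr. exact: lt_nbhsl.
split; first by apply: near_eq_derivable dF.
by rewrite -F' derive1E; apply/esym/near_eq_derive.
Unshelve. all: by end_near. Qed.

(** Covers the end points [a = 1] and [a = -1], where the boundary conditions of [N_alpha] are
    one-sided limits. The linear term is the increment of the primitive of the constant [f a], so
    the remainder is that of [f - f a], which is small near [a]. *)
Lemma prim_slope f (a k : R) : continuous f -> -1 <= a <= 1 -> 0 < k ->
  \forall y \near a, -1 <= y <= 1 ->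
   `|prim f y - prim f a - f a * (y - a)| <= k * `|y - a|.
Proof.
move=> fc aI k0; have fi : integrableI f.
  apply: continuous_compact_integrable; first exact: segment_compact.
  exact: continuous_subspaceT.
have /cvgrPdist_le /(_ k k0) := fc a.
move=> /nbhs_ballP[e /= e0 He]; apply/nbhs_ballP; exists e => // y.
rewrite /ball /= => ya yI.
have c1 (x k' : R) : -1 <= x <= 1 -> prim (fun=> k') x = k' * (x + 1).
  move=> xI; rewrite (eq_prim (g := fun t => k' * 1)) => [|t _]; last by rewrite mulr1.
  by rewrite primZ ?prim_one //; exact: integrableI_cst.
have -> : prim f y - prim f a - f a * (y - a) =
    prim (fun x => f x - f a) y - prim (fun x => f x - f a) a.
  by rewrite !primB //; try exact: integrableI_cst; rewrite !c1 //; ring.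
apply: le_trans (_ : `|prim (fun=> k) y - prim (fun=> k) a| <= _); last first.
  by rewrite !c1 // -mulrBr normrM gtr0_norm // opprD addrACA subrr addr0.
apply: prim_dist; [by apply: integrableIB => //; exact: integrableI_cst|exact: integrableI_cst| |].
  by move=> t _; exact: ltW.
move=> t tI ta; rewrite distrC; apply: He.
by rewrite /ball /= distrC (le_lt_trans ta) // distrC.
Qed.

Lemma prim_eq0 f x : continuous f -> (forall y, -1 <= y <= 1 -> prim f y = 0) ->
  -1 < x < 1 -> f x = 0.
Proof.
move=> fc f0 xI.
have fi : integrableI f.
  apply: continuous_compact_integrable; first exact: segment_compact.
  exact: continuous_subspaceT.
have [_ <-] := prim_derive fi xI (fc x).
have -> : 'D_1 (prim f) x = 'D_1 (cst 0 : R -> R) x.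
  case/andP: xI => x1 x2; apply: near_eq_derive; near=> y; apply: f0.
  apply/andP; split; apply: ltW; near: y.
    exact: lt_nbhsr. exact: lt_nbhsl.
by rewrite derive_cst.
Unshelve. all: by end_near. Qed.

(* Continuous induction: only a local bound of the increments of [D] by those of
   [H] is needed, no differentiability. *)
Lemma increment_le (D H : R -> R) (a b k : R) : a <= b ->
  (forall x y, a <= x -> x <= y -> y <= b -> H x <= H y) ->
  (forall x, a <= x <= b -> \forall y \near x, a <= y <= b ->
     `|D y - D x| <= k * `|H y - H x|) ->
  `|D b - D a| <= k * (H b - H a).
Proof.
move=> ab mH loc.
(* The points up to which the estimate has propagated from [a]. The local bound puts the supremum in
   [S], and would push it further if it were below [b]. *)
pose S := [set x | a <= x <= b /\ `|D x - D a| <= k * (H x - H a)].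
have Sa : S a by split; [rewrite lexx ab|rewrite !subrr normr0 mulr0].
have Sb : ubound S b by move=> x [/andP[]].
have supS : has_sup S by split; [exists a|exists b].
set s := sup S.
have as_ : a <= s by apply: ub_le_sup => //; exists b.
have sb : s <= b by apply: ge_sup => //; exists a.
have [d /= d0 dP] : exists2 d, 0 < d & forall y, `|s - y| < d -> a <= y <= b ->
    `|D y - D s| <= k * `|H y - H s|.
  have /nbhs_ballP[d d0 dP] := loc s (ltac:(by rewrite as_ sb)).
  by exists d => // y yd; apply: dP.
have Ss : S s.
  split; first by rewrite as_ sb.
  have [x [/andP[ax xb] Sx] sx] := sup_adherent d0 supS.
  have xs : x <= s by apply: ub_le_sup; [exists b|split=> //; rewrite ax xb].
  have := dP x; rewrite ger0_norm ?subr_ge0 // ltrBlDl -ltrBlDr.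
  move=> /(_ sx (ltac:(by rewrite ax xb))) h.
  have mxs : H x <= H s by apply: mH.
  have -> : D s - D a = (D s - D x) + (D x - D a) by ring.
  apply: le_trans (ler_normD _ _) _.
  have -> : k * (H s - H a) = k * `|H x - H s| + k * (H x - H a).
    by rewrite ler0_norm ?subr_le0 //; ring.
  by apply: lerD => //; rewrite distrC.
have [sltb|bs] := ltP s b; last first.
  by have -> : b = s by [apply/eqP; rewrite eq_le bs sb]; case: Ss.
pose y := Num.min b (s + d / 2).
have sy : s < y by rewrite /y lt_min sltb ltrDl divr_gt0.
have yb : y <= b by rewrite /y ge_min lexx.
have ysd : `|s - y| < d.
  rewrite ltr0_norm ?subr_lt0 // opprB ltrBlDl (le_lt_trans (_ : _ <= s + d / 2)) //.
    by rewrite /y ge_min lexx orbT.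
  by lra.
have yI : a <= y <= b by rewrite yb (le_trans as_ (ltW sy)).
suff : S y by move=> /(ub_le_sup (ex_intro _ b Sb)); rewrite leNgt sy.
split=> //.
have h := dP y ysd yI.
have msy : H s <= H y by apply: mH => //; exact: ltW.
have -> : D y - D a = (D y - D s) + (D s - D a) by ring.
apply: le_trans (ler_normD _ _) _.
have -> : k * (H y - H a) = k * `|H y - H s| + k * (H s - H a).
  by rewrite ger0_norm ?subr_ge0 //; ring.
by apply: lerD => //; case: Ss.
Qed.

(** [increment_le] bounds [|D b - D a|] by [k * (H b - H a)] for every [k > 0]. The [+ 1] in the
    choice of [k] covers the case [H b = H a]. *)
Lemma increment_eq0 (D H : R -> R) (a b : R) : a <= b ->
  (forall x y, a <= x -> x <= y -> y <= b -> H x <= H y) ->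
  (forall k, 0 < k -> forall x, a <= x <= b -> \forall y \near x, a <= y <= b ->
     `|D y - D x| <= k * `|H y - H x|) ->
  D b = D a.
Proof.
move=> ab mH loc; apply/eqP; rewrite -subr_eq0 -normr_le0.
have Hab : H a <= H b by apply: mH.
apply/ler_addgt0Pl => e e0; rewrite addr0.
pose k := e / (H b - H a + 1).
have k0 : 0 < k by rewrite divr_gt0 // ltr_wpDl // subr_ge0.
apply: le_trans (increment_le ab mH (loc k k0)) _.
rewrite /k mulrAC ler_pdivrMr ?ltr_wpDl ?subr_ge0 // ler_wpM2l //; lra.
Qed.

Lemma is_derive_increment (G : R -> R) (z d : R) : is_derive z 1 G d ->
  forall k, 0 < k -> \forall y \near z, `|G y - G z - d * (y - z)| <= k * `|y - z|.
Proof.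
move=> [dG Gd] k k0.
have := derivable_nbhs dG; rewrite Gd => /eqaddoP /(_ k k0).
move=> /nbhs_ballP[e /= e0 He]; apply/nbhs_ballP; exists e => // y.
rewrite /ball /= => yz.
have := He (y - z); rewrite /ball /= sub0r normrN distrC => /(_ yz).
by rewrite /= opprD /cst /= -![(_ + _ : _ -> _) _]/(_ + _) -![(- _ : _ -> _) _]/(- _)
 -[_%:A]/((y - z) * 1) -[_ *: _]/((y - z) * d) mulr1 subrK addrA
  [d * _]mulrC [`|z - y|]distrC.
Qed.

(* [w] need not be continuous: [increment_eq0] applies with [H] the primitive of
   [`|w|]. *)
Lemma prim_chain (G g : R -> R) (c : R) w x : integrableI w ->
  (forall y, -1 <= y <= 1 -> is_derive (c + prim w y) 1 G (g (c + prim w y))) ->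
  continuous (fun y => g (c + prim w y)) ->
  integrableI (fun y => g (c + prim w y) * w y) -> -1 <= x <= 1 ->
  G (c + prim w x) = G c + prim (fun y => g (c + prim w y) * w y) x.
Proof.
move=> wi dG gc gwi /andP[x1 x2].
pose F y := g (c + prim w y) * w y.
pose h t := `|w t|; have hi : integrableI h by exact: integrableI_norm.
have h0 t : -1 <= t <= 1 -> 0 <= h t by move=> _; exact: normr_ge0.
suff : G (c + prim w x) - prim F x = G (c + prim w (-1)) - prim F (-1).
  by rewrite !primN1 addr0 subr0 => <-; rewrite subrK.
apply: (@increment_eq0 (fun y => G (c + prim w y) - prim F y) (prim h)) => //.
  by move=> y z _ yz _; apply: prim_mono.
move=> k k0 y /andP[y1 y2].
have y11 : -1 <= y <= 1 by rewrite y1 (le_trans y2 x2).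
have k20 : 0 < k / 2 by rewrite divr_gt0.
have pc : {for y, continuous (fun z => c + prim w z)}.
  by apply: cvgD; [exact: cvg_cst|exact: continuous_prim].
have near1 : \forall z \near y, `|G (c + prim w z) - G (c + prim w y) - g (c + prim w y) *
    (c + prim w z - (c + prim w y))| <= k / 2 * `|c + prim w z - (c + prim w y)|.
  exact: (pc _ (is_derive_increment (dG y y11) k20)).
have near2 : \forall z \near y, forall t, `|t - y| <= `|z - y| ->
    `|g (c + prim w t) - g (c + prim w y)| <= k / 2.
  have /cvgrPdist_le := gc y => /(_ _ k20) /nbhs_ballP[e /= e0 He].
  apply/nbhs_ballP; exists e => // z; rewrite /ball /= distrC => ze t tz.
  by rewrite distrC; apply: He; rewrite /ball /= distrC (le_lt_trans tz).
near=> z => _.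
have n1 : `|G (c + prim w z) - G (c + prim w y) - g (c + prim w y) *
    (c + prim w z - (c + prim w y))| <= k / 2 * `|c + prim w z - (c + prim w y)| by near: z.
have n2 : forall t, `|t - y| <= `|z - y| ->
    `|g (c + prim w t) - g (c + prim w y)| <= k / 2 by near: z.
set G1 := G (c + prim w z); set G0 := G (c + prim w y); set g0 := g (c + prim w y).
(* The increment splits into the first-order remainder of [G] and the increment of a primitive of
   [(g (c + prim w) - g0) * w]; each is at most [k / 2] times the increment of the primitive of
   [|w|]. *)
have -> : G1 - prim F z - (G0 - prim F y) = (G1 - G0 - g0 * (c + prim w z - (c + prim w y)))
   - ((prim F z - g0 * prim w z) - (prim F y - g0 * prim w y)) by ring.
have -> : k * `|prim h z - prim h y| =
  k / 2 * `|prim h z - prim h y| + k / 2 * `|prim h z - prim h y| by field.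
apply: le_trans (ler_normB _ _) _; apply: lerD.
  apply: le_trans n1 _; rewrite ler_wpM2l ?(ltW k20) //.
  by rewrite opprD addrACA subrr add0r prim_distN.
rewrite -!(primZ g0) // -!primB //; try exact: integrableIZ.
have -> : k / 2 * `|prim h z - prim h y| =
  `|prim (fun t => k / 2 * h t) z - prim (fun t => k / 2 * h t) y|.
  by rewrite !primZ // -mulrBr normrM (gtr0_norm k20).
apply: prim_dist; [by apply: integrableIB => //; exact: integrableIZ|exact: integrableIZ| |].
  by move=> t tI; rewrite mulr_ge0 ?h0 // ltW.
by move=> t tI ty; rewrite /F -mulrBl normrM ler_wpM2r ?n2.
Unshelve. all: by end_near. Qed.

Lemma continuous_integrableI (g : R -> R) : continuous g -> integrableI g.
Proof.
move=> gc; apply: continuous_compact_integrable; first exact: segment_compact.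
exact: continuous_subspaceT.
Qed.

Lemma continuous_bounded_itv (g : R -> R) : continuous g ->
  exists2 M, 0 <= M & forall x, -1 <= x <= 1 -> `|g x| <= M.
Proof.
move=> gc; have [c _ cP] := @EVT_max R (fun x => `|g x|) (-1) 1 (ltac:(lra))
  (continuous_subspaceT (fun x => @cvg_norm _ _ _ _ _ _ _ (gc x))).
by exists `|g c| => // x xI; apply: cP; rewrite in_itv.
Qed.

Lemma continuous_measurable_itv (g : R -> R) : continuous g -> measurable_fun I g.
Proof. by move=> /continuous_integrableI /integrableI_measurable. Qed.

Lemma integrableI_mulc f g : integrableI f -> continuous g -> integrableI (fun x => f x * g x).
Proof.
move=> fi gc; have [M _ gM] := continuous_bounded_itv gc.
exact: integrableI_mul fi (continuous_measurable_itv gc) gM.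
Qed.

Lemma continuous_addr_prim f c : integrableI f -> continuous (fun x => c + prim f x).
Proof. by move=> fi x; apply: cvgD; [exact: cvg_cst|exact: continuous_prim]. Qed.

(** The chain rule for the square; its polarisation is integration by parts, so that no separate
    product rule is required. *)
Lemma integralI_sqr c w : integrableI w ->
  (c + integralI w) ^+ 2 - c ^+ 2 = 2 * integralI (fun x => w x * (c + prim w x)).
Proof.
move=> wi; have wi2 : integrableI (fun x => w x * (c + prim w x)).
  by apply: integrableI_mulc => //; exact: continuous_addr_prim.
rewrite -integralIZ // -prim1.
have dsq y : -1 <= y <= 1 ->
    is_derive (c + prim w y) 1 (fun x => x ^+ 2) (2 * (c + prim w y)).
  move=> _; apply: is_derive_eq; rewrite /=.
  by rewrite -[_ *: _]/(_ * _); ring.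
rewrite (@prim_chain (fun x => x ^+ 2) (fun x => 2 * x) c w 1 wi dsq) //.
- rewrite addrAC subrr add0r prim1; apply: eq_integralI => x _; ring.
- by move=> y; apply: cvgM; [exact: cvg_cst|exact: continuous_addr_prim].
- by apply: eq_integrableI (integrableIZ 2 wi2) => x _; ring.
- by apply/andP; split; lra.
Qed.

(* Polarisation of [integralI_sqr]. *)
Lemma prim_prod (a b : R -> R) (ca cb : R) : integrableI a -> integrableI b ->
  integralI (fun x => a x * (cb + prim b x)) =
  (ca + integralI a) * (cb + integralI b) - ca * cb - integralI (fun x => b x * (ca + prim a x)).
Proof.
move=> ai bi.
have i1 : integrableI (fun y => a y * (cb + prim b y)) by apply: integrableI_mulc => //;
  exact: continuous_addr_prim.
have i2 : integrableI (fun y => b y * (ca + prim a y)) by apply: integrableI_mulc => //;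
  exact: continuous_addr_prim.
have i3 : integrableI (fun y => a y * (ca + prim a y)) by apply: integrableI_mulc => //;
  exact: continuous_addr_prim.
have i4 : integrableI (fun y => b y * (cb + prim b y)) by apply: integrableI_mulc => //;
  exact: continuous_addr_prim.
have i12 := integrableID i1 i2; have i34 := integrableID i3 i4.
have e1 := integralI_sqr (ca + cb) (integrableID ai bi).
have e2 := integralI_sqr (ca - cb) (integrableIB ai bi).
rewrite integralID // in e1; rewrite integralIB // in e2.
rewrite (_ : integralI (fun x => _ * (_ + _)) = integralI (fun x =>
  (a x * (ca + prim a x) + b x * (cb + prim b x)) +
  (a x * (cb + prim b x) + b x * (ca + prim a x)))) in e1; last first.
  by apply: eq_integralI => x _; rewrite primD //; ring.
rewrite (_ : integralI (fun x => _ * (_ + _)) = integralI (fun x =>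
  (a x * (ca + prim a x) + b x * (cb + prim b x)) -
  (a x * (cb + prim b x) + b x * (ca + prim a x)))) in e2; last first.
  by apply: eq_integralI => x _; rewrite primB //; ring.
rewrite integralID // [integralI (fun x => a x * (cb + prim b x) + _)]integralID // in e1.
rewrite integralIB // [integralI (fun x => a x * (cb + prim b x) + _)]integralID // in e2.
move: e1 e2; set X := integralI _; set Y := integralI _; set Z := integralI _; set V := integralI _.
by move: (integralI a) (integralI b) X Y Z V => A B X Y Z V; clear; lra.
Qed.

(** * Reflection and parity *)

Lemma opp_preimage_I : (-%R : R -> R) @^-1` I = I.
Proof. by rewrite opp_preimage_itvbndbnd /= opprK. Qed.

Lemma integralI_opp f : integrableI f -> integrableI (fun x => f (- x)) /\ integralI (fun x =>
  f (- x)) = integralI f.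
Proof.
(* Extension by zero is measurable on the whole line, as composition with the reflection and the
   push-forward formula require. *)
move=> fi; pose f1 := f \_ I.
have mf1 : measurable_fun setT f1.
  by apply/(measurable_restrictT _ _).1 => //; exact: integrableI_measurable.
have f1E : {in I, f =1 f1} by move=> x xI; rewrite /f1 patchE xI.
have f1i : integrableI f1 by exact: eq_integrableI fi.
have mopp : measurable_fun setT (-%R : R -> R) by exact: oppr_measurable.
have push (h : R -> \bar R) :
    (\int[pushforward mu (-%R : _ -> measurableTypeR R)]_(y in I) h y = \int[mu]_(y in I) h y)%E.
  by apply: eq_measure_integral => A mA _; exact: lebesgue_measureN.
have f1oi : integrableI (f1 \o -%R).
  apply/integrableP; split.
    by apply/measurable_EFinP/measurable_funTS; exact: measurableT_comp.
  have /integrableP[_] := f1i.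
  rewrite -push ge0_integral_pushforward //=; last first.
    by apply: measurable_funTS; do 2 apply: measurableT_comp => //.
  by rewrite opp_preimage_I.
have eo : {in I, (f1 \o -%R) =1 (fun x => f (- x))}.
  move=> x; rewrite inE -{1}opp_preimage_I => xI /=.
  by rewrite /f1 patchE mem_set.
split; first exact: eq_integrableI f1oi.
have -> : integralI f = integralI f1 by exact: eq_Rintegral.
have <- : integralI (f1 \o -%R) = integralI (fun x => f (- x)) by exact: eq_Rintegral.
rewrite /integralI /Rintegral; congr fine; rewrite -[RHS]push integral_pushforward //=.
- by rewrite opp_preimage_I.
- by apply: measurableT_comp.
- by rewrite opp_preimage_I.
Qed.

Lemma prim_opp f x : integrableI f -> prim f (- x) = integralI f - prim (fun t => f (- t)) x.
Proof.
move=> fi; have [foi _] := integralI_opp fi.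
rewrite -(proj2 (integralI_opp fi)) /prim -(proj2 (integralI_opp (integrableI_ind (- x) fi))).
rewrite -integralIB //; last exact: integrableI_ind.
(* the two integrands only differ at the point [x] *)
rewrite /integralI /Rintegral; congr fine; apply: ae_eq_integral => //.
- by apply/measurable_EFinP; exact: integrableI_measurable (proj1 (integralI_opp (integrableI_ind (- x) fi))).
- by apply/measurable_EFinP; apply: integrableI_measurable; apply: integrableIB => //;
  exact: integrableI_ind.
- exists [set x]; split => //; first exact: lebesgue_measure_set1.
  move=> t /= /not_implyP[_] nt; apply: contrapT => tx; apply: nt.
  congr EFin; case: (ltgtP t x) => txx.
  + by rewrite lerN2 leNgt txx /= mulr0 mulr1 subrr.
  + by rewrite lerN2 (ltW txx) mulr0 mulr1 subr0.
  + by rewrite txx in tx.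
Qed.

Lemma prim_even f x : integrableI f -> (forall t,
  -1 <= t <= 1 -> f (- t) = f t) -> integralI f = 0 ->
  prim f (- x) = - prim f x.
Proof. by move=> fi fe f0; rewrite prim_opp // f0 sub0r (eq_prim x fe). Qed.

Lemma integralI_odd f : integrableI f -> (forall t,
  -1 <= t <= 1 -> f (- t) = - f t) -> integralI f = 0.
Proof.
move=> fi fo; have [_ e] := integralI_opp fi.
have : integralI (fun x => f (- x)) = - integralI f.
  by rewrite (eq_integralI fo) -[RHS]mulN1r -integralIZ //; apply: eq_integralI => t _;
    rewrite mulN1r.
by rewrite e => h; lra.
Qed.

Lemma prim_odd f x : integrableI f -> (forall t, -1 <= t <= 1 -> f (- t) = - f t) ->
  prim f (- x) = prim f x.
Proof.
move=> fi fo; rewrite prim_opp // integralI_odd // sub0r (eq_prim x fo).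
by rewrite -mulN1r -primZ ?(eq_prim (g:=f)) //; [move=> t _;
  ring|apply: eq_integrableI (integrableIN fi)].
Qed.

End Integration.

#[global] Opaque integralI prim.

(** * The energy as a functional of [u''], and a priori bounds *)

Section Energy.
Variable R : realType.
Implicit Types (f g h w : R -> R) (x y t s k M u p : R).

Definition arcl s := Num.sqrt (1 + s ^+ 2).

Lemma arcl_sqr s : arcl s ^+ 2 = 1 + s ^+ 2.
Proof. by rewrite sqr_sqrtr // addr_ge0 // sqr_ge0. Qed.

Lemma arcl_gt0 s : 0 < arcl s.
Proof. by rewrite sqrtr_gt0 ltr_pwDl // sqr_ge0. Qed.
Hint Resolve arcl_gt0 : core.

Lemma arcl_neq0 s : arcl s != 0. Proof. by rewrite gt_eqF. Qed.
Hint Resolve arcl_neq0 : core.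

Lemma arcl_ge1 s : 1 <= arcl s.
Proof. by rewrite -sqrtr1 ler_wsqrtr // lerDl sqr_ge0. Qed.

Lemma norm_le_arcl s : `|s| <= arcl s.
Proof. by rewrite -sqrtr_sqr ler_wsqrtr // lerDr. Qed.

Lemma arclN s : arcl (- s) = arcl s.
Proof. by rewrite /arcl sqrrN. Qed.

Lemma arcl_derive s : is_derive s 1 arcl (s / arcl s).
Proof.
have h : 0 < 1 + s ^+ 2 by rewrite ltr_pwDl // sqr_ge0.
have d1 : is_derive s 1 (fun x : R => 1 + x ^+ 2) (2 * s).
  apply: is_derive_eq; rewrite /=.
  by rewrite -[_ *: _]/(_ * _); ring.
have d2 := is_derive1_sqrt h.
have d3 := @is_derive1_comp _ Num.sqrt (fun x : R => 1 + x ^+ 2) s _ _ d2 d1.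
apply: (is_derive_eq d3); rewrite -/(arcl s).
by field.
Qed.

Lemma continuous_arcl : continuous arcl.
Proof.
by move=> s; apply: differentiable_continuous; apply/derivable1_diffP;
  have [] := arcl_derive s.
Qed.

Lemma continuous_arcl_comp (p : R -> R) : continuous p -> continuous (fun x => arcl (p x)).
Proof. by move=> pc x; exact: (continuous_comp (pc x) (@continuous_arcl (p x))). Qed.

(** The sine of the inclination angle of a curve of slope [s]. *)
Definition sigma s := s / arcl s.

Lemma sigmaN s : sigma (- s) = - sigma s.
Proof. by rewrite /sigma arclN mulNr. Qed.

Lemma sigma_derive s : is_derive s 1 sigma ((arcl s)^-1 ^+ 3).
Proof.
have d1 := arcl_derive s.
have dv := @is_deriveV _ arcl s _ 1 (arcl_neq0 s) d1.
apply: is_derive_eq; rewrite -![_ *: _]/(_ * _).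
have := arcl_sqr s => e.
apply/eqP; rewrite -subr_eq0; apply/eqP.
transitivity ((arcl s ^+ 2 - s ^+ 2 - 1) / arcl s ^+ 3); first by field.
by rewrite e; field.
Qed.

Variables alpha eps : R.
Hypothesis alpha0 : 0 < alpha.
Hypothesis eps0 : 0 <= eps.

(* The boundary conditions make [w = u''] determine an even profile [u]; since
   [u' / sqrt (1 + u'^2)] vanishes at both ends the cross term of the Willmore
   integrand integrates to [0], which leaves [Helfrich = pi / 2 * energy w]. *)
Definition profile w x := alpha + prim (prim w) x.
Local Notation U := profile.
(** The coefficient of [u''^2] in the integrand; [lagrB] is the part without [u'']. Taking the
    factor [pi / 2] out of the weight [2 * pi * eps] of the area leaves [4 * eps]. *)
Definition lagrA u p := u * (arcl p)^-1 ^+ 5.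
Definition lagrB u p := u^-1 * (arcl p)^-1 + 4 * eps * (u * arcl p).
Definition lagr u p k := k ^+ 2 * lagrA u p + lagrB u p.
Definition energy w := integralI (fun x => lagr (U w x) (prim w x) (w x)).

(** [prim] builds in [u (-1) = alpha] and [u' (-1) = 0], and [integralI w = 0] says [u' 1 = 0]. With
    [w] even this makes [u'] odd, hence [u] even and [u 1 = alpha]. *)
Definition admissible w := [/\ integrableI w, integrableI (fun x =>
  w x ^+ 2), forall x, w (- x) = w x,
  integralI w = 0 & forall x, -1 <= x <= 1 -> 0 < U w x].
Local Notation F := energy.
Local Notation adm := admissible.

Lemma integrableI_prim w : integrableI w -> integrableI (prim w).
Proof. by move=> /continuous_prim /continuous_integrableI. Qed.

Lemma continuous_profile w : integrableI w -> continuous (U w).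
Proof. by move=> /integrableI_prim; exact: continuous_addr_prim. Qed.

Lemma profile_clamp w x : U w x = U w (clamp x).
Proof. by rewrite /U prim_clamp. Qed.

(** The profile is constant on either side of [[-1, 1]], so positivity holds on the whole line and
    [1 / u] is continuous everywhere. *)
Lemma profile_gt0 w x : adm w -> 0 < U w x.
Proof. by move=> [_ _ _ _ u0]; rewrite profile_clamp u0 // clampI. Qed.

Lemma admissible_primN w x : adm w -> prim w (- x) = - prim w x.
Proof. by move=> [wi _ we w0 _]; apply: prim_even. Qed.

Lemma continuous_lagrA (u p : R -> R) : continuous u -> continuous p ->
  continuous (fun x => lagrA (u x) (p x)).
Proof.
move=> uc pc x; apply: cvgM; first exact: uc.
apply: (@continuous_comp _ _ _ (fun x => (arcl (p x))^-1) (fun y => y ^+ 5));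
  last exact: exprn_continuous.
apply: cvgV => //; apply: (@continuous_comp _ _ _ p arcl); [exact: pc|exact: continuous_arcl].
Qed.

Lemma continuous_lagrB (u p : R -> R) : (forall x, u x != 0) -> continuous u -> continuous p ->
  continuous (fun x => lagrB (u x) (p x)).
Proof.
move=> u0 uc pc x.
have ac : {for x, continuous (fun x => arcl (p x))}.
  by apply: (@continuous_comp _ _ _ p arcl); [exact: pc|exact: continuous_arcl].
apply: cvgD; first by apply: cvgM; apply: cvgV => //; exact: uc.
apply: cvgM; first exact: cvg_cst.
by apply: cvgM => //; exact: uc.
Qed.

Lemma integrableI_lagr w : adm w -> integrableI (fun x => lagr (U w x) (prim w x) (w x)).
Proof.
move=> aw; have [wi w2 _ _ _] := aw.
apply: integrableID; first by apply: integrableI_mulc => //; apply: continuous_lagrA;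
  [exact: continuous_profile|exact: continuous_prim].
apply: continuous_integrableI; apply: continuous_lagrB;
  [|exact: continuous_profile|exact: continuous_prim].
by move=> x; rewrite gt_eqF // profile_gt0.
Qed.

Lemma lagrA_ge0 u p : 0 < u -> 0 < lagrA u p.
Proof. by move=> u0; rewrite mulr_gt0 // exprn_gt0 // invr_gt0. Qed.

Lemma lagrB_ge0 u p : 0 < u -> 0 < lagrB u p.
Proof.
move=> u0; rewrite ltr_pwDl //; first by rewrite mulr_gt0 // invr_gt0.
by rewrite !mulr_ge0 // ltW.
Qed.

Lemma lagr_ge0 u p k : 0 < u -> 0 <= lagr u p k.
Proof.
move=> u0; rewrite addr_ge0 //; last exact/ltW/lagrB_ge0.
by rewrite mulr_ge0 ?sqr_ge0 //; exact/ltW/lagrA_ge0.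
Qed.

(* [lagr = 1/X + X (y^2 + 4 eps)] with [X = u q] and [y = k / q^3], so AM-GM gives
   [lagr >= 2 sqrt (y^2 + 4 eps)]; this is its tangent at [y = 2]. *)
Lemma lagr_lower u p k : 0 < u ->
  2 * `|(arcl p)^-1 ^+ 3 * k| <= Num.sqrt (1 + eps) * lagr u p k - 4 * eps.
Proof.
move=> u0; set c0 := Num.sqrt _.
have c00 : 0 < c0 by rewrite sqrtr_gt0 ltr_pwDl.
have c02 : c0 ^+ 2 = 1 + eps by rewrite sqr_sqrtr // addr_ge0.
set y := _ * k; pose X := u * arcl p.
have X0 : 0 < X by rewrite mulr_gt0.
have LE : lagr u p k = X^-1 + X * (y ^+ 2 + 4 * eps).
  rewrite /lagr /lagrA /lagrB /X /y; by field; rewrite arcl_neq0 (gt_eqF u0).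
rewrite lerBrDr LE; set N := 2 * `|y| + 4 * eps; set T := c0 * _.
have T0 : 0 <= T by rewrite mulr_ge0 ?(ltW c00) // addr_ge0 ?invr_ge0 ?mulr_ge0 ?addr_ge0 ?sqr_ge0 ?mulr_ge0 // ltW.
have N0 : 0 <= N by rewrite addr_ge0 // mulr_ge0 //; exact: normr_ge0.
rewrite -(@ler_pXn2r _ 2) // ?nnegrE //.
(* By [(a + b)^2 = (a - b)^2 + 4 a b]. Then [T^2 - N^2] equals [(1 + eps) (1/X - X (y^2 + 4 eps))^2
   + 4 eps (|y| - 2)^2]. *)
have -> : T ^+ 2 = c0 ^+ 2 * ((X^-1 - X * (y ^+ 2 + 4 * eps)) ^+ 2 + 4 * (y ^+ 2 + 4 * eps)).
  by rewrite /T; field; rewrite gt_eqF.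
have -> : y ^+ 2 = `|y| ^+ 2 by rewrite real_normK // num_real.
set z := `|y|; rewrite c02 /N -/z.
have h1 := sqr_ge0 (X^-1 - X * (z ^+ 2 + 4 * eps)).
have h2 := mulr_ge0 eps0 h1.
have h3 := mulr_ge0 eps0 (sqr_ge0 (z - 2)).
nra.
Qed.

(** The chain rule for [sigma], whose derivative is [arcl^-3]. It serves twice: [y] is the quantity
    bounded by [lagr_lower], and the cross term of the Willmore integrand is [-2 y]. *)
Lemma sigma_prim w : integrableI w -> let y t := (arcl (prim w t))^-1 ^+ 3 * w t in
  integrableI y /\ forall z, -1 <= z <= 1 -> sigma (prim w z) = prim y z.
Proof.
move=> wi y.
have pc : continuous (fun y : R => (arcl (0 + prim w y))^-1 ^+ 3).
  move=> z; apply: (@continuous_comp _ _ _ (fun x => (arcl (0 + prim w x))^-1) (fun y =>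
    y ^+ 3)); last exact: exprn_continuous.
  apply: cvgV => //; apply: (@continuous_comp _ _ _ (fun x => 0 + prim w x) arcl);
    last exact: continuous_arcl.
  exact: continuous_addr_prim.
have yi' : integrableI (fun t => (arcl (0 + prim w t))^-1 ^+ 3 * w t).
  by apply: eq_integrableI (integrableI_mulc wi pc) => t _; rewrite mulrC.
have yi : integrableI y by apply: eq_integrableI yi' => t _; rewrite add0r.
split => // z.
move=> zI.
have ds t : -1 <= t <= 1 -> is_derive (0 + prim w t) 1 sigma ((arcl (0 + prim w t))^-1 ^+ 3).
    by move=> _; exact: sigma_derive.
  have := @prim_chain _ sigma (fun s => (arcl s)^-1 ^+ 3) 0 w z wi ds pc yi' zI.
  rewrite [sigma 0]/sigma mul0r !add0r => ->.
  by apply: eq_prim => t _; rewrite add0r.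
Qed.

(* [sigma (prim w)] is odd and vanishes at [-1], [0] and [1], so that its total
   variation is at least [4 * `|sigma (prim w x)|]. *)
Lemma sigma_le w x : adm w ->
  8 * `|sigma (prim w x)| <= Num.sqrt (1 + eps) * F w - 8 * eps.
Proof.
move=> aw; have [wi w2 we w0 _] := aw.
wlog x0 : x / 0 <= x <= 1.
  move=> wl; rewrite (prim_clamp _ x); have /andP[c1 c2] := clampI x.
  case: (leP 0 (clamp x)) => c0; first by apply: wl; rewrite c0.
  have := wl (- clamp x); rewrite admissible_primN // sigmaN normrN; apply.
  by apply/andP; split; lra.
pose y t := (arcl (prim w t))^-1 ^+ 3 * w t.
have [yi S] := sigma_prim wi; rewrite -/y in yi S.
pose l t := 2^-1 * (Num.sqrt (1 + eps) * lagr (U w t) (prim w t) (w t) - 4 * eps).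
have li : integrableI l by apply/integrableIZ/integrableIB;
  [exact/integrableIZ/integrableI_lagr|exact: integrableI_cst].
have yl t : -1 <= t <= 1 -> `|y t| <= l t.
  move=> tI; rewrite /l; have := lagr_lower (prim w t) (w t) (profile_gt0 t aw).
  by rewrite -/(y t) => ?; lra.
have Itl : integralI l = 2^-1 * (Num.sqrt (1 + eps) * F w - 8 * eps).
  rewrite /l integralIZ; last by apply/integrableIB;
    [exact/integrableIZ/integrableI_lagr|exact: integrableI_cst].
  rewrite integralIB; [|exact/integrableIZ/integrableI_lagr|exact: integrableI_cst].
  have -> : integralI (fun t => Num.sqrt (1 + eps) * lagr (U w t) (prim w t) (w t)) =
    Num.sqrt (1 + eps) * F w by rewrite integralIZ //; exact: integrableI_lagr.
  by rewrite integralI_cst; set a := Num.sqrt _; set b := F w; lra.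
have sub a b : -1 <= a -> a <= b -> b <= 1 -> `|sigma (prim w b) - sigma (prim w a)| <= prim l b - prim l a.
  move=> a1 ab b1; rewrite !S; [|by apply/andP; split; lra..].
  by apply: prim_sub => // t tI _; exact: yl.
move/andP: x0 => [x0 x1].
have e1 := sub (-1) (- x) (ltac:(lra)) (ltac:(lra)) (ltac:(lra)).
have e2 := sub (- x) x (ltac:(lra)) (ltac:(lra)) (ltac:(lra)).
have e3 := sub x 1 (ltac:(lra)) (ltac:(lra)) (ltac:(lra)).
rewrite admissible_primN // sigmaN in e1 e2; rewrite prim1 w0 in e3.
rewrite primN1 in e1; rewrite prim1 in e3.
have s0 : sigma 0 = 0 by rewrite /sigma mul0r.
rewrite s0 sub0r normrN in e3; rewrite primN1 s0 subr0 normrN in e1.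
rewrite opprK -mulr2n normrMn in e2.
rewrite Itl in e3; set s := `|_| in e1 e2 e3 *; rewrite -mulr_natl in e2; lra.
Qed.

(** Since [1 - sigma^2 = 1 / arcl^2], the bound gives [arcl^2 <= 1 / (1 - k^2)], which is at most
    [1 / (1 - k)^2]. *)
Lemma sigma_arcl s k : `|sigma s| <= k -> k < 1 -> arcl s <= (1 - k)^-1.
Proof.
move=> sk k1; have k0 : 0 <= k by apply: le_trans sk.
have h : arcl s ^+ 2 * (1 - k ^+ 2) <= 1.
  have : sigma s ^+ 2 <= k ^+ 2 by rewrite -(real_normK (num_real (sigma s))) ler_pXn2r // nnegrE.
  rewrite /sigma exprMn exprVn ler_pdivrMr ?exprn_gt0 //.
  by have := arcl_sqr s; set a := arcl s ^+ 2 => e; nra.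
rewrite -[leRHS]mul1r ler_pdivlMr ?subr_gt0 //.
have a1 := arcl_ge1 s; set a := arcl s in h a1 *.
have h1 : 0 <= a * (1 - k) * (a * (1 + k) - 1) by rewrite !mulr_ge0 //; nra.
by nra.
Qed.

(** [sigma_le] keeps [|sigma|] below some [k < 1], hence the slope below [Q]. As [1 / (u q)], with
    [q = arcl u'], is part of the energy density, [|(ln u)'| = |u'| / u <= Q^2 / (u q)] has integral
    at most [Q^2 * F0]; integrating from [u (-1) = alpha] gives the lower bound [m]. Finally
    [lagrA >= m / Q^5] bounds [w] in L^2. *)
Lemma a_priori_bounds (F0 : R) : F0 < 8 * Num.sqrt (1 + eps) ->
  exists Q m C, [/\ 1 <= Q, 0 < m & forall w, adm w -> F w <= F0 ->
   [/\ forall x, arcl (prim w x) <= Q, forall x, m <= U w x <= C & integralI (fun x =>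
     w x ^+ 2) <= C]].
Proof.
move=> F08; set c0 := Num.sqrt _ in F08.
have c00 : 0 < c0 by rewrite sqrtr_gt0 ltr_pwDl.
have c02 : c0 ^+ 2 = 1 + eps by rewrite sqr_sqrtr // addr_ge0.
(* The bound of [sigma_le] divided by [8]; it is below [1] because
   [c0 * F0 < 8 * c0^2 = 8 * (1 + eps)]. *)
pose k := 8^-1 * (c0 * F0) - eps.
have k1 : k < 1 by rewrite /k; nra.
pose Q := Num.max 1 (1 - k)^-1; pose m := alpha * expR (- (Q ^+ 2 * F0)).
have Q1 : 1 <= Q by rewrite le_max lexx.
have Q0 : 0 < Q by lra.
have m0 : 0 < m by rewrite mulr_gt0 // expR_gt0.
exists Q, m, (Num.max (alpha + 2 * Q) (F0 * Q ^+ 5 / m)).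
split=> // w aw Fw; have [wi w2 we w0 _] := aw.
have qQ x : arcl (prim w x) <= Q.
  rewrite le_max (@sigma_arcl _ k) ?orbT //.
  have := sigma_le x aw; rewrite -/c0 /k; nra.
have pQ x : `|prim w x| <= Q by apply: le_trans (norm_le_arcl _) (qQ x).
have u0 x : 0 < U w x by exact: profile_gt0.
have uc := continuous_profile wi; have pc := continuous_prim wi.
have ivc : continuous (fun x => (U w x)^-1).
  by move=> x; apply: cvgV; [rewrite gt_eqF|exact: uc].
have Li := integrableI_lagr aw.
have mU x : m <= U w x.
  rewrite profile_clamp; have xI := clampI x; set z := clamp x in xI *.
  have pui : integrableI (fun y => (alpha + prim (prim w) y)^-1 * prim w y).
    by apply: continuous_integrableI => y; apply: cvgM; [exact: ivc|exact: pc].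
  have dln y : -1 <= y <= 1 -> is_derive (alpha + prim (prim w) y) 1 (@ln R) (alpha + prim (prim w) y)^-1.
    by move=> _; apply: is_derive1_ln; exact: u0.
  have := @prim_chain _ (@ln R) (fun x =>
    x^-1) alpha (prim w) z (integrableI_prim wi) dln ivc pui xI.
  rewrite -/(U w z) => e.
  rewrite -ler_ln ?posrE // e /m lnM ?posrE ?expR_gt0 // expRK lerD2l.
  rewrite lerNl; apply: le_trans (ler_norm _) _; rewrite normrN.
  apply: le_trans (prim_bound _ pui) _.
  apply: le_trans (_ : Q ^+ 2 * F w <= _); last by rewrite ler_wpM2l // exprn_ge0 // ltW.
  rewrite -integralIZ //; apply: integralI_le; [exact: integrableI_norm|exact: integrableIZ|] =>
    y yI.
  rewrite normrM -/(U w y) gtr0_norm ?invr_gt0 //.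
  have h1 : (U w y)^-1 * (arcl (prim w y))^-1 <= lagr (U w y) (prim w y) (w y).
    have h2 : 0 <= w y ^+ 2 * lagrA (U w y) (prim w y).
      by rewrite mulr_ge0 ?sqr_ge0 // ltW // lagrA_ge0.
    have h3 : 0 <= 4 * eps * (U w y * arcl (prim w y)).
      by rewrite !mulr_ge0 // ltW // arcl_gt0.
    by rewrite /lagr /lagrB; lra.
  apply: le_trans (_ : Q ^+ 2 * ((U w y)^-1 * (arcl (prim w y))^-1) <= _); last first.
    by rewrite ler_wpM2l // exprn_ge0 // ltW.
  rewrite [Q ^+ 2 * _]mulrCA ler_wpM2l ?invr_ge0 ?(ltW (u0 y)) //.
  rewrite ler_pdivlMr ?arcl_gt0 //.
  by rewrite expr2 ler_pM // ltW // arcl_gt0.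
split=> //.
  move=> x; rewrite mU le_max; apply/orP; left; rewrite lerD2l.
  apply: le_trans (ler_norm _) _; apply: le_trans (prim_bound _ (integrableI_prim wi)) _.
  rewrite mulrC -integralI_cst; apply: integralI_le => //;
    [exact/integrableI_norm/integrableI_prim|exact: integrableI_cst].
rewrite le_max; apply/orP; right; rewrite ler_pdivlMr // mulrC -integralIZ //.
apply: le_trans (_ : Q ^+ 5 * F w <= _); last by rewrite mulrC ler_wpM2r // exprn_ge0 // ltW.
rewrite -integralIZ //; apply: integralI_le; [exact: integrableIZ|exact: integrableIZ|] => y yI.
have h1 : w y ^+ 2 * lagrA (U w y) (prim w y) <= lagr (U w y) (prim w y) (w y).
  by rewrite /lagr lerDl ltW // lagrB_ge0.
apply: le_trans (_ : Q ^+ 5 * (w y ^+ 2 * lagrA (U w y) (prim w y)) <= _); last first.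
  by rewrite ler_wpM2l // exprn_ge0 // ltW.
rewrite [Q ^+ 5 * _]mulrCA [m * _]mulrC ler_wpM2l ?sqr_ge0 //.
rewrite /lagrA exprVn mulrCA -[leLHS]mulr1 ler_pM ?(ltW m0) //.
rewrite ler_pdivlMr ?exprn_gt0 ?arcl_gt0 // mul1r lerXn2r ?nnegrE //; exact/ltW.
Qed.

End Energy.

(** * From [N_alpha] and [Helfrich] to admissible [w] and [energy], and back *)

Section Translation.
Variable R : realType.
Implicit Types (f g h v w : R -> R) (x y t s k M u p : R).
Local Notation mu := (@lebesgue_measure R).
Local Notation I := (`[(-1)%R, 1%R]%classic : set R).

(* The integral of a nonnegative function is a supremum over the simple functions
   below it, hence monotone without any measurability; this avoids proving that
   [d2 v] is measurable. *)
Lemma ge0_le_integral_nomeas (f g : R -> \bar R) :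
  (forall x, I x -> (0 <= f x)%E) -> (forall x, I x -> (f x <= g x)%E) ->
  (\int[mu]_(x in I) f x <= \int[mu]_(x in I) g x)%E.
Proof.
move=> f0 fg; have g0 x : I x -> (0 <= g x)%E.
  by move=> xI; apply: le_trans (fg x xI); exact: f0.
rewrite !ge0_integralE //; apply: le_ereal_sup => _ [h hf <-]; exists h => // x.
apply: le_trans (hf x) _; rewrite !patchE; case: ifPn => //.
by rewrite inE => /fg.
Qed.

Lemma itv_1 : -1 <= (1 : R) <= 1.
Proof. by rewrite lexx andbT; lra. Qed.

Lemma itv_N1 : -1 <= (-1 : R) <= 1.
Proof. by rewrite lexx /=; lra. Qed.

(** [f] lies between [lo] and [up], the modifications of [g] by [0] and by [+oo] on [N]. These are
    measurable and have the integral of [g], so monotonicity squeezes the integral of [f]. *)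
Lemma ge0_ae_integral_nomeas (f g : R -> R) (N : set R) :
  measurable N -> mu N = 0%E -> measurable_fun I g ->
  (forall x, -1 <= x <= 1 -> 0 <= f x) -> (forall x, -1 <= x <= 1 -> 0 <= g x) ->
  (forall x, -1 <= x <= 1 -> ~ N x -> f x = g x) ->
  (\int[mu]_(x in I) (f x)%:E = \int[mu]_(x in I) (g x)%:E)%E.
Proof.
move=> mN N0 mg f0 g0 fg.
have mgE : measurable_fun I (EFin \o g) by exact/measurable_EFinP.
pose lo x := if x \in N then 0%E else (g x)%:E.
pose up x := if x \in N then +oo%E else (g x)%:E.
have mN' : measurable_fun I (fun x => x \in N).
  apply: (@measurable_fun_bool _ _ _ _ true).
  rewrite (_ : _ @^-1` _ = N); first exact: measurableI.
  by apply/seteqP; split => x /=; [move/set_mem|exact: mem_set].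
have e1 : (\int[mu]_(x in I) lo x = \int[mu]_(x in I) (g x)%:E)%E.
  apply: ae_eq_integral => //; first by apply: measurable_fun_if => //;
    apply: (measurable_funS _ _ mgE).
  exists N; split => // x /= h; apply: contrapT => xN; apply: h => xI.
  by rewrite /lo ifF //; apply/negP => /set_mem.
have e2 : (\int[mu]_(x in I) up x = \int[mu]_(x in I) (g x)%:E)%E.
  apply: ae_eq_integral => //; first by apply: measurable_fun_if => //;
    apply: (measurable_funS _ _ mgE).
  exists N; split => // x /= h; apply: contrapT => xN; apply: h => xI.
  by rewrite /up ifF //; apply/negP => /set_mem.
apply/eqP; rewrite eq_le -{2}e1 -{1}e2; apply/andP; split.
  apply: ge0_le_integral_nomeas => x /in_I xI; first by rewrite lee_fin f0.
  by rewrite /up; case: ifPn => xN; rewrite ?leey // fg // => /mem_set; exact/negP.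
apply: ge0_le_integral_nomeas => x /in_I xI.
  by rewrite /lo; case: ifPn => // _; rewrite lee_fin g0.
by rewrite /lo; case: ifPn => xN; rewrite lee_fin ?f0 // fg // => /mem_set; exact/negP.
Qed.

Variables alpha eps : R.
Local Notation U := (profile alpha).
Local Notation F := (energy alpha eps).
Local Notation adm := (admissible alpha).

Section FixProfile.
Variables v w : R -> R.
Hypothesis aw : adm w.
Hypothesis vE : forall x, -1 <= x <= 1 -> v x = U w x.

Lemma near_interior x : -1 < x < 1 -> \forall y \near x, -1 < y < 1.
Proof.
by move=> xI; have := @near_in_itvoo _ (-1) 1 x; rewrite in_itv => /(_ xI);
  apply: filterS => y; rewrite in_itv.
Qed.

Lemma near_eq_is_derive (f g : R -> R) x d : (forall y, -1 < y < 1 -> f y = g y) ->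
  -1 < x < 1 -> is_derive x 1 g d -> is_derive x 1 f d.
Proof.
move=> fg xI [dg gd].
have n : {near x, g =1 f}.
  by have := near_interior xI; apply: filterS => y /fg.
split; first exact: near_eq_derivable dg.
by rewrite -gd; apply/esym/near_eq_derive.
Qed.

Lemma d1E x : -1 < x < 1 -> d1 v x = prim w x.
Proof.
move=> xI; have [wi _ _ _ _] := aw.
have dU : is_derive x 1 (U w) (prim w x).
  have d := prim_derive (integrableI_prim wi) xI (@continuous_prim _ _ wi x).
  have := is_deriveD (is_derive_cst alpha x 1) d.
  by rewrite add0r.
have vE' y : -1 < y < 1 -> v y = U w y.
  by move=> /andP[y1 y2]; apply: vE; rewrite !ltW.
by have [_ <-] := near_eq_is_derive vE' xI dU; rewrite /d1 derive1E.
Qed.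

(** Lebesgue differentiation of [prim w], with [w] extended by zero. The end points join the null
    set because [v] is unconstrained outside [[-1, 1]] and [d1 v] is a two-sided derivative. *)
Lemma d2E : exists N : set R, [/\ measurable N, mu N = 0%E &
  forall x, -1 <= x <= 1 -> ~ N x -> -1 < x < 1 /\ d2 v x = w x].
Proof.
have [wi _ _ _ _] := aw.
pose w1 := w \_ I.
have w1i : mu.-integrable setT (EFin \o w1).
  by rewrite -restrict_EFin; apply/(integrable_mkcond _ _).1.
have lw1 : locally_integrable setT w1 by exact: integrable_locally.
have w1i' y : mu.-integrable [set` Interval (BLeft (-1)) (BRight y)] (EFin \o w1).
  exact: integrableS w1i.
have [N [mN N0 NP]] := FTC1 w1i' lw1.
exists (N `|` [set -1; 1]); split.
- by apply: measurableU => //; apply: measurableU.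
- apply: null_set_setU => //; first exact: measurableU.
  by apply: null_set_setU => //; exact: lebesgue_measure_set1.
move=> x /andP[x1 x2] /not_orP[nN n1].
have xI : -1 < x < 1.
  apply/andP; split; rewrite lt_neqAle ?x1 ?x2 andbT; apply/eqP => e; apply: n1 => /=.
    by left. by right.
split => //.
have [dF F'] : derivable (fun x => \int[mu]_(t in `[-1, x]) w1 t) x 1 /\ (fun x =>
  \int[mu]_(t in `[-1, x]) w1 t)^`() x = w1 x.
  apply: contrapT => h; apply: nN; apply: NP => /= h'; apply: h; apply: h'.
  by rewrite lte_fin; case/andP: xI.
rewrite derive1E in F'.
have dP : is_derive x 1 (d1 v) (w1 x).
  apply: (near_eq_is_derive _ xI (DeriveDef dF F')) => y /[dup] yI /andP[y1 y2].
  rewrite d1E // primE ?(ltW y1) ?(ltW y2) //; apply: eq_Rintegral => t.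
  rewrite inE /= in_itv /= => /andP[t1 t2]; rewrite /w1 patchE mem_set //=.
  by rewrite in_itv /= t1 (le_trans t2) // ltW.
have -> : w x = w1 x by rewrite /w1 patchE mem_set //=; rewrite in_itv /= x1 x2.
by have [_ <-] := dP; rewrite /d2 derive1E.
Qed.

(** Off the null set of [d2E], [prim w] and [w] may replace the derivatives of [v]; expanding the
    square then gives [gL - 2 y]. *)
Lemma HelfrichE : Helfrich eps v = (pi / 2 * F w)%:E.
Proof.
have [wi w2 we w0 _] := aw; have [N [mN N0 NP]] := d2E.
have [yi yP] := sigma_prim wi; set y := fun t => _ in yi yP.
(* The null Lagrangian: the integral of [y] is [sigma (prim w 1) = sigma 0 = 0]. *)
have yint : integralI y = 0 by rewrite -prim1 -yP ?w0 /sigma ?prim1 ?w0 ?mul0r //; apply/andP;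
  split; lra.
have u0 x : 0 < U w x by exact: profile_gt0.
have un x : U w x != 0 by rewrite gt_eqF.
have uc := @continuous_profile R alpha w wi; have pc := continuous_prim wi.
pose gA x := U w x * arcl (prim w x).
have ac := continuous_arcl_comp pc.
have gAi : integrableI gA by apply: continuous_integrableI => x; apply: cvgM; [exact: uc|exact: ac].
have gA0 x : 0 <= gA x by rewrite mulr_ge0 // ltW // arcl_gt0.
pose gL x := w x ^+ 2 * lagrA (U w x) (prim w x) + (U w x)^-1 * (arcl (prim w x))^-1.
have gLi : integrableI gL.
  apply: integrableID; first by apply: integrableI_mulc => //; apply: continuous_lagrA.
  apply: continuous_integrableI => x; apply: cvgM; apply: cvgV => //.
  - exact: uc. - exact: arcl_neq0. - exact: ac.
pose gW x := ((gA x)^-1 - w x / arcl (prim w x) ^+ 3) ^+ 2 * gA x.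
have gWE x : gW x = gL x - 2 * y x.
  rewrite /gW /gL /gA /y /lagrA; field.
  by rewrite arcl_neq0 un.
have gWi : integrableI gW.
  by apply: (@eq_integrableI _ (fun x => gL x - 2 * y x)) => [x _|];
    [rewrite gWE|apply/integrableIB/integrableIZ].
have FE : F w = integralI gW + 4 * eps * integralI gA.
  rewrite (eq_integralI (g := fun x =>
    gL x - 2 * y x)) ?integralIB ?integralIZ ?yint ?mulr0 ?subr0 //.
    rewrite -integralIZ // -integralID //; last exact: integrableIZ.
    by apply: eq_integralI => x _; rewrite /lagr /lagrB /gL /gA; ring.
  exact: integrableIZ.
rewrite /Helfrich /Willmore /Area.
rewrite (@ge0_ae_integral_nomeas _ gW N) //; last first.
- move=> x xI nN; have [xI' ->] := NP x xI nN.
  by rewrite d1E // vE.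
- by move=> x xI; rewrite mulr_ge0 ?sqr_ge0.
- by move=> x xI; rewrite mulr_ge0 ?sqr_ge0 // mulr_ge0 ?sqrtr_ge0 // vE // ltW.
- exact: integrableI_measurable.
rewrite (@ge0_ae_integral_nomeas (fun x => v x * Num.sqrt (1 + d1 v x ^+ 2)) gA N) //; last first.
- move=> x xI nN; have [xI' _] := NP x xI nN.
  by rewrite d1E // vE.
- by move=> x xI; rewrite mulr_ge0 ?sqrtr_ge0 // vE // ltW.
- exact: integrableI_measurable.
rewrite !integralI_E // -!EFinM -EFinD; congr EFin; rewrite FE; by field.
Qed.

End FixProfile.

Lemma N_alpha_admissible v : N_alpha alpha v ->
  exists2 w, adm w & forall x, -1 <= x <= 1 -> v x = U w x.
Proof.
move=> [[u1 [w [wi w2 u1E vE]]] ve v0 [va va1] [vl vr]].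
have u1P x : -1 <= x <= 1 -> u1 x = u1 (-1) + prim w x.
  by move=> xI; rewrite primE // u1E.
have u1i : integrableI (fun x => u1 (-1) + prim w x) by apply: continuous_integrableI;
  exact: continuous_addr_prim.
have vP x : -1 <= x <= 1 -> v x = alpha + prim (fun x => u1 (-1) + prim w x) x.
  move=> xI; rewrite primE // vE // va; congr (_ + _); apply: eq_Rintegral => t.
  rewrite inE /= in_itv /= => /andP[t1 t2]; rewrite u1P // t1 (le_trans t2) //.
  by case/andP: xI.
have u1c : continuous (fun x => u1 (-1) + prim w x) by exact: continuous_addr_prim.
(* By [prim_slope] the left difference quotients of [v] at [1] approach [u1 1], while the boundary
   condition prescribes the limit [0]. *)
have u1l : u1 1 = 0.
  apply/eqP; rewrite -normr_le0; apply/ler_addgt0Pl => k k0; rewrite addr0.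
  have k20 : 0 < k / 2 by rewrite divr_gt0.
  have /nbhs_ballP[e /= e0 He] := prim_slope u1c (ltac:(by apply/andP; split;
    lra) : -1 <= 1 <= 1) k20.
  have /cvgrPdist_le /(_ _ k20) n2 := vl.
  near (0 : R)^'- => h.
  have h0 : h < 0 by near: h; exact: nbhs_left_lt.
  have h1 : - Num.min e 1 < h.
    by near: h; apply: nbhs_left_gt; rewrite oppr_lt0 lt_min e0 ltr01.
  have : `|0 - h^-1 * (v (1 + h) - v 1)| <= k / 2 by near: h.
  have [he hm1] : - h < e /\ -1 < h.
    by move: h1; rewrite ltrNl lt_min => /andP[]; rewrite ltrNl; split=> //; lra.
  have hI : -1 <= 1 + h <= 1 by apply/andP; split; lra.
  have := He (1 + h); rewrite /ball /= => /(_ (ltac:(rewrite opprD addrA subrr sub0r gtr0_norm;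
    lra)) hI).
  have I1 := itv_1.
  rewrite -u1P // sub0r normrN normrM normfV (ltr0_norm h0) ler_pdivrMl ?oppr_gt0 //.
  rewrite !vP // (_ : 1 + h - 1 = h) ?(ltr0_norm h0); last by ring.
  set X := prim _ _; set Y := prim _ _ => a1 a2.
  have := ler_normB (X - Y) (X - Y - u1 1 * h).
  rewrite subKr normrM (ltr0_norm h0).
  rewrite (_ : alpha + X - (alpha + Y) = X - Y) in a2; last by ring.
  move=> a3; have a4 : `|u1 1| * - h <= k * - h by nra.
  by move: a4; rewrite ler_pM2r ?oppr_gt0.
have u1r : u1 (-1) = 0.
  apply/eqP; rewrite -normr_le0; apply/ler_addgt0Pl => k k0; rewrite addr0.
  have k20 : 0 < k / 2 by rewrite divr_gt0.
  have /nbhs_ballP[e /= e0 He] := prim_slope u1c (ltac:(by apply/andP; split;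
    lra) : -1 <= -1 <= 1) k20.
  have /cvgrPdist_le /(_ _ k20) n2 := vr.
  near (0 : R)^'+ => h.
  have h0 : 0 < h by near: h; exact: nbhs_right_gt.
  have h1 : h < Num.min e 1.
    by near: h; apply: nbhs_right_lt; rewrite lt_min e0 ltr01.
  have : `|0 - h^-1 * (v (-1 + h) - v (-1))| <= k / 2 by near: h.
  have [he hm1] : h < e /\ h < 1 by move: h1; rewrite lt_min => /andP[].
  have hI : -1 <= -1 + h <= 1 by apply/andP; split; lra.
  have := He (-1 + h); rewrite /ball /= =>
    /(_ (ltac:(rewrite opprD addrA subrr sub0r normrN gtr0_norm; lra)) hI).
  have I1 := itv_N1.
  rewrite -u1P // sub0r normrN normrM normfV (gtr0_norm h0) ler_pdivrMl //.
  rewrite !vP // (_ : -1 + h - -1 = h) ?(gtr0_norm h0); last by ring.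
  set X := prim _ _; set Y := prim _ _ => a1 a2.
  have := ler_normB (X - Y) (X - Y - u1 (-1) * h).
  rewrite subKr normrM (gtr0_norm h0).
  rewrite (_ : alpha + X - (alpha + Y) = X - Y) in a2; last by ring.
  move=> a3; have a4 : `|u1 (-1)| * h <= k * h by nra.
  by move: a4; rewrite ler_pM2r.
have w0 : integralI w = 0.
  by have := u1P 1 (ltac:(by apply/andP; split; lra)); rewrite u1l u1r add0r prim1.
have {}vP x : -1 <= x <= 1 -> v x = alpha + prim (prim w) x.
  by move=> xI; rewrite vP //; congr (_ + _); apply: eq_prim => t _; rewrite u1r add0r.
have Pwi := integrableI_prim wi; have Pwc := continuous_prim wi.
have Pw0 : integralI (prim w) = 0.
  have := vP 1 (ltac:(by apply/andP; split; lra)).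
  by rewrite va1 prim1 => h; lra.
have podd x : -1 <= x <= 1 -> prim w (- x) = - prim w x.
  (* Evenness of [v] makes the primitive of this continuous sum vanish, hence the sum itself inside
     the interval; the end points follow from [w0]. *)
  pose f x := prim w x + prim w (- x).
  have fc : continuous f.
    move=> t; apply: cvgD; first exact: Pwc.
    by apply: (@continuous_comp _ _ _ -%R (prim w)); [exact: opp_continuous|exact: Pwc].
  have [oi _] := integralI_opp Pwi.
  have f0 y : -1 <= y <= 1 -> prim f y = 0.
    move=> yI; rewrite primD //.
    have yI' : -1 <= - y <= 1 by case/andP: yI => y1 y2; apply/andP; split; lra.
    have := ve y yI; rewrite (vP _ yI) (vP _ yI') (prim_opp _ Pwi) Pw0 sub0r => /addrI <-.
    by rewrite addNr.
  move=> xI; apply/eqP; rewrite -addr_eq0 addrC; apply/eqP; rewrite -/(f x).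
  have [e1|n1] := eqVneq x 1; first by rewrite /f e1 prim1 primN1 w0 addr0.
  have [e2|n2] := eqVneq x (-1); first by rewrite /f e2 opprK prim1 primN1 w0 addr0.
  apply: prim_eq0 fc f0 _; case/andP: xI => x1 x2; apply/andP; split.
    by rewrite lt_neqAle eq_sym n2. by rewrite lt_neqAle n1.
have [woi _] := integralI_opp wi; have [w2oi _] := integralI_opp w2.
(* Nothing makes [w] even at every point, as [adm] requires. Its even part has the same primitive
   because [prim w] is odd. *)
pose ws x := 2^-1 * (w x + w (- x)).
have wsi : integrableI ws by apply/integrableIZ/integrableID.
have Pws x : -1 <= x <= 1 -> prim ws x = prim w x.
  move=> xI; rewrite primZ ?primD //; last exact: integrableID.
  have := prim_opp x wi; rewrite podd // w0 => h; lra.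
have Uws x : -1 <= x <= 1 -> v x = U ws x.
  by move=> xI; rewrite (vP x xI) /profile (eq_prim x Pws).
exists ws => //; split => //.
- apply: (@integrableI_le _ _ (fun x => w x ^+ 2 + w (- x) ^+ 2)).
  + by apply: measurable_funX; exact: integrableI_measurable.
  + exact: integrableID.
  + move=> x _; rewrite ger0_norm ?sqr_ge0 // /ws.
    have := sqr_ge0 (w x - w (- x)); nra.
- by move=> x; rewrite /ws opprK addrC.
- by rewrite -prim1 Pws ?prim1 //; apply/andP; split; lra.
- by move=> x xI; rewrite -Uws // v0.
Unshelve. all: by end_near. Qed.

Lemma admissible_N_alpha w : adm w -> N_alpha alpha (U w).
Proof.
move=> aw; have [wi w2 we w0 u0] := aw.
have Pwi := integrableI_prim wi; have Pwc := continuous_prim wi.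
have po x : -1 <= x <= 1 -> prim w (- x) = - prim w x by move=> _; exact: (admissible_primN x aw).
have Um1 : U w (-1) = alpha by rewrite /profile primN1 addr0.
have U1 : U w 1 = alpha by rewrite /profile prim1 integralI_odd // addr0.
split => //.
- exists (prim w), w; split => //.
    by move=> x xI; rewrite primN1 add0r primE.
  by move=> x xI; rewrite Um1 -primE.
- by move=> x _; rewrite /profile prim_odd.
have I1 := itv_1.
have Im1 := itv_N1.
have UB y a : U w y - U w a = prim (prim w) y - prim (prim w) a by rewrite /profile; ring.
split; apply/cvgrPdist_le => k k0.
- have /nbhs_ballP[e /= e0 He] := prim_slope Pwc I1 k0.
  near=> h.
  have h0 : h < 0 by near: h; exact: nbhs_left_lt.
  have h1 : - Num.min e 1 < h.
    by near: h; apply: nbhs_left_gt; rewrite oppr_lt0 lt_min e0 ltr01.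
  have [he hm1] : - h < e /\ -1 < h.
    by move: h1; rewrite ltrNl lt_min => /andP[]; rewrite ltrNl; split=> //; lra.
  have hI : -1 <= 1 + h <= 1 by apply/andP; split; lra.
  have := He (1 + h); rewrite /ball /= => /(_ (ltac:(rewrite opprD addrA subrr sub0r gtr0_norm;
    lra)) hI).
  rewrite (prim1 w) w0 mul0r subr0 (_ : 1 + h - 1 = h) -?UB => [a1|]; last by ring.
  by rewrite sub0r normrN normrM normfV ler_pdivrMl ?normr_gt0 ?lt_eqF // mulrC.
- have /nbhs_ballP[e /= e0 He] := prim_slope Pwc Im1 k0.
  near=> h.
  have h0 : 0 < h by near: h; exact: nbhs_right_gt.
  have h1 : h < Num.min e 1.
    by near: h; apply: nbhs_right_lt; rewrite lt_min e0 ltr01.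
  have [he hm1] : h < e /\ h < 1 by move: h1; rewrite lt_min => /andP[].
  have hI : -1 <= -1 + h <= 1 by apply/andP; split; lra.
  have := He (-1 + h); rewrite /ball /= =>
    /(_ (ltac:(rewrite opprD addrA subrr sub0r normrN gtr0_norm; lra)) hI).
  rewrite (primN1 w) mul0r subr0 (_ : -1 + h - -1 = h) -?UB => [a1|]; last by ring.
  by rewrite sub0r normrN normrM normfV ler_pdivrMl ?normr_gt0 ?gt_eqF // mulrC.
Unshelve. all: by end_near. Qed.

End Translation.

(** * Limit theorems and compactness *)

Section Compactness.
Variable R : realType.
Implicit Types (f g h w : R -> R) (x y t s k M u p : R).
Local Notation mu := (@lebesgue_measure R).
Local Notation I := (`[(-1)%R, 1%R]%classic : set R).

(** Fatou's lemma with a vanishing error [e], which along a minimizing sequence is the distance to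
    the infimum. Integrability of the limit is part of the conclusion. *)
Lemma fatou_integralI (fn : nat -> R -> R) f c (e : nat -> R) : (forall n, integrableI (fn n)) ->
  (forall n x, -1 <= x <= 1 -> 0 <= fn n x) ->
  (forall x, -1 <= x <= 1 -> fn ^~ x @ \oo --> f x) ->
  (forall n, integralI (fn n) <= c + e n) -> e @ \oo --> 0 ->
  integrableI f /\ integralI f <= c.
Proof.
move=> fi f0 ff fc e0.
have f0' x : -1 <= x <= 1 -> 0 <= f x.
  move=> xI; apply: (cvgr_to_ge (ff x xI)).
  by apply: nearW => n; exact: f0.
have mf : measurable_fun I f.
  apply: (@measurable_fun_cvg _ _ _ _ fn) => [n|x /in_I xI]; first exact: integrableI_measurable.
  exact: ff.
have le : (\int[mu]_(x in I) (f x)%:E <= c%:E)%E.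
  rewrite (@eq_integral _ _ _ mu I (fun x => limn_einf (fun n => (fn n x)%:E))); last first.
    move=> x; rewrite inE => /in_I xI.
    have h : (fun n => (fn n x)%:E) @ \oo --> (f x)%:E by apply: cvg_EFin; [exact: nearW|exact: ff].
    by have [-> _] := cvg_limn_einf_sup h.
  apply: le_trans (@fatou _ _ _ mu I _ (fun n => EFin \o fn n) _ _) _ => //.
    by move=> n; apply/measurable_EFinP; exact: integrableI_measurable.
  rewrite limn_einf_lim; apply: lime_le; first exact: is_cvg_einfs.
  apply: nearW => n; apply/lee_addgt0Pr => k k0.
  have /cvgrPdist_le /(_ k k0) := e0; move=> [m _ me].
  (* An index beyond [n], so that it enters the infimum, and beyond [m], so that the error is at
     most [k]. *)
  have := me (maxn m n) (leq_maxl _ _); rewrite sub0r normrN => ek.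
  apply: (@le_trans _ _ (\int[mu]_(x in I) (fn (maxn m n) x)%:E)%E).
    by apply: ereal_inf_lbound; exists (maxn m n) => //=; exact: leq_maxr.
  rewrite integralI_E // -EFinD lee_fin; apply: le_trans (fc _) _.
  by rewrite lerD2l; apply: le_trans (ler_norm _) ek.
have fi' : integrableI f.
  apply/integrableP; split; first exact/measurable_EFinP.
  apply: le_lt_trans (ltry c); apply: le_trans le.
  by apply: ge0_le_integral_nomeas => x /in_I xI; rewrite ?abse_ge0 //= lee_fin ger0_norm ?f0'.
by split=> //; rewrite -lee_fin -integralI_E.
Qed.

(* Riesz-Fischer for a rapidly converging sequence; the exceptional null set is
   chosen symmetric so that the limit is even. *)
Lemma fast_cvg_ae (w : nat -> R -> R) (c : R) : (forall n, integrableI (w n)) ->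
  (forall n x, w n (- x) = w n x) ->
  (forall n, integralI (fun x => `|w n.+1 x - w n x|) <= c * 2^-1 ^+ n) ->
  exists (N : set R) (h v : R -> R), [/\ measurable N, mu N = 0%E, integrableI h,
    (forall x, v (- x) = v x) & forall x, -1 <= x <= 1 ->
    (forall n, `|w n x * \1_(~` N) x| <= h x) /\
    (fun n => w n x * \1_(~` N) x) @ \oo --> v x ].
Proof.
move=> wi we wc.
pose e n x := if n is n'.+1 then w n'.+1 x - w n' x else w 0%N x.
have ei n : integrableI (e n) by case: n => [|n]; [exact: wi|apply: integrableIB].
have wE n x : w n x = series (e ^~ x) n.+1.
  elim: n => [|n IH]; first by rewrite /series /= big_nat1.
  by rewrite /series /= big_nat_recr //= -[X in X + _]/(series (e ^~ x) n.+1) -IH addrC subrK.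
pose G x := (\sum_(n <oo) `|e n x|%:E)%E.
have mG n : measurable_fun I (fun x => `|e n x|%:E).
  by apply/measurable_EFinP; exact: integrableI_measurable (integrableI_norm (ei n)).
have G0 x : (0 <= G x)%E by apply: nneseries_ge0 => n _ _; rewrite lee_fin.
pose C := integralI (fun x => `|w 0%N x|) + 2 * c.
have c0 : 0 <= c.
  by have := wc 0%N; rewrite expr0 mulr1; apply: le_trans; exact: integralI_ge0.
have GC : (\int[mu]_(x in I) G x <= C%:E)%E.
  rewrite integral_nneseries //.
  apply: lime_le; first by apply: is_cvg_nneseries => n _ _; apply: integral_ge0 => x _;
    rewrite lee_fin.
  apply: nearW => n.
  rewrite (eq_bigr (fun i => (integralI (fun x => `|e i x|))%:E)); last first.
    by move=> i _; rewrite -integralI_E //; exact: integrableI_norm.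
  rewrite sumEFin lee_fin.
  (* The geometric remainder [2 * c * 2^-n] is subtracted to make the induction close: each new term
     is at most half of it. *)
  suff : \sum_(0 <= i < n.+1) integralI (fun x => `|e i x|) <= C - 2 * c * 2^-1 ^+ n.
    rewrite big_nat_recr //= => h; have := integralI_ge0 (fun x _ => normr_ge0 (e n x)).
    have : 0 <= 2 * c * 2^-1 ^+ n by rewrite !mulr_ge0 // exprn_ge0 // invr_ge0.
    by move: h; set X := \sum_(_ <= _ < _) _; lra.
  elim: n => [|n IH]; first by rewrite big_nat1 expr0 /C; lra.
  rewrite big_nat_recr //=; apply: le_trans (lerD IH (wc n)) _.
  by rewrite exprS; lra.
have Gi : mu.-integrable I G.
  apply/integrableP; split.
    by apply: (@ge0_emeasurable_sum _ _ _ _ (fun n x => `|e n x|%:E) predT) => //.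
  apply: le_lt_trans (ltry C); apply: le_trans GC.
  by apply: ge0_le_integral_nomeas => x _; rewrite ?abse_ge0 // gee0_abs.
have [N0 [mN0 N00 N0P]] := @integrable_ae _ _ R mu I (measurable_itv _) G Gi.
pose N := N0 `|` (-%R @^-1` N0).
have mN : measurable N.
  apply: measurableU => //; rewrite -[_ @^-1` _]setTI.
  exact: (oppr_measurable measurableT mN0).
have NN x : ((- x) \in N) = (x \in N).
  by apply/idP/idP; rewrite !inE /N /= ?opprK; case; [right|left|right|left].
have mu0 : mu N = 0%E.
  apply: null_set_setU => //.
    by rewrite -[_ @^-1` _]setTI; exact: (oppr_measurable measurableT mN0).
  by rewrite -[RHS]N00; exact: lebesgue_measureN.
have finG x : -1 <= x <= 1 -> ~ N x -> G x = (fine (G x))%:E.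
  move=> xI nN; rewrite fineK //; apply: contrapT => h; apply: nN; left; apply: N0P => /= h'.
  by apply: h; apply: h'; exact/in_I.
have sumle x n : -1 <= x <= 1 -> ~ N x -> \sum_(0 <= i < n) `|e i x| <= fine (G x).
  move=> xI nN; rewrite -lee_fin -finG // -sumEFin.
  by apply: nneseries_lim_ge => k _ _; rewrite lee_fin.
(* Multiplication by the indicator of the complement of [N] makes the sequence converge at every
   point of [[-1, 1]], to [0] on [N]. Symmetry of [N] keeps each term even, hence the limit. *)
exists N, (fine \o G), (fun x => limn (fun n => w n x * \1_(~` N) x)); split => //.
- have h1 : integrableI (fine \o G).
    apply/integrableP; split.
      apply/measurable_EFinP; apply: measurableT_comp => //; exact: (measurable_int mu Gi).
    have /integrableP[_] := Gi; apply: le_lt_trans.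
    apply: ge0_le_integral_nomeas => x _; first by rewrite abse_ge0.
    rewrite /= ger0_norm ?fine_ge0 // gee0_abs //.
    by have := G0 x; case: (G x) => //= r _; rewrite leey.
  exact: h1.
- move=> x; congr (limn _); apply/funext => n.
  by rewrite !indicE !in_setC NN we.
move=> x xI; have [xN|xN] := pselect (N x).
  have w0 n : w n x * \1_(~` N) x = 0 by rewrite indicE in_setC mem_set //= mulr0.
  split; first by move=> n; rewrite w0 normr0 /= fine_ge0.
  by under eq_fun do rewrite w0; rewrite lim_cst //; exact: cvg_cst.
have w0 n : w n x * \1_(~` N) x = w n x by rewrite indicE in_setC memNset //= mulr1.
split.
  move=> n; rewrite w0 wE; apply: le_trans (ler_norm_sum _ _ _) _.
  exact: sumle.
under eq_fun do rewrite w0.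
suff : cvgn (fun n => w n x) by [].
under eq_fun do rewrite wE.
suff /cvg_ex[l hl] : cvgn (series (e ^~ x)).
  by apply/cvg_ex; exists l; rewrite cvg_shiftS.
apply: normed_cvg; apply: nondecreasing_is_cvgn.
  apply/nondecreasing_seqP => n.
  change (\sum_(0 <= k < n) `|e k x| <= \sum_(0 <= k < n.+1) `|e k x|).
  by rewrite big_nat_recr //= lerDl normr_ge0.
by exists (fine (G x)) => _ [n _ <-]; exact: sumle.
Qed.

Lemma ae_eq_integralI (N : set R) f g : measurable N -> mu N = 0%E -> integrableI f -> integrableI g ->
  (forall x, -1 <= x <= 1 -> ~ N x -> f x = g x) -> integralI f = integralI g.
Proof.
move=> mN N0 fi gi fg; apply/EFin_inj; rewrite -!integralI_E //.
apply: ae_eq_integral => //; try by apply/measurable_EFinP; exact: integrableI_measurable.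
exists N; split => // x /= h; apply: contrapT => xN; apply: h => /in_I xI.
by rewrite fg.
Qed.

Lemma ae_eq_prim (N : set R) f g x : measurable N -> mu N = 0%E -> integrableI f -> integrableI g ->
  (forall x, -1 <= x <= 1 -> ~ N x -> f x = g x) -> prim f x = prim g x.
Proof.
move=> mN N0 fi gi fg; rewrite !prim_integral; apply: (ae_eq_integralI mN N0);
  try exact: integrableI_ind.
by move=> t tI nt; rewrite fg.
Qed.

Lemma integrableI_indic (A : set R) f : measurable A -> integrableI f -> integrableI (fun x =>
  f x * \1_A x).
Proof.
move=> mA fi.
have h : measurable_fun I (\1_A : R -> R) by apply: measurable_indic.
apply: (integrableI_mul fi h (M := 1)) => x _.
by rewrite indicE; case: (x \in A); rewrite ?normr1 ?normr0.
Qed.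

Lemma integralI_dominated (fn : nat -> R -> R) f h : (forall n,
  integrableI (fn n)) -> integrableI h ->
  (forall n x, -1 <= x <= 1 -> `|fn n x| <= h x) ->
  (forall x, -1 <= x <= 1 -> fn ^~ x @ \oo --> f x) ->
  integrableI f /\ (fun n => integralI (fn n)) @ \oo --> integralI f.
Proof.
move=> fi hi fh ff.
have mf : measurable_fun I f.
  apply: (@measurable_fun_cvg _ _ _ _ fn) => [n|x /in_I xI]; first exact: integrableI_measurable.
  exact: ff.
have [] := @dominated_convergence _ _ R mu I (measurable_itv _) (fun n =>
  EFin \o fn n) (EFin \o f) (EFin \o h).
- by move=> n; apply/measurable_EFinP; exact: integrableI_measurable.
- exact/measurable_EFinP.
- apply: aeW => x /in_I xI; apply: cvg_EFin; [exact: nearW|exact: ff].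
- exact: hi.
- by apply: aeW => x n /in_I xI; rewrite /= lee_fin fh.
move=> fint _ c; split; first exact: fint.
have : (fun n => (integralI (fn n))%:E) @ \oo --> (integralI f)%:E.
  rewrite -integralI_E //; move: c; apply: cvg_trans; apply: near_eq_cvg.
  by apply: nearW => n; rewrite /= integralI_E.
by move/fine_cvgP => [_].
Qed.

Lemma ultra_fmap (S T : Type) (g : S -> T) (G : set_system S) :
  UltraFilter G -> UltraFilter (g @ G).
Proof.
move=> GU; split; first exact: fmap_proper_filter.
move=> H HF sub; apply/seteqP; split => // A HA.
have [//|nA] := in_ultra_setVsetC (g @^-1` A) GU.
have HnA : H (~` A) by apply: sub.
by exfalso; apply: (filter_not_empty H); rewrite -(setICr A); exact: filterI.
Qed.

(** Arzela-Ascoli with an ultrafilter finer than [\oo] in place of a diagonal subsequence: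
    compactness of [[- M, M]] gives pointwise limits along it, equicontinuity passes to the limit,
    and a finite grid makes the closeness uniform at some index beyond [N]. *)
Lemma equicontinuous_cluster (fn : nat -> R -> R) M :
  (forall n x, -1 <= x <= 1 -> `|fn n x| <= M) ->
  (forall k, 0 < k -> exists2 d, 0 < d & forall n x y, -1 <= x <= 1 -> -1 <= y <= 1 ->
     `|x - y| < d -> `|fn n x - fn n y| <= k) ->
  exists f, forall k N, 0 < k -> exists2 n, (N <= n)%N &
     forall x, -1 <= x <= 1 -> `|fn n x - f x| <= k.
Proof.
move=> bd ec.
have [G [GU Goo]] := @ultraFilterLemma nat \oo _.
have lim x : exists l : R, -1 <= x <= 1 -> fn ^~ x @ G --> l.
  case: (pselect (-1 <= x <= 1)) => xI; last by exists 0 => /xI.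
  have := @segment_compact R (- M) M; rewrite compact_ultra.
  move=> /(_ (fn ^~ x @ G)) [].
  - exact: ultra_fmap.
  - change (G (fn ^~ x @^-1` `[- M, M])).
    by apply: filterS filterT => n _ /=; rewrite in_itv /= -ler_norml bd.
  by move=> l [_ ll]; exists l.
pose f x := projT1 (cid (lim x)).
have fP x : -1 <= x <= 1 -> fn ^~ x @ G --> f x := projT2 (cid (lim x)).
exists f => k N k0.
(* The final triangle inequality spends one fifth on [fn n] between [x] and the grid point, one on
   the distance to the limit there, and three on the modulus of continuity [fec] of the limit. *)
have k5 : 0 < k / 5 by rewrite divr_gt0.
have [d d0 dP] := ec _ k5.
have near1 x : -1 <= x <= 1 -> \forall n \near G, `|fn n x - f x| <= k / 5.
  by move=> xI; have /cvgrPdist_le /(_ _ k5) := fP x xI; apply: filterS => n; rewrite distrC.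
have fec x y : -1 <= x <= 1 -> -1 <= y <= 1 -> `|x - y| < d -> `|f x - f y| <= k / 5 * 3.
  move=> xI yI xy.
  have [n [n1 n2]] := @filter_ex _ G _ _ (filterI (near1 x xI) (near1 y yI)).
  have -> : f x - f y = - (fn n x - f x) + (fn n x - fn n y) + (fn n y - f y) by ring.
  apply: le_trans (ler_normD _ _) _; apply: le_trans (lerD (ler_normD _ _) (lexx _)) _.
  rewrite normrN; have := dP n x y xI yI xy; lra.
(* Enough points of mesh [d], starting at [-1], for each [x] in [[-1, 1]] to lie less than [d] to
   the right of one of them. *)
pose K := (Num.truncn (2 / d)).+1.
pose pt (i : nat) := -1 + i%:R * d.
have nearK : \forall n \near G, forall i : 'I_K,
  -1 <= pt i <= 1 -> `|fn n (pt i) - f (pt i)| <= k / 5.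
  apply: filter_forall => i; case: (pselect (-1 <= pt i <= 1)) => h.
    by apply: filterS (near1 _ h) => n.
  by apply: filterS filterT => n _ /h.
have nearN : \forall n \near G, (N <= n)%N by apply: Goo; exists N.
have [n [nK nN]] := @filter_ex _ G _ _ (filterI nearK nearN).
exists n => // x xI.
pose i := Num.truncn ((x + 1) / d).
case/andP: (xI) => x1 x2.
have xd : 0 <= (x + 1) / d by rewrite divr_ge0 // ?(ltW d0) //; lra.
have /andP[i1 i2] := truncn_itv xd; rewrite -/i in i1 i2.
rewrite ler_pdivlMr // in i1; rewrite ltr_pdivrMr // in i2.
have iK : (i < K)%N.
  rewrite /i truncn_lt_nat //; apply: le_lt_trans (truncnS_gt (2 / d)).
  by rewrite ler_pM2r ?invr_gt0 //; lra.
have ptI : -1 <= pt i <= 1.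
  rewrite /pt; apply/andP; split; last by lra.
  by rewrite lerDl mulr_ge0 // ltW.
have ptx : `|x - pt i| < d.
  rewrite -natr1 mulrDl mul1r in i2; rewrite /pt ger0_norm; lra.
have e1 := dP n x (pt i) xI ptI ptx.
have e2 := nK (Ordinal iK) ptI; rewrite /= in e2.
have e3 := fec x (pt i) xI ptI ptx.
have -> : fn n x - f x = (fn n x - fn n (pt i)) + (fn n (pt i) - f (pt i)) - (f x - f (pt i)) by ring.
apply: le_trans (ler_normB _ _) _; apply: le_trans (lerD (ler_normD _ _) (lexx _)) _.
lra.
Qed.

(** * Lipschitz estimates for the Lagrangian and uniform convexity in [u''] *)

Lemma arcl_lip p p' : `|arcl p - arcl p'| <= `|p - p'|.
Proof.
have a0 := arcl_gt0 p; have b0 := arcl_gt0 p'.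
have := norm_le_arcl p; have := norm_le_arcl p' => h1 h2.
rewrite -(@ler_pM2r _ (arcl p + arcl p')) ?addr_gt0 //.
have {1}<- : `|arcl p + arcl p'| = arcl p + arcl p' by rewrite gtr0_norm ?addr_gt0.
rewrite -normrM (_ : _ * _ = (p - p') * (p + p')).
  rewrite normrM ler_wpM2l //; apply: le_trans (ler_normD _ _) _; lra.
transitivity (arcl p ^+ 2 - arcl p' ^+ 2); first by ring.
by rewrite !arcl_sqr; ring.
Qed.

Lemma inv_arcl_lip p p' : `|(arcl p)^-1 - (arcl p')^-1| <= `|p - p'|.
Proof.
have a0 := arcl_gt0 p; have b0 := arcl_gt0 p'.
have a1 := arcl_ge1 p; have b1 := arcl_ge1 p'.
apply: le_trans (arcl_lip p p').
have -> : (arcl p)^-1 - (arcl p')^-1 = - (arcl p - arcl p') / (arcl p * arcl p').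
  by field; rewrite !gt_eqF.
rewrite normrM normrN ler_piMr // normfV invf_le1 ?normr_gt0 ?mulf_neq0 ?gt_eqF //.
by rewrite gtr0_norm ?mulr_gt0 //; nra.
Qed.

Lemma norm_mulB_le (a a' b b' ka kb : R) : `|a'| <= ka -> `|b| <= kb ->
  `|a * b - a' * b'| <= kb * `|a - a'| + ka * `|b - b'|.
Proof.
move=> h1 h2; have -> : a * b - a' * b' = b * (a - a') + a' * (b - b') by ring.
by apply: le_trans (ler_normD _ _) _; rewrite !normrM lerD // ler_wpM2r.
Qed.

Lemma exp_lip (a b : R) n : 0 <= a <= 1 -> 0 <= b <= 1 -> `|a ^+ n - b ^+ n| <= n%:R * `|a - b|.
Proof.
move=> /andP[a0 a1] /andP[b0 b1]; elim: n => [|n IH]; first by rewrite subrr normr0 mul0r.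
rewrite !exprS; apply: le_trans (@norm_mulB_le _ _ _ _ 1 1 _ _) _.
- by rewrite ger0_norm.
- by rewrite ger0_norm ?exprn_ge0 // exprn_ile1.
- by rewrite !mul1r -[n.+1%:R]natr1 mulrDl mul1r addrC lerD2r.
Qed.

Variables alpha eps : R.
Hypothesis eps0 : 0 <= eps.
Local Notation U := (profile alpha).
Local Notation F := (energy alpha eps).
Local Notation adm := (admissible alpha).

Lemma inv_arcl01 p : 0 <= (arcl p)^-1 <= 1.
Proof. by rewrite invr_ge0 ltW ?arcl_gt0 //= invf_le1 ?arcl_gt0 // arcl_ge1. Qed.

Lemma lagrA_lip u u' p p' C : `|u'| <= C ->
  `|lagrA u p - lagrA u' p'| <= (1 + 5 * C) * (`|u - u'| + `|p - p'|).
Proof.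
move=> uC; have C0 : 0 <= C by apply: le_trans uC.
have /andP[r0 r1] := inv_arcl01 p.
apply: le_trans (@norm_mulB_le _ _ _ _ C 1 uC _) _.
  by rewrite ger0_norm ?exprn_ge0 // exprn_ile1.
have := exp_lip 5 (inv_arcl01 p) (inv_arcl01 p').
have := inv_arcl_lip p p'; set X := `|_ ^-1 - _|; set Y := `|p - p'|;
  set Z := `|_ ^+ 5 - _| => h1 h2.
have h3 : C * Z <= C * (5 * Y) by rewrite ler_wpM2l //; lra.
have n1 : 0 <= `|u - u'| by []. have n2 : 0 <= Y by exact: normr_ge0.
have n3 := mulr_ge0 C0 n1; set V := `|u - u'| in n1 n3 *.
by clear h1 h2; move: h3 n1 n2 n3; move: (C * Z) V Y => CZ V Y; clear; lra.
Qed.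

Lemma lagrB_lip u u' p p' m C Q : 0 < m -> m <= u <= C -> m <= u' <= C -> arcl p <= Q ->
  `|lagrB eps u p - lagrB eps u' p'| <= (m^-1 ^+ 2 + m^-1 + 4 * eps * (Q + C)) * (`|u - u'| + `|p - p'|).
Proof.
move=> m0 /andP[mu1 uC] /andP[mu' u'C] pQ.
have u0 : 0 < u by lra. have u'0 : 0 < u' by lra.
have /andP[r0 r1] := inv_arcl01 p.
have im u1 : m <= u1 -> `|u1^-1| <= m^-1.
  by move=> h; rewrite ger0_norm ?invr_ge0 ?lef_pV2 ?posrE //; lra.
have h1 : `|u^-1 * (arcl p)^-1 - u'^-1 * (arcl p')^-1| <= m^-1 ^+ 2 * `|u - u'| + m^-1 * `|p - p'|.
  apply: le_trans (@norm_mulB_le _ _ _ _ m^-1 1 (im _ mu') _) _; first by rewrite ger0_norm.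
  rewrite mul1r lerD //; last first.
    by rewrite ler_wpM2l ?inv_arcl_lip // invr_ge0 ltW.
  have -> : u^-1 - u'^-1 = - (u^-1 * u'^-1 * (u - u')) by field; rewrite !gt_eqF.
  by rewrite normrN normrM ler_wpM2r // normrM expr2 ler_pM // im.
have h2 : `|u * arcl p - u' * arcl p'| <= Q * `|u - u'| + C * `|p - p'|.
  apply: le_trans (@norm_mulB_le _ _ _ _ C Q _ _) _.
  - by rewrite ger0_norm // ltW.
  - by rewrite gtr0_norm // arcl_gt0.
  - by rewrite lerD2l ler_wpM2l ?arcl_lip //; lra.
have -> : lagrB eps u p - lagrB eps u' p' = (u^-1 * (arcl p)^-1 - u'^-1 * (arcl p')^-1) +
   4 * eps * (u * arcl p - u' * arcl p') by rewrite /lagrB; ring.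
apply: le_trans (ler_normD _ _) _; rewrite normrM [`|4 * eps|]ger0_norm ?mulr_ge0 //.
have e4 : 0 <= 4 * eps by rewrite mulr_ge0.
have := ler_wpM2l e4 h2.
have a0 := normr_ge0 (u - u'); have b0 := normr_ge0 (p - p').
set a := `|u - u'| in h1 a0 *; set b := `|p - p'| in h1 b0 *; move=> h3.
have Q0 : 0 <= Q by apply: le_trans pQ; exact/ltW/arcl_gt0.
have n1 : 0 <= m^-1 * a by rewrite mulr_ge0 // invr_ge0 ltW.
have n2 : 0 <= m^-1 ^+ 2 * b by rewrite mulr_ge0 // sqr_ge0.
have n3 : 0 <= 4 * eps * (Q * b) by rewrite !mulr_ge0.
have n4 : 0 <= 4 * eps * (C * a) by rewrite !mulr_ge0 //; lra.
apply: le_trans (lerD h1 h3) _.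
by move: n1 n2 n3 n4 a0 b0; clear; lra.
Qed.

Lemma mid_profile w1 w2 x : integrableI w1 -> integrableI w2 ->
  prim (fun x => 2^-1 * (w1 x + w2 x)) x = 2^-1 * (prim w1 x + prim w2 x) /\
  U (fun x => 2^-1 * (w1 x + w2 x)) x = 2^-1 * (U w1 x + U w2 x).
Proof.
move=> i1 i2.
have PE' y : prim (fun x => 2^-1 * (w1 x + w2 x)) y = 2^-1 * (prim w1 y + prim w2 y).
  by rewrite primZ ?primD //; exact: integrableID.
split=> //; rewrite /profile (eq_prim (g := fun x => 2^-1 * (prim w1 x + prim w2 x))) //.
rewrite primZ ?primD //; try exact: integrableI_prim; first by field.
by apply: integrableID; exact: integrableI_prim.
Qed.

Lemma integrableI_sqrD w1 w2 : integrableI w1 -> integrableI w2 -> integrableI (fun x =>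
  w1 x ^+ 2) ->
  integrableI (fun x => w2 x ^+ 2) -> integrableI (fun x => (w1 x + w2 x) ^+ 2).
Proof.
move=> i1 i2 s1 s2; apply: (@integrableI_le _ _ (fun x => 2 * (w1 x ^+ 2 + w2 x ^+ 2))).
- by apply: measurable_funX; apply: integrableI_measurable; exact: integrableID.
- by apply/integrableIZ/integrableID.
- move=> x _; rewrite ger0_norm ?sqr_ge0 //.
  by have := sqr_ge0 (w1 x - w2 x); nra.
Qed.

Lemma integrableI_sqrB w1 w2 : integrableI w1 -> integrableI w2 -> integrableI (fun x =>
  w1 x ^+ 2) ->
  integrableI (fun x => w2 x ^+ 2) -> integrableI (fun x => (w1 x - w2 x) ^+ 2).
Proof.
move=> i1 i2 s1 s2; apply: integrableI_sqrD => //; first exact: integrableIN.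
by apply: eq_integrableI s2 => x _; rewrite sqrrN.
Qed.

Lemma integrableI_sqrZ k w : integrableI (fun x => w x ^+ 2) -> integrableI (fun x =>
  (k * w x) ^+ 2).
Proof. by move=> /(integrableIZ (k ^+ 2)); apply: eq_integrableI => x _; rewrite exprMn. Qed.

Lemma admissible_mid w1 w2 : adm w1 -> adm w2 -> adm (fun x => 2^-1 * (w1 x + w2 x)).
Proof.
move=> a1 a2; have [i1 s1 e1 z1 _] := a1; have [i2 s2 e2 z2 _] := a2; split.
- by apply/integrableIZ/integrableID.
- by apply/integrableI_sqrZ/integrableI_sqrD.
- by move=> x; rewrite e1 e2.
- by rewrite integralIZ ?integralID ?z1 ?z2 ?addr0 ?mulr0 //; exact: integrableID.
- move=> x _; rewrite (mid_profile x i1 i2).2.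
  by rewrite mulr_gt0 ?invr_gt0 // addr_gt0 // profile_gt0.
Qed.

(** With a common coefficient [e] of the squares, [2 (e a^2 + e b^2 - 2 e ((a + b) / 2)^2)] is
    exactly [e (a - b)^2]. Replacing [e1], [e2] and the lower bound [a0] by the midpoint coefficient
    costs multiples of [T], which add up to [4 T (a^2 + b^2)]; the terms free of squares cost
    [4 S]. *)
Lemma sqr_mid_le (a b a0 e1 e2 em b1 b2 bm T S : R) : 0 <= T -> a0 <= e1 ->
  `|e1 - em| <= T -> `|e2 - em| <= T -> `|b1 - bm| <= S -> `|b2 - bm| <= S ->
  a0 * (a - b) ^+ 2 <=
    2 * ((a ^+ 2 * e1 + b1) + (b ^+ 2 * e2 + b2) -
         2 * ((2^-1 * (a + b)) ^+ 2 * em + bm)) +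
    (4 * T * (a ^+ 2 + b ^+ 2) + 4 * S).
Proof.
move=> T0 h0; rewrite !ler_norml => /andP[h1 h1'] /andP[h2 _] /andP[h3 _] /andP[h4 _].
have z1 : 0 <= a ^+ 2 * (e1 - em + T) by rewrite mulr_ge0 ?sqr_ge0 //; clear -h1; lra.
have z2 : 0 <= b ^+ 2 * (e2 - em + T) by rewrite mulr_ge0 ?sqr_ge0 //; clear -h2; lra.
have z3 : 0 <= (a - b) ^+ 2 * (em + T - a0).
  by rewrite mulr_ge0 ?sqr_ge0 //; clear -h1' h0; lra.
have z4 : 0 <= T * (a + b) ^+ 2 by rewrite mulr_ge0 ?sqr_ge0.
clear h1 h1' h2 h0 T0.
rewrite -subr_ge0; set g := _ - _.
have -> : g = 2 * (a ^+ 2 * (e1 - em + T)) + 2 * (b ^+ 2 * (e2 - em + T)) +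
  (a - b) ^+ 2 * (em + T - a0) + T * (a + b) ^+ 2 + 2 * (b1 - bm + S) + 2 * (b2 - bm + S).
  by rewrite /g; field.
clear g; move: z1 z2 z3 z4.
move: (a ^+ 2 * _) (b ^+ 2 * _) ((a - b) ^+ 2 * _) (T * _) => x1 x2 x3 x4; clear -h3 h4; lra.
Qed.

Lemma mid_itv (m C X Y : R) : m <= X -> X <= C -> m <= Y -> Y <= C ->
  m <= 2^-1 * (X + Y) <= C.
Proof. by move=> *; apply/andP; split; lra. Qed.

(* The energy is uniformly convex in [w], up to an error controlled by the
   uniform distance of the first derivatives [prim w]. *)
Lemma energy_mid (Q m C : R) : 1 <= Q -> 0 < m -> exists K, forall w1 w2 d,
  adm w1 -> adm w2 ->
  (forall x, arcl (prim w1 x) <= Q) -> (forall x, arcl (prim w2 x) <= Q) ->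
  (forall x, m <= U w1 x <= C) -> (forall x, m <= U w2 x <= C) ->
  integralI (fun x => w1 x ^+ 2) <= C -> integralI (fun x => w2 x ^+ 2) <= C ->
  (forall x, -1 <= x <= 1 -> `|prim w1 x - prim w2 x| <= d) ->
  m * Q^-1 ^+ 5 * integralI (fun x => (w1 x - w2 x) ^+ 2) <=
  2 * (F w1 + F w2 - 2 * F (fun x => 2^-1 * (w1 x + w2 x))) + K * d.
Proof.
move=> Q1 m0.
pose KA := 1 + 5 * C; pose KB := m^-1 ^+ 2 + m^-1 + 4 * eps * (Q + C).
(* [KA] and [KB] are the Lipschitz constants of [lagrA] and [lagrB], and [2 * d] bounds the distance
   of either [(u, u')] to the midpoint. After integration [2 * C] bounds the two integrals of
   squares, and the last [2] is the length of the interval. *)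
exists (4 * (KA * 2) * (2 * C) + 4 * (KB * 2) * 2) => w1 w2 d a1 a2 q1 q2 u1 u2 c1 c2 dP.
have [i1 s1 _ _ _] := a1; have [i2 s2 _ _ _] := a2.
set wm := fun x => 2^-1 * (w1 x + w2 x).
have am : adm wm by exact: admissible_mid.
have Qn0 : 0 < Q by apply: lt_le_trans Q1.
have d0 : 0 <= d by apply: le_trans (dP 0 _); rewrite ?normr_ge0 // oppr_le0 ler01.
have hd : 2^-1 * (2 * d) + 2^-1 * d <= 2 * d by lra.
have C0 : 0 < C by case/andP: (u1 0) => h1 h2; apply: lt_le_trans m0 (le_trans h1 h2).
have KA0 : 0 <= KA by rewrite /KA addr_ge0 // mulr_ge0 // ltW.
have KB0 : 0 <= KB.
  by rewrite /KB !addr_ge0 ?sqr_ge0 ?invr_ge0 ?mulr_ge0 ?addr_ge0 // ltW.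
have dU x : `|U w1 x - U w2 x| <= 2 * d.
  have -> : U w1 x - U w2 x = prim (fun t => prim w1 t - prim w2 t) x.
    by rewrite primB /profile; [ring|exact: integrableI_prim|exact: integrableI_prim].
  apply: le_trans (prim_bound _ _) _; first by apply: integrableIB; exact: integrableI_prim.
  rewrite mulrC -integralI_cst; apply: integralI_le => //; last exact: integrableI_cst.
  by apply: integrableI_norm; apply: integrableIB; exact: integrableI_prim.
have half (X Y d' : R) : `|X - Y| <= d' ->
    `|X - 2^-1 * (X + Y)| <= 2^-1 * d' /\ `|Y - 2^-1 * (X + Y)| <= 2^-1 * d'.
  move=> h; have -> : X - 2^-1 * (X + Y) = 2^-1 * (X - Y) by field.
  have -> : Y - 2^-1 * (X + Y) = - (2^-1 * (X - Y)) by field.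
  by rewrite normrN normrM [`|2^-1|]ger0_norm ?invr_ge0 // ler_wpM2l ?invr_ge0.
pose T := KA * (2 * d); pose S := KB * (2 * d).
have T0 : 0 <= T by rewrite !mulr_ge0.
have key x : -1 <= x <= 1 ->
  m * Q^-1 ^+ 5 * (w1 x - w2 x) ^+ 2 <=
  2 * (lagr eps (U w1 x) (prim w1 x) (w1 x) + lagr eps (U w2 x) (prim w2 x) (w2 x) -
    2 * lagr eps (U wm x) (prim wm x) (wm x)) + (4 * T * (w1 x ^+ 2 + w2 x ^+ 2) + 4 * S).
  move=> xI; have [Pm Um] := mid_profile x i1 i2; rewrite -/wm in Pm Um.
  have Umb : m <= U wm x <= C.
    by rewrite Um; move: (u1 x) (u2 x) => /andP[h1 h2] /andP[h3 h4]; exact: mid_itv.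
  have Uma : `|U wm x| <= C by rewrite ger0_norm; case/andP: Umb => // h _; apply: le_trans h;
    exact: ltW.
  have [p1 p2] := half _ _ _ (dP x xI); rewrite -Pm in p1 p2.
  have [v1 v2] := half _ _ _ (dU x); rewrite -Um in v1 v2.
  have n1 : `|U w1 x - U wm x| + `|prim w1 x - prim wm x| <= 2 * d.
    by apply: le_trans (lerD v1 p1) hd.
  have n2 : `|U w2 x - U wm x| + `|prim w2 x - prim wm x| <= 2 * d.
    by apply: le_trans (lerD v2 p2) hd.
  have A1 := le_trans (lagrA_lip (U w1 x) (prim w1 x) (prim wm x) Uma) (ler_wpM2l KA0 n1).
  have A2 := le_trans (lagrA_lip (U w2 x) (prim w2 x) (prim wm x) Uma) (ler_wpM2l KA0 n2).
  have B1 := le_trans (lagrB_lip (prim wm x) m0 (u1 x) Umb (q1 x)) (ler_wpM2l KB0 n1).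
  have B2 := le_trans (lagrB_lip (prim wm x) m0 (u2 x) Umb (q2 x)) (ler_wpM2l KB0 n2).
  have A0 : m * Q^-1 ^+ 5 <= lagrA (U w1 x) (prim w1 x).
    case/andP: (u1 x) => h _.
    rewrite /lagrA ler_pM ?(ltW m0) ?exprn_ge0 ?invr_ge0 ?(ltW Qn0) //.
    by rewrite lerXn2r ?nnegrE ?invr_ge0 ?(ltW Qn0) ?(ltW (arcl_gt0 _)) // lef_pV2 ?posrE ?arcl_gt0.
  exact: sqr_mid_le T0 A0 A1 A2 B1 B2.
have L1 := integrableI_lagr eps a1; have L2 := integrableI_lagr eps a2;
  have Lm := integrableI_lagr eps am.
have sB : integrableI (fun x => (w1 x - w2 x) ^+ 2) by exact: integrableI_sqrB.
have LL : integrableI (fun x => lagr eps (U w1 x) (prim w1 x) (w1 x) + lagr eps (U w2 x) (prim w2 x) (w2 x) -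
    2 * lagr eps (U wm x) (prim wm x) (wm x)) by apply: integrableIB (integrableID L1 L2) (integrableIZ 2 Lm).
have ss : integrableI (fun x => 4 * T * (w1 x ^+ 2 + w2 x ^+ 2)) by exact: integrableIZ (integrableID s1 s2).
have ss' := integrableID ss (integrableI_cst (4 * S)).
rewrite -integralIZ //.
apply: le_trans (integralI_le (integrableIZ _ sB) (integrableID (integrableIZ 2 LL) ss') key) _.
rewrite (integralID (integrableIZ 2 LL) ss') (integralIZ _ LL).
rewrite (integralIB (integrableID L1 L2) (integrableIZ 2 Lm)) (integralID L1 L2) (integralIZ _ Lm).
rewrite (integralID ss (integrableI_cst _)) (integralIZ _ (integrableID s1 s2)) (integralID s1 s2).
rewrite integralI_cst -/(F w1) -/(F w2) -/(F wm).
rewrite lerD2l; have := ler_wpM2l (mulr_ge0 (ler0n _ 4) T0) (lerD c1 c2).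
by rewrite /T /S; move: (integralI _) (integralI _) => X Y; clear; lra.
Qed.

End Compactness.

(** * Existence of a minimizer *)

Section Minimizer.
Variable R : realType.
Implicit Types (f g h w : R -> R) (x y t s k M u p : R).

Variables alpha eps : R.
Hypothesis alpha0 : 0 < alpha.
Hypothesis eps0 : 0 <= eps.
Local Notation U := (profile alpha).
Local Notation F := (energy alpha eps).
Local Notation adm := (admissible alpha).

(** Young's inequality [|w| <= (l + w^2 / l) / 2] bounds an increment of [prim w] by the mean of
    [l * |y - x|] and [C / l]. The weight [l] makes the second at most [k], and the radius [k / l]
    then does the same for the first. *)
Lemma prim_equicont C k : 0 < k -> exists2 d, 0 < d &
  forall w x y, integrableI w -> integrableI (fun x => w x ^+ 2) -> integralI (fun x =>
    w x ^+ 2) <= C ->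
  `|y - x| < d -> `|prim w y - prim w x| <= k.
Proof.
move=> k0; pose l := (`|C| + 1) / k.
have l0 : 0 < l by rewrite divr_gt0 // ltr_wpDl.
exists (k / l) => [|w x y wi w2 wC yx]; first by rewrite divr_gt0.
pose h t := 2^-1 * (l + l^-1 * w t ^+ 2).
have hi : integrableI h by apply/integrableIZ/integrableID;
  [exact: integrableI_cst|exact: integrableIZ].
have h0 t : 0 <= h t.
  by rewrite mulr_ge0 ?invr_ge0 // addr_ge0 ?(ltW l0) // mulr_ge0 ?sqr_ge0 // invr_ge0 ltW.
apply: le_trans (_ : `|prim h y - prim h x| <= _).
  apply: prim_dist => // t _ _; rewrite /h.
  rewrite -subr_ge0 (_ : _ - _ = 2^-1 * (l^-1 * (`|w t| - l) ^+ 2)).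
    by rewrite mulr_ge0 ?invr_ge0 // mulr_ge0 ?sqr_ge0 // invr_ge0 ltW.
  rewrite -[w t ^+ 2]real_normK ?num_real //; field.
  by rewrite gt_eqF.
have hE z : prim h z = 2^-1 * (l * prim (fun=> 1) z + l^-1 * prim (fun x => w x ^+ 2) z).
  rewrite primZ; last by apply: integrableID; [exact: integrableI_cst|exact: integrableIZ].
  rewrite primD; [|exact: integrableI_cst|exact: integrableIZ].
  have -> : prim (fun=> l) z = l * prim (fun=> 1) z.
    by rewrite -primZ; [apply: eq_prim => t _; rewrite mulr1|exact: integrableI_cst].
  by rewrite (primZ _ _ w2).
rewrite !hE -mulrBr normrM ger0_norm ?invr_ge0 //.
set X := _ - _; have -> : X = l * (prim (fun=> 1) y - prim (fun=> 1) x) +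
   l^-1 * (prim (fun x => w x ^+ 2) y - prim (fun x => w x ^+ 2) x) by rewrite /X; ring.
clear X; have b1 : `|l * (prim (fun=> 1) y - prim (fun=> 1) x)| <= k.
  rewrite normrM gtr0_norm // mulrC -ler_pdivlMr //.
  by apply: le_trans (prim_one_dist x y) (ltW yx).
have b2 : `|l^-1 * (prim (fun x => w x ^+ 2) y - prim (fun x => w x ^+ 2) x)| <= k.
  rewrite normrM gtr0_norm ?invr_gt0 // mulrC ler_pdivrMr //.
  rewrite /l mulrCA divff ?gt_eqF // mulr1.
  have s0 : forall t, -1 <= t <= 1 -> 0 <= w t ^+ 2 by move=> t _; exact: sqr_ge0.
  have PP z : 0 <= prim (fun x => w x ^+ 2) z <= integralI (fun x => w x ^+ 2).
    have e : `|prim (fun x => w x ^+ 2) z| <= integralI (fun x => w x ^+ 2).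
      apply: le_trans (prim_bound z w2) _; apply: integralI_le => //; first exact: integrableI_norm.
      by move=> t _; rewrite ger0_norm ?sqr_ge0.
    rewrite (le_trans (ler_norm _) e) andbT.
    rewrite -(prim_leN1 (fun x => w x ^+ 2) (x := Num.min z (-1))) ?ge_min ?lexx ?orbT //.
    by apply: prim_mono => //; rewrite ge_min lexx.
  have /andP[a1 a2] := PP x; have /andP[a3 a4] := PP y.
  have h1 := ler_norm C; rewrite ler_norml; apply/andP; split; lra.
by rewrite mulrC ler_pdivrMr // mulr_natr mulr2n; apply: le_trans (ler_normD _ _) (lerD b1 b2).
Qed.

(** Bookkeeping for [energy_mid]: [a] and [b] are the energies of two near minimizers, [Y] is that
    of their midpoint and [i] the infimum. *)
Lemma near_inf_gap (a b Y i p p' q r : R) : i <= Y -> a <= i + p' -> b <= i + p ->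
  p' <= p -> q <= r -> 2 * (a + b - 2 * Y) + q <= 4 * p + r.
Proof. move=> *; lra. Qed.

(* Existence by the direct method.  Along a minimizing sequence the derivatives
   converge uniformly (equicontinuity), so by [energy_mid] the second derivatives
   converge in L^2, fast and hence almost everywhere for a subsequence; Fatou
   then gives lower semicontinuity. *)
Lemma minimizer w0 : adm w0 -> F w0 < 8 * Num.sqrt (1 + eps) ->
  exists2 w, adm w & forall w', adm w' -> F w <= F w'.
Proof.
move=> a0 F0.
have [Q [m [C [Q1 m0 apr]]]] := a_priori_bounds alpha0 eps0 F0.
pose S := [set F w | w in adm].
have Sinf : has_inf S.
  split; first by exists (F w0), w0.
  by exists 0 => _ [w aw <-]; apply: integralI_ge0 => x xI; apply: lagr_ge0 => //;
    exact: profile_gt0.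
pose inf := inf S.
have infP w : adm w -> inf <= F w by move=> aw; apply: ge_inf; [case: Sinf|exists w].
have near_inf d : 0 < d -> exists w, [/\ adm w, F w <= F w0 & F w <= inf + d].
  move=> d0; have [_ [w aw <-] wd] := inf_adherent d0 Sinf.
  have /orP[h|h] := le_total (F w) (F w0).
    by exists w; split; [exact: aw|exact: h|exact: ltW].
  by exists w0; split; [exact: a0|exact: lexx|exact: ltW (le_lt_trans h wd)].
have [wn wnP] : {wn : nat -> R -> R & forall n,
    [/\ adm (wn n), F (wn n) <= F w0 & F (wn n) <= inf + n.+1%:R^-1]}.
  apply: (@choice _ _ (fun n w => [/\ adm w, F w <= F w0 & F w <= inf + n.+1%:R^-1])) => n.
  by apply: near_inf; rewrite invr_gt0.
have bdn w : adm w -> F w <= F w0 -> forall x, -1 <= x <= 1 -> `|prim w x| <= Q.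
  by move=> aw Fw x _; have [q _ _] := apr w aw Fw; apply: le_trans (norm_le_arcl _) (q x).
have [ps psP] : exists f, forall k N, 0 < k -> exists2 n, (N <= n)%N &
    forall x, -1 <= x <= 1 -> `|prim (wn n) x - f x| <= k.
  apply: (@equicontinuous_cluster R (fun n => prim (wn n)) Q) => [n x xI|k k0].
    by have [aw fw _] := wnP n; exact: bdn.
  have [d d0 dP] := prim_equicont C k0; exists d => // n x y _ _ xy.
  have [aw fw _] := wnP n; have [_ _ c] := apr _ aw fw; have [i s _ _ _] := aw.
  exact: dP i s c xy.
(* The rate [4^-n], in energy and in slope, makes the squared L^2 distance of consecutive terms of
   order [4^-n] and so their L^1 distance of order [2^-n], as [fast_cvg_ae] asks. *)
have [vn vnP] : {vn : nat -> R -> R & forall n,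
    [/\ adm (vn n), F (vn n) <= F w0, F (vn n) <= inf + 4^-1 ^+ n &
      forall x, -1 <= x <= 1 -> `|prim (vn n) x - ps x| <= 4^-1 ^+ n]}.
  apply: (@choice _ _ (fun n w => [/\ adm w, F w <= F w0, F w <= inf + 4^-1 ^+ n &
      forall x, -1 <= x <= 1 -> `|prim w x - ps x| <= 4^-1 ^+ n])) => n.
  have p0 : 0 < 4^-1 ^+ n :> R by rewrite exprn_gt0 // invr_gt0.
  have [j jn jP] := psP _ (Num.truncn (4^-1 ^+ n : R)^-1) p0.
  exists (wn j); have [a f e] := wnP j; split => //.
  apply: le_trans e _; rewrite lerD2l -[leRHS]invrK lef_pV2 ?posrE ?invr_gt0 //.
  apply: le_trans (ltW (truncnS_gt _)) _; rewrite ler_nat; exact: jn.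
have [K KP] := @energy_mid R alpha eps eps0 Q m C Q1 m0.
pose a := m * Q^-1 ^+ 5.
have aP : 0 < a by rewrite mulr_gt0 // exprn_gt0 // invr_gt0; lra.
have vc n : integralI (fun x => `|vn n.+1 x - vn n x|) <= (1 + 2^-1 * a^-1 * (4 + 2 * `|K|)) * 2^-1 ^+ n.
  have [a1 f1 e1 d1] := vnP n.+1; have [a2 f2 e2 d2] := vnP n.
  have [q1 u1 c1] := apr _ a1 f1; have [q2 u2 c2] := apr _ a2 f2.
  have [i1 s1 _ _ _] := a1; have [i2 s2 _ _ _] := a2.
  have p0 : 0 <= 4^-1 ^+ n :> R by rewrite exprn_ge0 // invr_ge0.
  have p1 : 4^-1 ^+ n.+1 <= 4^-1 ^+ n :> R.
    by rewrite exprS ler_piMl // invf_le1 // ler1n.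
  have dP x : -1 <= x <= 1 -> `|prim (vn n.+1) x - prim (vn n) x| <= 2 * 4^-1 ^+ n.
    move=> xI; have -> : prim (vn n.+1) x - prim (vn n) x =
        (prim (vn n.+1) x - ps x) - (prim (vn n) x - ps x) by ring.
    apply: le_trans (ler_normB _ _) _; rewrite mulr_natl mulr2n.
    by apply: lerD (d2 x xI); apply: le_trans (d1 x xI) p1.
  have := KP _ _ _ a1 a2 q1 q2 u1 u2 c1 c2 dP.
  have := infP _ (admissible_mid a1 a2).
  set d2f := fun x => (vn n.+1 x - vn n x) ^+ 2.
  have d2i : integrableI d2f by exact: integrableI_sqrB.
  have di := integrableIB i1 i2.
  set X := integralI d2f; set Y := F _ => h1 h2.
  have h3 : a * X <= (4 + 2 * `|K|) * 4^-1 ^+ n.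
    apply: le_trans h2 _; have h4 : K * (2 * 4^-1 ^+ n) <= `|K| * (2 * 4^-1 ^+ n).
      by rewrite ler_wpM2r ?ler_norm // mulr_ge0.
    rewrite (_ : (4 + 2 * `|K|) * _ = 4 * 4^-1 ^+ n + `|K| * (2 * 4^-1 ^+ n)); last by ring.
    exact: near_inf_gap h1 e1 e2 p1 h4.
  have t0 : 0 < 2^-1 ^+ n :> R by rewrite exprn_gt0 // invr_gt0.
  have t2 : 4^-1 ^+ n = (2^-1 ^+ n) ^+ 2 :> R.
    by rewrite -exprM mulnC exprM; congr (_ ^+ n); field.
  (* Young's inequality with weight [2^-n] passes from the L^2 to the L^1 distance. *)
  apply: le_trans (_ : integralI (fun x => 2^-1 * (2^-1 ^+ n + (2^-1 ^+ n)^-1 * d2f x)) <= _).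
    apply: integralI_le; [exact: integrableI_norm|by apply/integrableIZ/integrableID;
      [exact: integrableI_cst|exact: integrableIZ]|].
    move=> x _; rewrite -subr_ge0 /d2f; move: (vn n.+1 x - vn n x) => z.
    rewrite (_ : _ - _ = 2^-1 * ((2^-1 ^+ n)^-1 * (`|z| - 2^-1 ^+ n) ^+ 2)).
      by rewrite mulr_ge0 ?invr_ge0 // mulr_ge0 ?sqr_ge0 // invr_ge0 ltW.
    by rewrite -[z ^+ 2]real_normK ?num_real //; field; rewrite gt_eqF.
  rewrite integralIZ; last by apply: integrableID; [exact: integrableI_cst|exact: integrableIZ].
  rewrite integralID; [|exact: integrableI_cst|exact: integrableIZ].
  rewrite integralI_cst integralIZ // -/X.
  have h5 : X <= a^-1 * ((4 + 2 * `|K|) * 4^-1 ^+ n) by rewrite ler_pdivlMl.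
  have h6 : (2^-1 ^+ n)^-1 * X <= a^-1 * (4 + 2 * `|K|) * 2^-1 ^+ n.
    rewrite ler_pdivrMl //; apply: le_trans h5 _; rewrite t2 expr2.
    by rewrite le_eqVlt; apply/orP; left; apply/eqP; ring.
  rewrite mulrDl mul1r mulrDr mulrCA mulVf // mulr1 lerD2l.
  by rewrite -!mulrA ler_wpM2l ?invr_ge0 // !mulrA.
have vni n : integrableI (vn n) by have [[]] := vnP n.
have vns n : integrableI (fun x => vn n x ^+ 2) by have [[]] := vnP n.
have vne n : forall x, vn n (- x) = vn n x by have [[]] := vnP n.
have [N [h [v [mN N0 hi ve vP]]]] := fast_cvg_ae vni vne vc.
have mNC : measurable (~` N) by exact: measurableC.
pose wn' n x := vn n x * \1_(~` N) x.
have ind1 x : ~ N x -> \1_(~` N) x = 1 :> R by move=> nx; rewrite indicE in_setC memNset.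
have wi' n : integrableI (wn' n) by exact: integrableI_indic.
have wE n x : -1 <= x <= 1 -> ~ N x -> wn' n x = vn n x by move=> _ nx; rewrite /wn' ind1 ?mulr1.
have Pwn n x : prim (wn' n) x = prim (vn n) x := ae_eq_prim x mN N0 (wi' n) (vni n) (wE n).
have ind_le t x : `|(t <= x)%R%:R| <= 1 :> R by case: (t <= x); rewrite ?normr1 ?normr0.
have [vi _] : integrableI v /\ (fun n => integralI (wn' n)) @ \oo --> integralI v.
  apply: (integralI_dominated wi' hi) => [n x xI|x xI]; first exact: (vP x xI).1.
  exact: (vP x xI).2.
have Pcv x : (fun n => prim (vn n) x) @ \oo --> prim v x.
  have -> : (fun n => prim (vn n) x) = (fun n => integralI (fun t => wn' n t * (t <= x)%R%:R)).
    by apply/funext => n; rewrite -Pwn prim_integral.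
  rewrite prim_integral; apply: (proj2 (integralI_dominated _ hi _ _)) => [n|n t tI|t tI].
  - exact: integrableI_ind.
  - apply: le_trans (_ : `|wn' n t| <= _); last exact: (vP t tI).1.
    by rewrite normrM ler_piMr.
  - by apply: cvgMl; exact: (vP t tI).2.
have g0 : (fun n => 4^-1 ^+ n : R) @ \oo --> (0 : R).
  by apply: cvg_expr; rewrite ger0_norm ?invr_ge0 // invf_lt1 // ltr1n.
have Pps x : -1 <= x <= 1 -> prim v x = ps x.
  move=> xI; apply: (cvg_unique _ (Pcv x)) => //.
  apply/cvgrPdist_le => k k0; have /cvgrPdist_le /(_ k k0) := g0.
  apply: filterS => n; rewrite sub0r normrN ger0_norm ?exprn_ge0 ?invr_ge0 //; apply: le_trans.
  by have [_ _ _ h4] := vnP n; rewrite distrC h4.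
have dUn n x : `|U (vn n) x - U v x| <= 2 * 4^-1 ^+ n.
  have vPi := integrableI_prim vi; have nPi := integrableI_prim (vni n).
  have -> : U (vn n) x - U v x = prim (fun t => prim (vn n) t - prim v t) x.
    by rewrite primB // /profile [RHS]addrC opprD addrACA subrr add0r addrC.
  apply: le_trans (prim_bound _ (integrableIB nPi vPi)) _.
  rewrite mulrC -integralI_cst; apply: integralI_le; [by apply: integrableI_norm;
    exact: integrableIB|exact: integrableI_cst|].
  by move=> t tI; rewrite (Pps t tI); have [_ _ _ h4] := vnP n; exact: h4.
have Ucv x : (fun n => U (vn n) x) @ \oo --> U v x.
  apply/cvgrPdist_le => k k0; have k20 : 0 < k / 2 by rewrite divr_gt0.
  have /cvgrPdist_le /(_ _ k20) := g0.
  apply: filterS => n; rewrite sub0r normrN ger0_norm ?exprn_ge0 ?invr_ge0 // => kn.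
  rewrite distrC; apply: le_trans (dUn n x) _.
  by rewrite mulrC -ler_pdivlMr.
have mU x : m <= U v x.
  apply: (cvgr_to_ge (Ucv x)); apply: nearW => n.
  by have [a1 f1 _ _] := vnP n; have [_ u1 _] := apr _ a1 f1; case/andP: (u1 x).
have z0 : (fun _ : nat => 0 : R) @ \oo --> (0 : R) by exact: cvg_cst.
have sqE n x : wn' n x ^+ 2 = vn n x ^+ 2 * \1_(~` N) x.
  by rewrite /wn' exprMn indicE; case: (x \in ~` N); rewrite ?expr1n // expr0n.
have wns' n : integrableI (fun x => wn' n x ^+ 2).
  by under eq_fun do rewrite sqE; exact: integrableI_indic.
have [v2 _] : integrableI (fun x => v x ^+ 2) /\ integralI (fun x => v x ^+ 2) <= C.
  apply: (@fatou_integralI R (fun n x => wn' n x ^+ 2) _ C (fun=> 0)) => // [n x _|x xI|n].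
  - exact: sqr_ge0.
  - by apply: cvgM; exact: (vP x xI).2.
  - rewrite addr0 (ae_eq_integralI mN N0 (wns' n) (vns n)).
      by have [a1 f1 _ _] := vnP n; have [_ _] := apr _ a1 f1.
    by move=> x xI nx; rewrite (wE n x xI nx).
have av : adm v.
  split => //.
  - rewrite -prim1; apply: (cvg_unique _ (Pcv 1)) => //.
    have E : (fun n => prim (vn n) 1) = (fun=> 0).
      by apply/funext => n; rewrite prim1; have [[]] := vnP n.
    by rewrite /= E.
  - by move=> x _; apply: lt_le_trans m0 (mU x).
exists v; first exact: av.
move=> w' aw'; apply: le_trans (infP w' aw').
have cA n : continuous (fun x => lagrA (U (vn n) x) (prim (vn n) x)).
  by apply: continuous_lagrA; [exact: continuous_profile|exact: continuous_prim].
have un0 n x : U (vn n) x != 0 by have [a1 _ _ _] := vnP n; rewrite gt_eqF // profile_gt0.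
(* Slope and profile of [vn n] are kept and only the second derivative is changed on the null set:
   the energy is the same, and the integrand now converges at every point, ready for Fatou. *)
have Lni n : integrableI (fun x => lagr eps (U (vn n) x) (prim (vn n) x) (wn' n x)).
  apply: integrableID; first exact: integrableI_mulc.
  by apply: continuous_integrableI; apply: continuous_lagrB;
    [exact: un0|exact: continuous_profile|exact: continuous_prim].
have LE n : integralI (fun x => lagr eps (U (vn n) x) (prim (vn n) x) (wn' n x)) = F (vn n).
  apply: (ae_eq_integralI mN N0) => //; last by move=> x xI nx; rewrite wE.
  by apply: integrableI_lagr; have [] := vnP n.
apply: (proj2 (@fatou_integralI R (fun n x => lagr eps (U (vn n) x) (prim (vn n) x) (wn' n x))
  (fun x => lagr eps (U v x) (prim v x) (v x)) inf (fun n => 4^-1 ^+ n) Lni _ _ _ g0)).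
- move=> n x xI; apply: lagr_ge0 => //; have [a1 _ _ _] := vnP n; exact: profile_gt0.
- move=> x xI.
  have acv : (fun n => arcl (prim (vn n) x)) @ \oo --> arcl (prim v x).
    exact: continuous_cvg (@continuous_arcl R (prim v x)) (Pcv x).
  have an0 : arcl (prim v x) != 0 by exact: arcl_neq0.
  have uv0 : U v x != 0 by rewrite gt_eqF // profile_gt0.
  rewrite /lagr /lagrA /lagrB; apply: cvgD.
    apply: cvgM; first by apply: cvgM; exact: (vP x xI).2.
    apply: cvgM; first exact: Ucv.
    apply: (@continuous_cvg _ _ _ _ _ _ (fun y : R => y ^+ 5) (arcl (prim v x))^-1).
      exact: exprn_continuous.
    exact: cvgV.
  apply: cvgD; first by apply: cvgM; apply: cvgV.
  by apply: cvgM; [exact: cvg_cst|exact: cvgM].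
- by move=> n; rewrite LE; have [_ _ e _] := vnP n.
Qed.

End Minimizer.

(** * Calculus of first-order expansions *)

Section FirstVariation.
Variable R : realType.
Implicit Types (h w : R -> R) (x y t s k M u p : R).

Lemma contD (f g : R -> R) : continuous f -> continuous g -> continuous (fun x => f x + g x).
Proof. by move=> fc gc x; apply: cvgD; [exact: fc|exact: gc]. Qed.

Lemma contM (f g : R -> R) : continuous f -> continuous g -> continuous (fun x => f x * g x).
Proof. by move=> fc gc x; apply: cvgM; [exact: fc|exact: gc]. Qed.

Lemma contN (f : R -> R) : continuous f -> continuous (fun x => - f x).
Proof. by move=> fc x; apply: cvgN; exact: fc. Qed.

Lemma contC k : continuous ((fun=> k) : R -> R).
Proof. by move=> x; exact: cvg_cst. Qed.

Lemma contV (f : R -> R) : (forall x, f x != 0) -> continuous f -> continuous (fun x => (f x)^-1).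
Proof. by move=> f0 fc x; apply: cvgV; [exact: f0|exact: fc]. Qed.

Lemma contX (f : R -> R) n : continuous f -> continuous (fun x => f x ^+ n).
Proof.
move=> fc x; apply: (@continuous_cvg _ _ _ _ _ _ (fun y : R => y ^+ n) (f x)); last exact: fc.
exact: exprn_continuous.
Qed.

Section Expansion.
Variable t0 : R.
Hypothesis t01 : 0 < t0 <= 1.

(** A first-order Taylor expansion in [t] at [0], uniform in [x], with quadratic remainder.
    Uniformity lets it be integrated directly, in place of differentiation under the integral
    sign. *)
Definition expands (f : R -> R -> R) (f0 f1 : R -> R) :=
  exists2 C, 0 <= C & forall x t, -1 <= x <= 1 -> `|t| <= t0 ->
    [/\ `|f0 x| <= C, `|f1 x| <= C & `|f t x - f0 x - t * f1 x| <= C * t ^+ 2].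

Lemma expands_ext (f f' : R -> R -> R) (f0 f0' f1 f1' : R -> R) : (forall t x, f t x = f' t x) ->
  f0 =1 f0' -> f1 =1 f1' -> expands f f0 f1 -> expands f' f0' f1'.
Proof.
move=> e e0 e1 [C C0 CP]; exists C => // x t xI tt; rewrite -e -e0 -e1; exact: CP.
Qed.

(** The bounds used by the product and inverse rules; [t0 <= 1] enters through [t^2 <= |t|]. *)
Lemma expands_bounded (f : R -> R -> R) (f0 f1 : R -> R) : expands f f0 f1 -> exists2 C, 0 <= C &
  forall x t, -1 <= x <= 1 -> `|t| <= t0 ->
    [/\ `|f0 x| <= C, `|f1 x| <= C, `|f t x| <= C,
    `|f t x - f0 x| <= C * `|t| & `|f t x - f0 x - t * f1 x| <= C * t ^+ 2].
Proof.
case/andP: t01 => t00 t11 [C C0 CP]; exists (3 * C) => [|x t xI tt]; first by rewrite mulr_ge0.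
have [b0 b1 b2] := CP x t xI tt.
have t1 : `|t| <= 1 by apply: le_trans tt t11.
have tn : 0 <= `|t| by [].
have t2 : t ^+ 2 <= `|t| by rewrite -real_normK ?num_real // expr2 ler_piMr.
have C3 : C <= 3 * C by lra.
have e1 : `|f t x - f0 x| <= 2 * C * `|t|.
  have -> : f t x - f0 x = (f t x - f0 x - t * f1 x) + t * f1 x by ring.
  apply: le_trans (ler_normD _ _) _; rewrite normrM.
  have h1 := ler_wpM2l tn b1; have h2 := ler_wpM2l C0 t2; lra.
split; [exact: le_trans b0 C3|exact: le_trans b1 C3| | |].
- have -> : f t x = (f t x - f0 x) + f0 x by ring.
  apply: le_trans (ler_normD _ _) _; have := ler_wpM2l (mulr_ge0 (ler0n R 2) C0) t1; lra.
- by apply: le_trans e1 _; rewrite ler_wpM2r //; lra.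
- by apply: le_trans b2 _; rewrite ler_wpM2r ?sqr_ge0.
Qed.

Lemma expands_lin (f0 f1 : R -> R) : continuous f0 -> continuous f1 ->
  expands (fun t x => f0 x + t * f1 x) f0 f1.
Proof.
move=> c0 c1; have [C C0 CP] := continuous_bounded_itv c0;
  have [D D0 DP] := continuous_bounded_itv c1.
exists (C + D) => [|x t xI _]; first exact: addr_ge0.
split.
- by apply: le_trans (CP x xI) _; rewrite lerDl.
- by apply: le_trans (DP x xI) _; rewrite lerDr.
- have -> : f0 x + t * f1 x - f0 x - t * f1 x = 0 by ring.
  by rewrite normr0 mulr_ge0 ?sqr_ge0 ?addr_ge0.
Qed.

Lemma expands_D (f g : R -> R -> R) (f0 f1 g0 g1 : R -> R) : expands f f0 f1 -> expands g g0 g1 ->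
  expands (fun t x => f t x + g t x) (fun x => f0 x + g0 x) (fun x => f1 x + g1 x).
Proof.
move=> [C C0 CP] [D D0 DP]; exists (C + D) => [|x t xI tt]; first exact: addr_ge0.
have [a0 a1 a2] := CP x t xI tt; have [b0 b1 b2] := DP x t xI tt; split.
- by apply: le_trans (ler_normD _ _) (lerD a0 b0).
- by apply: le_trans (ler_normD _ _) (lerD a1 b1).
- rewrite mulrDl (_ : _ - _ - _ = (f t x - f0 x - t * f1 x) + (g t x - g0 x - t * g1 x)).
    by apply: le_trans (ler_normD _ _) (lerD a2 b2).
  by ring.
Qed.

Lemma expands_Z k (f : R -> R -> R) (f0 f1 : R -> R) : expands f f0 f1 ->
  expands (fun t x => k * f t x) (fun x => k * f0 x) (fun x => k * f1 x).
Proof.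
move=> [C C0 CP]; exists (`|k| * C) => [|x t xI tt]; first by rewrite mulr_ge0.
have [a0 a1 a2] := CP x t xI tt; split.
- by rewrite normrM ler_wpM2l.
- by rewrite normrM ler_wpM2l.
- rewrite (_ : _ - _ - _ = k * (f t x - f0 x - t * f1 x)); last by ring.
  by rewrite normrM -mulrA ler_wpM2l.
Qed.

Lemma expands_M (f g : R -> R -> R) (f0 f1 g0 g1 : R -> R) : expands f f0 f1 -> expands g g0 g1 ->
  expands (fun t x => f t x * g t x) (fun x => f0 x * g0 x)
    (fun x => f0 x * g1 x + f1 x * g0 x).
Proof.
move=> /expands_bounded[C C0 CP] /expands_bounded[D D0 DP].
exists (3 * (C * D)) => [|x t xI tt]; first by rewrite !mulr_ge0.
have [a0 a1 a3 a4 a2] := CP x t xI tt; have [b0 b1 b3 b4 b2] := DP x t xI tt.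
have CD : 0 <= C * D by rewrite mulr_ge0.
have mm (X Y : R) : `|X| <= C -> `|Y| <= D -> `|X * Y| <= C * D.
  by move=> h1 h2; rewrite normrM ler_pM.
split.
- by apply: le_trans (mm _ _ a0 b0) _; lra.
- apply: le_trans (ler_normD _ _) _.
  by have := lerD (mm _ _ a0 b1) (mm _ _ a1 b0); lra.
- rewrite (_ : _ - _ - _ = (f t x - f0 x - t * f1 x) * g0 x + f0 x * (g t x - g0 x - t * g1 x)
     + (f t x - f0 x) * (g t x - g0 x)); last by ring.
  apply: le_trans (ler_normD _ _) _; apply: le_trans (lerD (ler_normD _ _) (lexx _)) _.
  rewrite !normrM.
  have h1 : `|f t x - f0 x - t * f1 x| * `|g0 x| <= C * t ^+ 2 * D by rewrite ler_pM.
  have h2 : `|f0 x| * `|g t x - g0 x - t * g1 x| <= C * (D * t ^+ 2) by rewrite ler_pM.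
  have h3 : `|f t x - f0 x| * `|g t x - g0 x| <= (C * `|t|) * (D * `|t|) by rewrite ler_pM.
  apply: le_trans (lerD (lerD h1 h2) h3) _.
  rewrite (_ : C * `|t| * (D * `|t|) = C * D * `|t| ^+ 2); last by ring.
  by rewrite real_normK ?num_real // le_eqVlt; apply/orP; left; apply/eqP; ring.
Qed.

Lemma expands_V (f : R -> R -> R) (f0 f1 : R -> R) (d : R) : 0 < d ->
  (forall x t, -1 <= x <= 1 -> `|t| <= t0 -> d <= f t x) -> expands f f0 f1 ->
  expands (fun t x => (f t x)^-1) (fun x => (f0 x)^-1) (fun x => - f1 x / f0 x ^+ 2).
Proof.
case/andP: t01 => t00 t11.
move=> d0 fd /expands_bounded[C C0 CP].
(* At [t = 0] the remainder vanishes, so [f0] is [f 0] and inherits its lower bound. *)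
have f0d x : -1 <= x <= 1 -> d <= f0 x.
  move=> xI; have [_ _ _ _] := CP x 0 xI (ltac:(by rewrite normr0 ltW)).
  rewrite mul0r subr0 expr0n /= mulr0 normr_le0 subr_eq0 => /eqP <-.
  by apply: fd; rewrite // normr0 ltW.
have iv X : d <= X -> `|X^-1| <= d^-1.
  move=> h; have X0 : 0 < X by apply: lt_le_trans h.
  by rewrite gtr0_norm ?invr_gt0 // lef_pV2 ?posrE.
pose K := d^-1 + C * d^-1 ^+ 2 + (C * C + C * C) * d^-1 ^+ 3.
have i0 : 0 <= d^-1 by rewrite invr_ge0 ltW.
have K1 : 0 <= C * d^-1 ^+ 2 by rewrite mulr_ge0 ?sqr_ge0.
have K2 : 0 <= (C * C + C * C) * d^-1 ^+ 3 by rewrite mulr_ge0 ?addr_ge0 ?mulr_ge0 ?exprn_ge0.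
exists (K + C * d^-1 ^+ 2) => [|x t xI tt]; first by rewrite /K !addr_ge0.
have [a0 a1 a3 a4 a2] := CP x t xI tt.
have fn : f t x != 0 by rewrite gt_eqF // (lt_le_trans d0) // fd.
have f0n : f0 x != 0 by rewrite gt_eqF // (lt_le_trans d0) // f0d.
have v0 := iv _ (f0d x xI); have v1 := iv _ (fd x t xI tt).
have v02 : `|(f0 x)^-1 ^+ 2| <= d^-1 ^+ 2 by rewrite normrX lerXn2r ?nnegrE.
split.
- by apply: le_trans v0 _; rewrite /K; lra.
- rewrite -exprVn normrM normrN; apply: le_trans (ler_pM _ _ a1 v02) _ => //.
  by rewrite /K; lra.
rewrite (_ : _ - _ - _ = - (f t x - f0 x - t * f1 x) * (f0 x)^-1 ^+ 2
   + (f t x - f0 x) ^+ 2 * ((f0 x)^-1 ^+ 2 * (f t x)^-1)); last by field; rewrite fn f0n.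
apply: le_trans (ler_normD _ _) _.
have h1 : `|- (f t x - f0 x - t * f1 x) * (f0 x)^-1 ^+ 2| <= C * t ^+ 2 * d^-1 ^+ 2.
  by rewrite normrM normrN ler_pM.
have h2 : `|(f t x - f0 x) ^+ 2 * ((f0 x)^-1 ^+ 2 * (f t x)^-1)| <=
    (C * `|t|) ^+ 2 * (d^-1 ^+ 2 * d^-1).
  rewrite normrM [`|_ * (f t x)^-1|]normrM; apply: ler_pM => //.
    by rewrite normrX lerXn2r ?nnegrE ?mulr_ge0.
  exact: ler_pM.
apply: le_trans (lerD h1 h2) _.
rewrite exprMn real_normK ?num_real //.
have e1 : C * t ^+ 2 * d^-1 ^+ 2 = (C * d^-1 ^+ 2) * t ^+ 2 by ring.
have e2 : C ^+ 2 * t ^+ 2 * (d^-1 ^+ 2 * d^-1) = C * C * d^-1 ^+ 3 * t ^+ 2 by ring.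
rewrite e1 e2 -mulrDl ler_wpM2r ?sqr_ge0 // /K.
have K3 : 0 <= C * C * d^-1 ^+ 3 by rewrite !mulr_ge0 ?exprn_ge0.
by rewrite mulrDl; lra.
Qed.

(** With [D = arcl (s + h) - arcl s], the remainder is exactly [(h^2 - D^2) / (2 arcl s)], and
    [D^2 <= h^2] because [arcl] is 1-Lipschitz. *)
Lemma arcl_taylor (s h : R) : `|arcl (s + h) - arcl s - s / arcl s * h| <= h ^+ 2.
Proof.
have q0 := arcl_gt0 s; have q1 := arcl_ge1 s.
have e1 := arcl_sqr s; have e2 := arcl_sqr (s + h); have l := arcl_lip (s + h) s.
have l2 : (arcl (s + h) - arcl s) ^+ 2 <= h ^+ 2.
  rewrite -real_normK ?num_real // -[h ^+ 2]real_normK ?num_real //.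
  by rewrite lerXn2r ?nnegrE //; rewrite addrAC subrr add0r in l.
have -> : arcl (s + h) - arcl s - s / arcl s * h =
   (arcl s)^-1 * (2^-1 * (h ^+ 2 - (arcl (s + h) - arcl s) ^+ 2)).
  have -> : (arcl (s + h) - arcl s) ^+ 2 =
     2 * arcl s ^+ 2 + 2 * s * h + h ^+ 2 - 2 * arcl s * arcl (s + h).
    rewrite sqrrB e2 e1 -mulr_natl; ring.
  by field; rewrite gt_eqF.
rewrite normrM gtr0_norm ?invr_gt0 // ler_pdivrMl //.
have sq := sqr_ge0 (arcl (s + h) - arcl s); have h2 := sqr_ge0 h.
apply: (@le_trans _ _ (h ^+ 2)); last by rewrite ler_peMl.
rewrite ger0_norm; last by rewrite mulr_ge0 ?invr_ge0 // subr_ge0.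
by move: l2 sq h2; move: ((arcl (s + h) - arcl s) ^+ 2) (h ^+ 2) => X Y; lra.
Qed.

Lemma expands_arcl (p0 p1 : R -> R) : continuous p0 -> continuous p1 ->
  expands (fun t x => arcl (p0 x + t * p1 x)) (fun x => arcl (p0 x))
    (fun x => p0 x / arcl (p0 x) * p1 x).
Proof.
move=> c0 c1; have [C C0 CP] := continuous_bounded_itv (continuous_arcl_comp c0);
  have [D D0 DP] := continuous_bounded_itv c1.
exists (C + D + D ^+ 2) => [|x t xI _]; first by rewrite !addr_ge0 ?sqr_ge0.
have q0 := arcl_gt0 (p0 x); have D2 := sqr_ge0 D; split.
- by apply: le_trans (CP x xI) _; rewrite -addrA lerDl addr_ge0.
- rewrite normrM; apply: (@le_trans _ _ (1 * D)).
    apply: ler_pM => //; last exact: DP.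
    by rewrite normrM normfV (gtr0_norm q0) ler_pdivrMr // mul1r norm_le_arcl.
  by rewrite mul1r addrAC lerDr addr_ge0.
- have := arcl_taylor (p0 x) (t * p1 x).
  rewrite (_ : p0 x / arcl (p0 x) * (t * p1 x) = t * (p0 x / arcl (p0 x) * p1 x)); last by ring.
  move=> /le_trans; apply; rewrite exprMn mulrC ler_wpM2r ?sqr_ge0 //.
  rewrite -[p1 x ^+ 2]real_normK ?num_real //; apply: (@le_trans _ _ (D ^+ 2)).
    by rewrite lerXn2r ?nnegrE ?DP.
  by rewrite lerDr addr_ge0.
Qed.

End Expansion.

End FirstVariation.

(** * First variation and the Euler-Lagrange equation *)

Section EulerLagrange.
Variable R : realType.
Implicit Types (f g h w : R -> R) (x y t s k M : R).
Local Notation mu := (@lebesgue_measure R).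
Local Notation I := (`[(-1)%R, 1%R]%classic : set R).

Lemma continuous_itv_lower (u : R -> R) : continuous u -> (forall x, -1 <= x <= 1 -> 0 < u x) ->
  exists2 m, 0 < m & forall x, -1 <= x <= 1 -> m <= u x.
Proof.
move=> uc u0; have [c cI cP] := @EVT_min R u (-1) 1 (ltac:(lra)) (continuous_subspaceT uc).
exists (u c); first by apply: u0; move: cI; rewrite in_itv.
by move=> x xI; apply: cP; rewrite in_itv.
Qed.

Lemma integrableI_sqr_eq0 f : integrableI (fun x => f x ^+ 2) -> integralI (fun x =>
  f x ^+ 2) = 0 ->
  exists N : set R, [/\ measurable N, mu N = 0%E & forall x, -1 <= x <= 1 -> ~ N x -> f x = 0].
Proof.
move=> fi f0.
have := @ae_eq_integral_abs _ _ R mu I (measurable_itv _) (fun x => (f x ^+ 2)%:E).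
move=> /(_ (ltac:(by apply/measurable_EFinP; exact: integrableI_measurable))) [h _].
have [|N [mN N0 NP]] := h.
  transitivity (\int[mu]_(x in I) (f x ^+ 2)%:E)%E; last by rewrite integralI_E ?f0.
  by apply: eq_integral => x _; rewrite gee0_abs // lee_fin sqr_ge0.
exists N; split => // x xI xN; apply: contrapT => fx; apply: xN; apply: NP => /= /(_ xI) [].
by move=> /eqP; rewrite sqrf_eq0 => /eqP.
Qed.

(** The remainder of the energy density when [a = w] is moved in the direction [b = psi]: [X1] is
    the Taylor remainder of [lagrA], [X2] its increment, [X3] its perturbed value and [X4] the
    Taylor remainder of [lagrB]. *)
Lemma variation_bound (a b t CA CB X1 X2 X3 X4 : R) : 0 <= CA -> 0 <= CB ->
  `|X1| <= CA * t ^+ 2 -> `|X2| <= CA * `|t| -> `|X3| <= CA -> `|X4| <= CB * t ^+ 2 ->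
  `|a ^+ 2 * X1 + 2 * t * (a * b) * X2 + t ^+ 2 * (b ^+ 2 * X3) + X4| <=
    3 * (CA + CB) * t ^+ 2 * (a ^+ 2 + b ^+ 2 + 1).
Proof.
move=> CA0 CB0 h1 h2 h3 h4.
have t2 : 0 <= t ^+ 2 := sqr_ge0 t.
have a2 : 0 <= a ^+ 2 := sqr_ge0 a. have b2 : 0 <= b ^+ 2 := sqr_ge0 b.
have e1 : `|a ^+ 2 * X1| <= a ^+ 2 * (CA * t ^+ 2) by rewrite normrM ger0_norm // ler_wpM2l.
have e2 : `|2 * t * (a * b) * X2| <= CA * t ^+ 2 * (a ^+ 2 + b ^+ 2).
  have ab : `|2 * (a * b)| <= a ^+ 2 + b ^+ 2.
    rewrite ler_norml; apply/andP; split.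
      by have := sqr_ge0 (a + b); rewrite sqrrD -mulr_natl; lra.
    by have := sqr_ge0 (a - b); rewrite sqrrB -mulr_natl; lra.
  rewrite (_ : 2 * t * (a * b) * X2 = (t * X2) * (2 * (a * b))); last by ring.
  rewrite normrM ler_pM //.
  rewrite normrM; apply: le_trans (ler_wpM2l (normr_ge0 t) h2) _.
  by rewrite mulrCA -expr2 real_normK ?num_real.
have e3 : `|t ^+ 2 * (b ^+ 2 * X3)| <= t ^+ 2 * (b ^+ 2 * CA).
  by rewrite normrM (ger0_norm t2) ler_wpM2l // normrM (ger0_norm b2) ler_wpM2l.
have p1 : 0 <= CA * t ^+ 2 by rewrite mulr_ge0.
have p2 : 0 <= CB * t ^+ 2 by rewrite mulr_ge0.
have q1 := mulr_ge0 p1 a2; have q2 := mulr_ge0 p1 b2.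
have q3 := mulr_ge0 p2 a2; have q4 := mulr_ge0 p2 b2.
apply: le_trans (ler_normD _ _) _; apply: le_trans (lerD (ler_normD _ _) h4) _.
apply: le_trans (lerD (lerD (ler_normD _ _) (lexx _)) (lexx _)) _.
apply: le_trans (lerD (lerD (lerD e1 e2) e3) (lexx _)) _.
rewrite -subr_ge0 (_ : _ - _ = CA * t ^+ 2 * a ^+ 2 + CA * t ^+ 2 * b ^+ 2 + 3 * (CA * t ^+ 2) +
  3 * (CB * t ^+ 2 * a ^+ 2) + 3 * (CB * t ^+ 2 * b ^+ 2) + 2 * (CB * t ^+ 2)); last by ring.
by rewrite !addr_ge0 // mulr_ge0.
Qed.

(** Testing with [t = s] and [t = - s] for a small [s > 0] gives [|d| <= |K| * s], and [s] is chosen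
    to make this at most [k]. *)
Lemma critical_eq0 (d t0 K : R) : 0 < t0 ->
  (forall t, `|t| <= t0 -> 0 <= t * d + K * t ^+ 2) -> d = 0.
Proof.
move=> t00 h; apply/eqP; rewrite -normr_le0; apply/ler_addgt0Pl => k k0; rewrite addr0.
pose s := Num.min t0 (k / (`|K| + 1)).
have K1 : 0 < `|K| + 1 by rewrite ltr_wpDl.
have s0 : 0 < s by rewrite lt_min t00 divr_gt0.
have sK : s * `|K| <= k.
  have : s <= k / (`|K| + 1) by rewrite ge_min lexx orbT.
  rewrite ler_pdivlMr // => /(le_trans _); apply.
  by rewrite ler_wpM2l ?(ltW s0) // lerDl.
have key (t : R) : `|t| = s -> - t * d <= s * k.
  move=> ts; have := h t; rewrite ts ge_min lexx => /(_ isT).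
  have e : K * t ^+ 2 <= s * k.
    rewrite -[t ^+ 2]real_normK ?num_real // ts expr2 mulrCA ler_wpM2l ?(ltW s0) //.
    by apply: le_trans sK; rewrite mulrC ler_wpM2l ?ler_norm // ltW.
  by move: e; move: (K * _) (s * k) => X Y; rewrite mulNr; move: (t * d) => Z; lra.
rewrite ler_norml; apply/andP; split.
  by have := key s (gtr0_norm s0); rewrite mulNr -mulrN ler_pM2l // lerNl.
by have := key (- s) (ltac:(by rewrite normrN gtr0_norm)); rewrite opprK ler_pM2l.
Qed.

Variables alpha eps : R.
Local Notation U := (profile alpha).
Local Notation F := (energy alpha eps).
Local Notation adm := (admissible alpha).

(* The partial derivatives of [lagr] with respect to [u] and [p]. *)
Definition lagr_u (u p k : R) := k ^+ 2 * (arcl p)^-1 ^+ 5 - u^-1 ^+ 2 * (arcl p)^-1 +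
  4 * eps * arcl p.
Definition lagr_p (u p k : R) := - (5 * u * p * (arcl p)^-1 ^+ 7) * k ^+ 2 -
  u^-1 * p * (arcl p)^-1 ^+ 3 + 4 * eps * (u * p * (arcl p)^-1).

Section Pointwise.
Variables (u p z e : R -> R) (t0 d : R).
Hypotheses (uc : continuous u) (pc : continuous p) (zc : continuous z) (ec : continuous e).
Hypotheses (t01 : 0 < t0 <= 1) (d0 : 0 < d).
Hypothesis ud : forall x t, -1 <= x <= 1 -> `|t| <= t0 -> d <= u x + t * z x.

Let u0 x : -1 <= x <= 1 -> u x != 0.
Proof.
move=> xI; have := @ud x 0 xI; rewrite mul0r addr0 normr0 => h.
by rewrite gt_eqF // (lt_le_trans d0) // h //; case/andP: t01 => /ltW.
Qed.

Lemma expands_eq (f : R -> R -> R) (f0 f1 g0 g1 : R -> R) :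
  (forall x, -1 <= x <= 1 -> f0 x = g0 x) -> (forall x, -1 <= x <= 1 -> f1 x = g1 x) ->
  expands t0 f f0 f1 -> expands t0 f g0 g1.
Proof.
move=> e0 e1 [C C0 CP]; exists C => // x t xI tt.
by rewrite -e0 // -e1 //; exact: CP.
Qed.

Lemma expands_inv_arcl : expands t0 (fun t x => (arcl (p x + t * e x))^-1)
  (fun x => (arcl (p x))^-1) (fun x => - (p x * (arcl (p x))^-1 ^+ 3) * e x).
Proof.
apply: expands_eq (expands_V t01 ltr01 _ (expands_arcl t0 pc ec)) => //.
- by move=> x _; field; rewrite arcl_neq0.
- by move=> x t _ _; exact: arcl_ge1.
Qed.

Lemma expands_u : expands t0 (fun t x => u x + t * z x) u z.
Proof. exact: expands_lin. Qed.

Lemma expands_lagrA : expands t0 (fun t x => lagrA (u x + t * z x) (p x + t * e x))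
  (fun x => lagrA (u x) (p x))
  (fun x => (arcl (p x))^-1 ^+ 5 * z x - 5 * u x * p x * (arcl (p x))^-1 ^+ 7 * e x).
Proof.
have r1 := expands_inv_arcl; have r2 := expands_M t01 r1 r1.
have r4 := expands_M t01 r2 r2; have r5 := expands_M t01 r1 r4.
have := expands_M t01 expands_u r5; apply: expands_ext => [t x|x|x]; rewrite /lagrA; ring.
Qed.

Lemma expands_lagrB : expands t0 (fun t x => lagrB eps (u x + t * z x) (p x + t * e x))
  (fun x => lagrB eps (u x) (p x))
  (fun x => (- (u x)^-1 ^+ 2 * (arcl (p x))^-1 + 4 * eps * arcl (p x)) * z x +
    (- ((u x)^-1 * p x * (arcl (p x))^-1 ^+ 3) + 4 * eps * (u x * p x * (arcl (p x))^-1)) * e x).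
Proof.
have ui := expands_V t01 d0 ud expands_u.
have b1 := expands_M t01 ui expands_inv_arcl.
have b2 := expands_Z (4 * eps) (expands_M t01 expands_u (expands_arcl t0 pc ec)).
apply: expands_eq (expands_D b1 b2) => x xI; rewrite /lagrB //.
by field; rewrite u0 // arcl_neq0.
Qed.

End Pointwise.

Section Variation.
Variable w : R -> R.
Hypothesis aw : adm w.
Let wi : integrableI w. Proof. by case: aw. Qed.
Let w2 : integrableI (fun x => w x ^+ 2). Proof. by case: aw. Qed.
Let uc : continuous (U w) := @continuous_profile R alpha w wi.
Let pc : continuous (prim w) := continuous_prim wi.
Let u0 x : U w x != 0. Proof. by rewrite gt_eqF // profile_gt0. Qed.
Let qc : continuous (fun x => arcl (prim w x)) := continuous_arcl_comp pc.
Let rc : continuous (fun x => (arcl (prim w x))^-1).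
Proof. by apply: contV => // x; exact: arcl_neq0. Qed.
Let ic : continuous (fun x => (U w x)^-1). Proof. exact: contV. Qed.

Definition lagr_u_along x := lagr_u (U w x) (prim w x) (w x).
Definition lagr_p_along x := lagr_p (U w x) (prim w x) (w x).

Lemma integrableI_lagr_u : integrableI lagr_u_along.
Proof.
apply: integrableID; last by apply: continuous_integrableI; apply: contM => //; exact: contC.
apply: integrableIB; first by apply: integrableI_mulc => //; exact: contX.
by apply: continuous_integrableI; apply: contM => //; exact: contX.
Qed.

Lemma integrableI_lagr_p : integrableI lagr_p_along.
Proof.
apply: integrableID; last first.
  by apply: continuous_integrableI; apply: contM; [exact: contC|apply: contM => //; exact: contM].
apply: integrableIB.
  apply: (@eq_integrableI _ (fun x =>
    w x ^+ 2 * - (5 * U w x * prim w x * (arcl (prim w x))^-1 ^+ 7))).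
    by move=> x _; rewrite mulrC.
  apply: integrableI_mulc => //; apply: contN; apply: contM; last exact: contX.
  by apply: contM => //; apply: contM => //; exact: contC.
by apply: continuous_integrableI; apply: contM; [exact: contM|exact: contX].
Qed.

(** [psi] is only square integrable, but [u] and [u'] move by its continuous primitives, so [lagrA]
    and [lagrB] have uniform expansions. The dependence on [w] itself is exactly quadratic, hence
    the remainder is at most a constant times [t^2 * (w^2 + psi^2 + 1)], which is integrable. *)
Lemma first_variation psi : integrableI psi -> integrableI (fun x => psi x ^+ 2) ->
  exists t0 K, [/\ 0 < t0, forall t, `|t| <= t0 -> forall x, -1 <= x <= 1 ->
      0 < U (fun x => w x + t * psi x) x &
   forall t, `|t| <= t0 -> `|F (fun x => w x + t * psi x) - F w -
     t * integralI (fun x => 2 * w x * psi x * lagrA (U w x) (prim w x) +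
       (lagr_p_along x * prim psi x + lagr_u_along x * prim (prim psi) x))|
      <= K * t ^+ 2].
Proof.
move=> si s2.
have ec := continuous_prim si; have zc := continuous_prim (integrableI_prim si).
set z := prim (prim psi) in zc *; set e := prim psi in ec z zc *.
have Pt t x : prim (fun x => w x + t * psi x) x = prim w x + t * e x.
  by rewrite primD ?primZ //; exact: integrableIZ.
have Ut t x : U (fun x => w x + t * psi x) x = U w x + t * z x.
  rewrite /profile (eq_prim (g := fun x => prim w x + t * e x)) //.
  rewrite primD ?primZ -?addrA //; try exact: integrableI_prim.
  by apply: integrableIZ; exact: integrableI_prim.
have [m m0 mu_] := continuous_itv_lower uc (fun x _ => profile_gt0 x aw).
have [Z Z0 ZP] := continuous_bounded_itv zc.
(* Keeps [|t * z| <= m / 2], so that the perturbed profile stays above [m / 2]; [Z + 1] is positive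
   even when [Z = 0]. *)
pose t0 := Num.min 1 (m / (2 * (Z + 1))).
have Z1 : 0 < 2 * (Z + 1) by rewrite mulr_gt0 // ltr_wpDl.
have t01 : 0 < t0 <= 1 by rewrite lt_min ltr01 divr_gt0 //= ge_min lexx.
have m20 : 0 < m / 2 by rewrite divr_gt0.
have ud x t : -1 <= x <= 1 -> `|t| <= t0 -> m / 2 <= U w x + t * z x.
  move=> xI; rewrite le_min => /andP[_]; rewrite ler_pdivlMr // => tm.
  have h1 : `|t * z x| <= m / 2.
    rewrite normrM ler_pdivlMr //; apply: le_trans tm.
    rewrite -mulrA ler_wpM2l // mulrC ler_wpM2l //.
    by apply: le_trans (ZP x xI) _; rewrite lerDl.
  have := mu_ x xI; have := ler_norm (- (t * z x)); rewrite normrN.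
  by move: h1; move: (t * z x) (U w x) => X Y; lra.
have [CA CA0 CAP] := expands_bounded t01 (expands_lagrA uc pc zc ec t01).
have [CB CB0 CBP] := expands_lagrB uc pc zc ec t01 m20 ud.
pose C := CA + CB.
exists t0, (3 * C * integralI (fun x => w x ^+ 2 + psi x ^+ 2 + 1)); split.
- by case/andP: t01.
- by move=> t tt x xI; rewrite Ut; apply: lt_le_trans m20 (ud x t xI tt).
move=> t tt.
pose Lt x := lagr eps (U w x + t * z x) (prim w x + t * e x) (w x + t * psi x).
have FtE : F (fun x => w x + t * psi x) = integralI Lt by apply: eq_integralI => x _; rewrite Ut Pt.
have stc : integrableI (fun x => (w x + t * psi x) ^+ 2).
  by apply: integrableI_sqrD => //; [exact: integrableIZ|exact: integrableI_sqrZ].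
have utc : continuous (fun x => U w x + t * z x) by apply: contD => //; apply: contM => //;
  exact: contC.
have ptc : continuous (fun x => prim w x + t * e x) by apply: contD => //; apply: contM => //;
  exact: contC.
have un x : U w x + t * z x != 0.
  rewrite -Ut profile_clamp Ut gt_eqF //; apply: lt_le_trans m20 (ud _ _ _ tt).
  exact: clampI.
have Ltbd : integrableI Lt.
  apply: integrableID; first by apply: integrableI_mulc => //; exact: continuous_lagrA.
  by apply: continuous_integrableI; exact: continuous_lagrB.
pose D x := 2 * w x * psi x * lagrA (U w x) (prim w x) + (lagr_p_along x * e x + lagr_u_along x * z x).
have wsi : integrableI (fun x => w x * psi x).
  apply: (@eq_integrableI _ (fun x => 2^-1 * ((w x + psi x) ^+ 2 - w x ^+ 2 - psi x ^+ 2))).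
    by move=> x _; field.
  by apply: integrableIZ; apply: integrableIB => //; apply: integrableIB => //;
    exact: integrableI_sqrD.
have Di : integrableI D.
  apply: integrableID.
    apply: (@eq_integrableI _ (fun x => w x * psi x * (2 * lagrA (U w x) (prim w x)))).
      by move=> x _; ring.
    by apply: integrableI_mulc => //; apply: contM; [exact: contC|exact: continuous_lagrA].
  by apply: integrableID; apply: integrableI_mulc => //;
    [exact: integrableI_lagr_p|exact: integrableI_lagr_u].
have L0i := integrableI_lagr eps aw.
have gi : integrableI (fun x => w x ^+ 2 + psi x ^+ 2 + 1).
  by apply: integrableID; [exact: integrableID|exact: integrableI_cst].
rewrite FtE -integralIZ // -integralIB // -integralIB //;
  [|exact: integrableIB|exact: integrableIZ].
apply: le_trans (integralI_norm _) _; first by apply: integrableIB;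
  [exact: integrableIB|exact: integrableIZ].
rewrite mulrAC -integralIZ //; apply: integralI_le; [by apply: integrableI_norm;
  apply: integrableIB; [exact: integrableIB|exact: integrableIZ]|exact: integrableIZ|].
move=> x xI.
have [a0 a1 a2 a3 a4] := CAP x t xI tt; have [_ _ b2] := CBP x t xI tt.
set A := lagrA (_ + _) _ in a2 a3 a4; set A0 := lagrA _ _ in a0 a3 a4;
  set A1 := _ * z x - _ * e x in a1 a4.
set B := lagrB _ (_ + _) _ in b2; set B0 := lagrB _ _ _ in b2; set B1 := _ * z x + _ * e x in b2.
have -> : Lt x - lagr eps (U w x) (prim w x) (w x) - t * D x =
   w x ^+ 2 * (A - A0 - t * A1) + 2 * t * (w x * psi x) * (A - A0) + t ^+ 2 * (psi x ^+ 2 * A)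
   + (B - B0 - t * B1).
  by rewrite /Lt /D /lagr /lagr_p_along /lagr_u_along /lagr_p /lagr_u -/A -/A0 -/B -/B0 /A1 /B1;
    ring.
exact: variation_bound a4 a3 a2 b2.
Qed.

End Variation.

Lemma lagr_u_alongN w x : adm w -> lagr_u_along w (- x) = lagr_u_along w x.
Proof.
move=> aw; have [wi _ we _ _] := aw.
have Ue : U w (- x) = U w x.
  by rewrite /profile prim_odd //; [exact: integrableI_prim|move=> t _;
    exact: (admissible_primN t aw)].
by rewrite /lagr_u_along Ue (admissible_primN x aw) we /lagr_u arclN.
Qed.

Lemma profileN w x : adm w -> U w (- x) = U w x.
Proof.
move=> aw; have [wi _ _ _ _] := aw.
by rewrite /profile prim_odd //; [exact: integrableI_prim|move=> t _;
  exact: (admissible_primN t aw)].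
Qed.

Lemma lagr_p_alongN w x : adm w -> lagr_p_along w (- x) = - lagr_p_along w x.
Proof.
move=> aw; have [_ _ we _ _] := aw.
by rewrite /lagr_p_along (profileN x aw) (admissible_primN x aw) we /lagr_p arclN; ring.
Qed.

(** Integrating the Euler-Lagrange equation [(L_k)'' - (L_p)' + L_u = 0] twice, where
    [L_k = 2 lagrA w], gives [L_k = Psi + EL_cst]. Subtracting half the integral makes [Phi] the odd
    primitive of [L_u], so [Psi] is even; [EL_cst] gives the residual mean zero. Both properties
    make the residual an admissible direction. *)
Definition Phi w x := prim (lagr_u_along w) x - 2^-1 * integralI (lagr_u_along w).
Definition Psi w x := prim (fun x => lagr_p_along w x - Phi w x) x.
Definition EL_cst w := 2^-1 * integralI (fun x => 2 * lagrA (U w x) (prim w x) * w x - Psi w x).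

(* The Euler-Lagrange equation: testing with [psi = 2 lagrA w - Psi - c], two
   integrations by parts turn the first variation into the integral of [psi^2]. *)
Lemma euler_lagrange w : adm w -> (forall w', adm w' -> F w <= F w') ->
  exists N : set R, [/\ measurable N, mu N = 0%E & forall x, -1 <= x <= 1 -> ~ N x ->
    w x = (Psi w x + EL_cst w) / (2 * lagrA (U w x) (prim w x))].
Proof.
move=> aw minw; have [wi w2 we w0 _] := aw.
have uc := @continuous_profile R alpha w wi; have pc := continuous_prim wi.
have fui := integrableI_lagr_u aw; have fpi := integrableI_lagr_p aw.
have Phic : continuous (Phi w).
  by apply: contD; [exact: continuous_prim|exact: contC].
have Phii := continuous_integrableI Phic.
have gi : integrableI (fun x => lagr_p_along w x - Phi w x) by exact: integrableIB.
have Psic : continuous (Psi w) := continuous_prim gi.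
have Ac : continuous (fun x => lagrA (U w x) (prim w x)) by exact: continuous_lagrA.
have Ac2 : continuous (fun x => 2 * lagrA (U w x) (prim w x)) by apply: contM => //; exact: contC.
pose c := EL_cst w.
pose psi x := 2 * lagrA (U w x) (prim w x) * w x - Psi w x - c.
have Awi : integrableI (fun x => 2 * lagrA (U w x) (prim w x) * w x).
  by apply: eq_integrableI (integrableI_mulc wi Ac2) => x _; rewrite mulrC.
have Psii := continuous_integrableI Psic.
have si : integrableI psi by apply: integrableIB; [exact: integrableIB|exact: integrableI_cst].
have s2 : integrableI (fun x => psi x ^+ 2).
  apply: integrableI_sqrB; [exact: integrableIB|exact: integrableI_cst| |exact: integrableI_cst].
  apply: integrableI_sqrB => //; last by apply: continuous_integrableI; exact: contX.
  by apply: eq_integrableI (integrableI_mulc w2 (contX (n := 2) Ac2)) => x _; ring.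
have s0 : integralI psi = 0.
  rewrite integralIB; [|exact: integrableIB|exact: integrableI_cst].
  by rewrite integralI_cst /c /EL_cst mulrAC mulVf ?mul1r ?subrr.
have Phio x : Phi w (- x) = - Phi w x.
  rewrite /Phi prim_opp // (eq_prim (g := lagr_u_along w)); last by move=> t _;
    exact: lagr_u_alongN.
  by field.
have se x : psi (- x) = psi x.
  rewrite /psi (profileN x aw) (admissible_primN x aw) we /lagrA arclN /Psi prim_odd //.
  by move=> t _; rewrite lagr_p_alongN // Phio; ring.
have [t0 [K [t00 tU tF]]] := first_variation aw si s2.
set delta := integralI _ in tF.
have at_ t : `|t| <= t0 -> adm (fun x => w x + t * psi x).
  move=> tt; split.
  - by apply: integrableID => //; exact: integrableIZ.
  - by apply: integrableI_sqrD => //; [exact: integrableIZ|exact: integrableI_sqrZ].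
  - by move=> x; rewrite we se.
  - by rewrite integralID ?integralIZ ?w0 ?s0 ?mulr0 ?addr0 //; exact: integrableIZ.
  - exact: tU.
have d0 : delta = 0.
  apply: (critical_eq0 t00 (K := K)) => t tt.
  have h1 := tF t tt; have h2 := minw _ (at_ t tt).
  have := le_trans (ler_norm _) h1.
  by move: h2; move: (F w) (F _) => X Y; lra.
have ei : integrableI (prim psi) := integrableI_prim si.
have e0 : integralI (prim psi) = 0 by apply: integralI_odd => // t _; apply: prim_even => // s _;
  exact: se.
(* The boundary terms of both integrations by parts vanish: [prim psi] has mean zero because it is
   odd, [psi] by the choice of [EL_cst]. *)
have ibp1 := prim_prod (- (2^-1 * integralI (lagr_u_along w))) 0 fui ei.
have ibp2 := prim_prod 0 0 gi si.
have E1 : integralI (fun x => lagr_u_along w x * prim (prim psi) x) = - integralI (fun x =>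
  prim psi x * Phi w x).
  rewrite -(eq_integralI (f := fun x => lagr_u_along w x * (0 + prim (prim psi) x))) => [|x _];
    last by rewrite add0r.
  rewrite ibp1 e0 addr0 !mulr0 subrr sub0r; congr (- _); apply: eq_integralI => x _.
  by rewrite /Phi; ring.
have E2 : integralI (fun x => (lagr_p_along w x - Phi w x) * prim psi x) = - integralI (fun x =>
  psi x * Psi w x).
  rewrite -(eq_integralI (f := fun x => (lagr_p_along w x - Phi w x) * (0 + prim psi x))) =>
    [|x _]; last by rewrite add0r.
  rewrite ibp2 s0 addr0 !mulr0 subrr sub0r; congr (- _); apply: eq_integralI => x _.
  by rewrite /Psi add0r.
have ec := continuous_prim si; have zc := continuous_prim ei.
have i1 : integrableI (fun x => lagr_p_along w x * prim psi x) by exact: integrableI_mulc.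
have i2 : integrableI (fun x => lagr_u_along w x * prim (prim psi) x) by exact: integrableI_mulc.
have i3 : integrableI (fun x => prim psi x * Phi w x) by exact: integrableI_mulc.
have i4 : integrableI (fun x => psi x * Psi w x) by exact: integrableI_mulc.
have i5 : integrableI (fun x => 2 * w x * psi x * lagrA (U w x) (prim w x)).
  apply: (@eq_integrableI _ (fun x => psi x ^+ 2 + psi x * Psi w x + c * psi x)).
    by move=> x _; rewrite /psi; ring.
  by apply: integrableID; [exact: integrableID|exact: integrableIZ].
have E3 : integralI (fun x => lagr_p_along w x * prim psi x) - integralI (fun x =>
  prim psi x * Phi w x) =
   - integralI (fun x => psi x * Psi w x).
  by rewrite -integralIB // -E2; apply: eq_integralI => x _; ring.
have E4 : integralI (fun x => 2 * w x * psi x * lagrA (U w x) (prim w x)) =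
   integralI (fun x => psi x ^+ 2) + integralI (fun x => psi x * Psi w x).
  transitivity (integralI (fun x => psi x ^+ 2 + psi x * Psi w x + c * psi x)).
    by apply: eq_integralI => x _; rewrite /psi; ring.
  by rewrite integralID ?integralID ?integralIZ ?s0 ?mulr0 ?addr0 //;
    [exact: integrableID|exact: integrableIZ].
have psi0 : integralI (fun x => psi x ^+ 2) = 0.
  rewrite -d0 /delta integralID //; last exact: integrableID.
  by rewrite integralID // E1 E3 E4 addrK.
have [N [mN N0 NP]] := integrableI_sqr_eq0 s2 psi0.
exists N; split => // x xI xN; have := NP x xI xN; rewrite /psi => h.
have A0 : 2 * lagrA (U w x) (prim w x) != 0 by rewrite gt_eqF // mulr_gt0 // lagrA_ge0 // profile_gt0.
apply: (mulIf A0); rewrite divfK // mulrC; apply/eqP; rewrite -subr_eq0 opprD addrA.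
exact/eqP.
Qed.

End EulerLagrange.

(** * Bootstrapping to smoothness, and the theorem *)

Section Smoothness.
Variable R : realType.
Implicit Types (x y t k : R).

Section Generated.
Variable G : (R -> R) -> Prop.

(** Only sums and products are closure rules. Reciprocals and [arcl u'] enter as generators, so
    stability under derivation has to be checked on generators alone. *)
Inductive generated : (R -> R) -> Prop :=
| generated_in (f : R -> R) : G f -> generated f
| generated_cst k : generated (fun=> k)
| generated_add (f g : R -> R) : generated f -> generated g -> generated (fun x => f x + g x)
| generated_mul (f g : R -> R) : generated f -> generated g -> generated (fun x => f x * g x).

Hypothesis G_cont : forall f, G f -> continuous f.
Hypothesis G_derive : forall f, G f ->
  exists2 g, generated g & forall x, -1 < x < 1 -> is_derive x 1 f (g x).

Lemma continuous_generated f : generated f -> continuous f.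
Proof.
elim=> {f} [f /G_cont //|k|f g _ fc _ gc|f g _ fc _ gc]; first exact: contC.
  exact: contD. exact: contM.
Qed.

Lemma generated_derive f : generated f ->
  exists2 g, generated g & forall x, -1 < x < 1 -> is_derive x 1 f (g x).
Proof.
elim=> {f} [f /G_derive //|k|f g gf [f' gf' df] gg [g' gg' dg]|f g gf [f' gf' df] gg [g' gg' dg]].
- by exists (fun=> 0); [exact: generated_cst|move=> x _; exact: is_derive_cst].
- exists (fun x => f' x + g' x); first exact: generated_add.
  by move=> x xI; exact: is_deriveD (df x xI) (dg x xI).
- exists (fun x => f x * g' x + g x * f' x).
    by apply: generated_add; exact: generated_mul.
  by move=> x xI; exact: is_deriveM (df x xI) (dg x xI).
Qed.

(** A derivation chosen on the algebra is iterated. Its iterates are continuous on the whole line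
    and agree with the classical derivatives inside, so they are the continuous extensions required
    up to the end points. *)
Lemma generated_smooth f : generated f -> smooth_closed f.
Proof.
move=> gf; split; first exact: continuous_subspaceT (continuous_generated gf).
have [gn [gng gnE]] : exists gn : nat -> R -> R, (forall n, generated (gn n)) /\
    forall n x, -1 < x < 1 -> iter n (@derive1 R R) f x = gn n x.
  have [s sP] : {s : {f : R -> R | generated f} -> {f : R -> R | generated f} &
      forall a x, -1 < x < 1 -> is_derive x 1 (sval a) (sval (s a) x)}.
    apply: (@choice _ _ (fun (a b : {f : R -> R | generated f}) =>
      forall x, -1 < x < 1 -> is_derive x 1 (sval a) (sval b x))) => -[a ga] /=.
    by have [b gb ab] := generated_derive ga; exists (exist _ b gb).
  exists (fun n => sval (iter n s (exist _ f gf))); split => [n|]; first exact: svalP.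
  elim=> [//|n IH] x xI; rewrite iterS derive1E.
  by have [_] := near_eq_is_derive IH xI (sP _ x xI).
move=> n; have dn x : -1 < x < 1 -> derivable (iter n (@derive1 R R) f) x 1.
  move=> xI; have [g _ dg] := generated_derive (gng n).
  by have [] := near_eq_is_derive (gnE n) xI (dg x xI).
split=> //; exists (gn n); split; first exact: continuous_subspaceT (continuous_generated (gng n)).
by move=> x xI; rewrite gnE.
Qed.

End Generated.

Variables alpha eps : R.
Hypothesis eps0 : 0 <= eps.
Local Notation U := (profile alpha).
Local Notation F := (energy alpha eps).
Local Notation adm := (admissible alpha).

(* The Euler-Lagrange equation makes (u, u', Psi, Phi) solve an autonomous system
   whose right-hand side is polynomial in these functions, [1/u], [arcl u'] and
   its inverse, so the algebra they generate is stable under derivation. *)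
Lemma minimizer_smooth w : adm w -> (forall w', adm w' -> F w <= F w') ->
  smooth_closed (U w).
Proof.
move=> aw minw; have [N [mN N0 NP]] := euler_lagrange aw minw.
have [wi _ _ _ _] := aw.
have uc := @continuous_profile R alpha w wi; have pc := continuous_prim wi;
  have qc := continuous_arcl_comp pc.
have u0 x : U w x != 0 by rewrite gt_eqF // profile_gt0.
have q0 x : arcl (prim w x) != 0 by exact: arcl_neq0.
have fui := integrableI_lagr_u eps aw; have fpi := integrableI_lagr_p eps aw.
have Phic : continuous (Phi alpha eps w).
  by apply: contD; [exact: continuous_prim|exact: contC].
have gi : integrableI (fun x => lagr_p_along alpha eps w x - Phi alpha eps w x).
  by apply: integrableIB => //; exact: continuous_integrableI.
have Psic : continuous (Psi alpha eps w) := continuous_prim gi.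
pose r x := (arcl (prim w x))^-1; pose iu x := (U w x)^-1.
have rc : continuous r by exact: contV.
have iuc : continuous iu by exact: contV.
(* The continuous representative of [w] read off from the Euler-Lagrange equation. It has the same
   primitive, and may replace [w] under every integral. *)
pose W x := (Psi alpha eps w x + EL_cst alpha eps w) * (2^-1 * (iu x * (arcl (prim w x)) ^+ 5)).
have WE x : W x = (Psi alpha eps w x + EL_cst alpha eps w) / (2 * lagrA (U w x) (prim w x)).
  by rewrite /W /lagrA /iu; field; rewrite u0 q0.
have Wc : continuous W.
  apply: contM; first by apply: contD => //; exact: contC.
  by apply: contM; [exact: contC|apply: contM => //; exact: contX].
have wW x : -1 <= x <= 1 -> ~ N x -> w x = W x by move=> xI xN; rewrite WE; exact: NP.
have PW : prim w = prim W by apply/funext => x;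
  exact: ae_eq_prim mN N0 wi (continuous_integrableI Wc) wW.
pose gu x := lagr_u eps (U w x) (prim w x) (W x).
pose gp x := lagr_p eps (U w x) (prim w x) (W x) - Phi alpha eps w x.
pose G f := f = U w \/ f = prim w \/ f = iu \/ f = r \/ f = (fun x => arcl (prim w x)) \/
  f = Phi alpha eps w \/ f = Psi alpha eps w.
have G1 : generated G (U w) by apply: generated_in; left.
have G2 : generated G (prim w) by apply: generated_in; right; left.
have G3 : generated G iu by apply: generated_in; right; right; left.
have G4 : generated G r by apply: generated_in; right; right; right; left.
have G5 : generated G (fun x => arcl (prim w x)) by apply: generated_in; do 4 right; left.
have G6 : generated G (Phi alpha eps w) by apply: generated_in; do 5 right; left.
have G7 : generated G (Psi alpha eps w) by apply: generated_in; do 6 right.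
have gX f n : generated G f -> generated G (fun x => f x ^+ n).
  move=> gf; elim: n => [|n IH]; first exact: generated_cst.
  have -> : (fun x => f x ^+ n.+1) = (fun x => f x * f x ^+ n) by apply/funext => x; rewrite exprS.
  exact: generated_mul.
have gZ k f : generated G f -> generated G (fun x => k * f x).
  by move=> gf; apply: generated_mul => //; exact: generated_cst.
have gN f : generated G f -> generated G (fun x => - f x).
  move=> /(gZ (-1)); congr (generated G _); apply/funext => x; exact: mulN1r.
have GW : generated G W.
  apply: generated_mul; first by apply: generated_add => //; exact: generated_cst.
  by apply: (gZ 2^-1); apply: generated_mul => //; exact: gX.
have Ggu : generated G gu.
  apply: generated_add; last by apply: (gZ (4 * eps)).
  apply: generated_add; first by apply: generated_mul; exact: gX.
  by apply: gN; apply: generated_mul => //; exact: (gX iu).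
have Ggp : generated G gp.
  apply: generated_add; last exact: gN.
  apply: generated_add; last by apply: (gZ (4 * eps)); apply: generated_mul => //;
    exact: generated_mul.
  apply: generated_add.
    apply: generated_mul; last exact: gX.
    apply: gN; apply: generated_mul; last exact: (gX r).
    by apply: generated_mul => //; exact: gZ.
  apply: gN; apply: generated_mul; last exact: (gX r).
  by apply: (generated_mul G3 G2).
have Gc f : G f -> continuous f.
  by case=> [->|[->|[->|[->|[->|[->|->]]]]]].
have du x : -1 < x < 1 -> is_derive x 1 (U w) (prim w x).
  move=> xI; have := is_deriveD (is_derive_cst alpha x 1) (prim_derive (integrableI_prim wi) xI (pc x)).
  by rewrite add0r.
have dp x : -1 < x < 1 -> is_derive x 1 (prim w) (W x).
  by move=> xI; rewrite PW; exact: prim_derive (continuous_integrableI Wc) xI (Wc x).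
have dq x : -1 < x < 1 -> is_derive x 1 (fun x => arcl (prim w x)) (prim w x * r x * W x).
  by move=> xI; exact: is_derive1_comp (arcl_derive (prim w x)) (dp x xI).
have guc : continuous gu by exact: continuous_generated Ggu.
have gpc : continuous gp by exact: continuous_generated Ggp.
have dPhi x : -1 < x < 1 -> is_derive x 1 (Phi alpha eps w) (gu x).
  move=> xI; have e : prim (lagr_u_along alpha eps w) = prim gu.
    apply/funext => y; apply: ae_eq_prim mN N0 fui (continuous_integrableI guc) _ => t tI tN.
    by rewrite /lagr_u_along /gu (wW t tI tN).
  have := is_deriveD (prim_derive (continuous_integrableI guc) xI (guc x))
    (is_derive_cst (- (2^-1 * integralI (lagr_u_along alpha eps w))) x 1).
  by rewrite addr0 -e.
have dPsi x : -1 < x < 1 -> is_derive x 1 (Psi alpha eps w) (gp x).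
  move=> xI; have e : Psi alpha eps w = prim gp.
    apply/funext => y; apply: ae_eq_prim mN N0 gi (continuous_integrableI gpc) _ => t tI tN.
    by rewrite /lagr_p_along /gp (wW t tI tN).
  by rewrite {1}e; exact: prim_derive (continuous_integrableI gpc) xI (gpc x).
apply: (generated_smooth Gc _ G1) => f.
case=> [->|[->|[->|[->|[->|[->|->]]]]]].
- by exists (prim w).
- by exists W.
- exists (fun x => - (iu x ^+ 2) * prim w x).
    by apply: generated_mul => //; apply: gN; exact: gX.
  move=> x xI; have := is_deriveV (u0 x) (du x xI).
  by rewrite /iu exprVn.
- exists (fun x => - (r x ^+ 2) * (prim w x * r x * W x)).
    apply: generated_mul; first by apply: gN; exact: gX.
    by apply: generated_mul => //; exact: generated_mul.
  move=> x xI; have := @is_deriveV R (fun x => arcl (prim w x)) x _ 1 (q0 x) (dq x xI).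
  by rewrite /r exprVn.
- exists (fun x => prim w x * r x * W x) => //.
  by apply: generated_mul => //; exact: generated_mul.
- by exists gu.
- by exists gp.
Qed.

(** The left side is the bound [pi * (4 + eps)] divided by the factor [pi / 2] between [Helfrich]
    and [energy]. Squaring reduces the inequality to [0 <= eps * (8 - eps)]. *)
Lemma threshold_le : eps <= 4 -> 2 * (4 + eps) <= 8 * Num.sqrt (1 + eps).
Proof.
move=> e4; set s := Num.sqrt _.
have s0 : 0 <= s by exact: sqrtr_ge0.
have s2 : s ^+ 2 = 1 + eps by rewrite sqr_sqrtr // addr_ge0.
rewrite (_ : 8 * s = 2 * (4 * s)); last by ring.
rewrite ler_pM2l // -(@ler_pXn2r _ 2) ?nnegrE ?addr_ge0 ?mulr_ge0 //.
rewrite exprMn s2; have := mulr_ge0 eps0 (_ : 0 <= 8 - eps).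
rewrite subr_ge0 => /(_ (ltac:(lra))); nra.
Qed.

End Smoothness.

Unset Implicit Arguments.

Theorem theorem3p3 (R : realType) (alpha eps : R) :
  0 < alpha -> 0 <= eps <= 4 ->
  (exists v : R -> R, N_alpha alpha v /\
     (Helfrich eps v < (pi * (4 + eps))%:E)%E) ->
  exists u : R -> R, [/\ N_alpha alpha u,
     (forall w : R -> R, N_alpha alpha w -> (Helfrich eps u <= Helfrich eps w)%E)
   & smooth_closed u].
Proof.
move=> alpha0 /andP[eps0 eps4] [v [Nv Hv]].
have [w0 aw0 vE] := N_alpha_admissible Nv.
have pi0 : 0 < pi :> R := pi_gt0 R.
have F0 : energy alpha eps w0 < 8 * Num.sqrt (1 + eps).
  apply: lt_le_trans (threshold_le eps0 eps4).
  move: Hv; rewrite (HelfrichE eps aw0 vE) lte_fin -mulrA ltr_pM2l //.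
  by rewrite ltr_pdivrMl.
have [w aw minw] := minimizer alpha0 eps0 aw0 F0.
exists (profile alpha w); split.
- exact: admissible_N_alpha.
- move=> w' Nw'; have [w1 aw1 w1E] := N_alpha_admissible Nw'.
  rewrite (HelfrichE eps aw1 w1E) (HelfrichE eps aw (fun x _ => erefl)).
  rewrite lee_fin ler_pM2l ?divr_gt0 //; exact: minw.
- exact: minimizer_smooth minw.
Qed.
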